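(* Let $\mathcal X\subseteq\mathbb R^d$, $\mathcal Y\subseteq\mathbb R^m$ be nonempty closed convex sets with diameters at most $R>0$ and $R'>0$ respectively. Let $f:\mathcal X\times\mathcal Y\to\mathbb R$ be $L$-smooth, convex in $x$ for every $y$, and $\mu$-strongly-concave in $y$ for every $x$, with $0<\mu\le L$; let $F(x)=\max_{y\in\mathcal Y}f(x,y)$ and $\epsilon>0$. Then RECAPP with additive error (given in the context), with $\lambda=\mu$, a suitable $T=O(R\sqrt{\mu/\epsilon})$, and accelerated gradient descent used to implement the best-response computations, outputs $x\in\mathcal X$ with $\mathbb E F(x)-\min_{x'\in\mathcal X}F(x')\le\epsilon$, and has expected gradient query complexity $$O\left(\frac{LR}{\sqrt{\mu\epsilon}}+\frac L\mu\log\frac L\mu+\sqrt{\frac L\mu}\log\frac{R'}{R}+R\sqrt{\frac L\epsilon}\,\log\frac{L(R+R')^2}{\epsilon}\right).$$ Further, if $F$ is $\gamma$-strongly-convex with $0<\gamma\le\mu$, then restarted RECAPP with additive error (given in the context), with $\lambda=\mu$ and suitable $T=O(\sqrt{\mu/\gamma})$, $K=O(\log(LR^2/\epsilon))$, finds $x\in\mathcal X$ with $\mathbb E F(x)-\min_{x'\in\mathcal X}F(x')\le\epsilon$ and has expected gradient query complexity $$O\left(\frac{L}{\sqrt{\mu\gamma}}\log\frac{LR^2}{\epsilon}+\frac L\mu\log\frac L\mu+\sqrt{\frac L\mu}\log\frac{R'}{R}+\sqrt{\frac L\gamma}\,\log\left(\frac{\mu L(R+R')^2}{\gamma\epsilon}\right)\log\frac{LR^2}{\epsilon}\right).$$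 The constants hidden in $O(\cdot)$ are universal.
   Context: A gradient query is one evaluation of $\nabla f(x,y)=(\nabla_xf,\nabla_yf)$ at a point of $\mathcal X\times\mathcal Y$. Inside $O(\cdot)$, $\log z$ is read as $\max\{1,\log z\}$. $L$-smooth means $\nabla f$ is $L$-Lipschitz (Euclidean norms); $\mu$-strongly-concave means the negative is $\mu$-strongly-convex; $F$ is $\gamma$-strongly-convex if $F(x')\ge F(x)+\langle\nabla F(x),x'-x\rangle+\frac\gamma2\|x'-x\|^2$ on $\mathcal X$. Let $y^{\rm br}_x=\arg\max_{y\in\mathcal Y}f(x,y)$, so $\nabla F(x)=\nabla_xf(x,y^{\rm br}_x)$. $V^{\mathrm e}_x(x')=\frac12\|x'-x\|^2$; $\mathrm{Proj}$ is Euclidean projection. AGD: Nesterov's accelerated (projected) gradient method for the $L$-smooth $\mu$-strongly-concave problem $\max_{y\in\mathcal Y}f(x,y)$. MirrorProx$(\phi,M,x_{\rm init},y_{\rm init},N)$ for convex-concave $\phi$ with $M$-Lipschitz gradient: $\eta=1/M$, $(x_0,y_0)=(x_{\rm init},y_{\rm init})$; for $t=0,\dots,N-1$: $u_t=\mathrm{Proj}_{\mathcal X}(x_t-\eta\nabla_x\phi(x_t,y_t))$, $v_t=\mathrm{Proj}_{\mathcal Y}(y_t+\eta\nabla_y\phi(x_t,y_t))$, $x_{t+1}=\mathrm{Proj}_{\mathcal X}(x_t-\eta\nabla_x\phi(u_t,v_t))$, $y_{t+1}=\mathrm{Proj}_{\mathcal Y}(y_t+\eta\nabla_y\phi(u_t,v_t))$;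 return the averages $\frac1N\sum_{t<N}u_t$, $\frac1N\sum_{t<N}v_t$. $\mathrm{ApproxProx}^\delta(s;x_{\rm init},x_{\rm prev})$: use AGD to find $y_{\rm init}\in\mathcal Y$ with $f(x_{\rm prev},y^{\rm br}_{x_{\rm prev}})-f(x_{\rm prev},y_{\rm init})\le\delta$; run MirrorProx on $\phi(x,y)=f(x,y)+\frac\mu2\|x-s\|^2$ with $M=L+\mu$ from $(x_{\rm init},y_{\rm init})$ for $\lceil64(L+\mu)/\mu\rceil$ iterations; return the $x$-component. $\mathrm{UnbiasedProx}^\delta(s;x_{\rm prev})$: with $\delta_j=2^{-3-2j}\delta$, $x^{(0)}=\mathrm{ApproxProx}^{\delta_0}(s;s,x_{\rm prev})$; sample $J\in\{2,3,\dots\}$ with $\mathbb P[J=j]=2^{-(j-1)}$; for $j=1,\dots,J$, $x^{(j)}=\mathrm{ApproxProx}^{\delta_j}(s;x^{(j-1)},x^{(j-1)})$; return $x^{(1)}+2^{J-1}(x^{(J)}-x^{(J-1)})$. WarmStart: from an arbitrary $(x_{\rm init},y_{\rm init})\in\mathcal X\times\mathcal Y$, use AGD to find $y'_{\rm init}$ with $f(x_{\rm init},y^{\rm br}_{x_{\rm init}})-f(x_{\rm init},y'_{\rm init})\le\frac12LR^2$; with $\phi(x,y)=f(x,y)+\frac\mu2\|x-x_{\rm init}\|^2$, start at $(x_{\rm init},y'_{\rm init})$ and perform $O(\log(L/\mu))$ successive calls of MirrorProx$(\phi,L+\mu,\cdot,\cdot,N)$, $N=O(L/\mu)$, each started at the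 output of the previous one; return the final $x$-component. RECAPP with additive error (parameters $\lambda=\mu$, $T$): $\alpha_0=1$, $x_0=v_0=$ output of WarmStart. For $t=0,\dots,T-1$: let $\alpha_{t+1}\in[0,1]$ satisfy $\frac1{\alpha_{t+1}^2}-\frac1{\alpha_{t+1}}=\frac1{\alpha_t^2}$; $s_t=(1-\alpha_{t+1})x_t+\alpha_{t+1}v_t$; $\delta_{t+1}=\frac{1}{4(t+1)^2}\alpha_{t+1}^2\lambda R^2$; $x_{t+1}=\mathrm{ApproxProx}^{\delta_{t+1}}(s_t;s_t,x_t)$; $\tilde x_{t+1}=\mathrm{UnbiasedProx}^{\delta_{t+1}}(s_t;x_t)$; $v_{t+1}=\mathrm{Proj}_{\mathcal X}\left(v_t-\frac1{\alpha_{t+1}}(s_t-\tilde x_{t+1})\right)$. Return $x_T$. Restarted RECAPP with additive error (parameters $\lambda=\mu$, $T$, $K$): $x^{(0)}=$ output of WarmStart. For $k=1,\dots,K$: set $\alpha_0=1$ and $x_0=v_0=x^{(k-1)}$ (no warm start); for $t=0,\dots,T-1$: let $\alpha_{t+1}\in[0,1]$ satisfy $\frac1{\alpha_{t+1}^2}-\frac1{\alpha_{t+1}}=\frac1{\alpha_t^2}$; $s_t=(1-\alpha_{t+1})x_t+\alpha_{t+1}v_t$; $x_{t+1}=\mathrm{ApproxProx}^{\delta^{(k)}_{t+1}}(s_t;s_t,x_t)$; $\tilde x_{t+1}=\mathrm{UnbiasedProx}^{\delta^{(k)}_{t+1}}(s_t;x_t)$; $v_{t+1}=\mathrm{Proj}_{\mathcal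 X}\left(v_t-\frac1{\alpha_{t+1}}(s_t-\tilde x_{t+1})\right)$, where $\delta^{(k)}_t=2^{-k}\frac1{4t^2}\alpha_t^2\lambda R^2$ for $t\ge1$; then set $x^{(k)}=x_T$. Return $x^{(K)}$. *)

(* Defs.v *)
From HB Require Import structures.
From mathcomp Require Export all_boot all_order all_algebra.
From mathcomp Require Export all_classical all_reals all_analysis.
Export numFieldNormedType.Exports.
Export Order.TTheory GRing.Theory Num.Theory.

Set Implicit Arguments.
Unset Strict Implicit.
Unset Printing Implicit Defensive.

Local Open Scope classical_set_scope.
Local Open Scope ring_scope.

Section Euclidean.
Variable R : realType.

Definition dot d (u v : 'rV[R]_d) : R := \sum_(i < d) u 0 i * v 0 i.

(* The library norm on 'rV[R]_d is the sup norm, hence this definition. *)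
Definition enorm d (u : 'rV[R]_d) : R := Num.sqrt (dot u u).

Definition enorm2 d m (p : 'rV[R]_d * 'rV[R]_m) : R :=
  Num.sqrt (dot p.1 p.1 + dot p.2 p.2).

Definition proj d (X : set 'rV[R]_d) (z : 'rV[R]_d) : 'rV[R]_d :=
  xget 0 [set p | X p /\ forall q, X q -> enorm (z - p) <= enorm (z - q)].

(* The logarithm as it is read inside O(.). *)
Definition logO (z : R) : R := Num.max 1 (ln z).

End Euclidean.

Section Problem.
Variables (R : realType) (d m : nat).
Implicit Types (X : set 'rV[R]_d) (Y : set 'rV[R]_m).
Implicit Types (f : 'rV[R]_d -> 'rV[R]_m -> R).

(* A gradient oracle: (x, y) |-> (nabla_x f (x, y), nabla_y f (x, y)). *)
Definition oracle := 'rV[R]_d -> 'rV[R]_m -> 'rV[R]_d * 'rV[R]_m.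

(* f is only meaningful on X x Y, so differentiability is relative to X x Y:
   f z' = f z + <g z, z' - z> + o(|z' - z|) for z' -> z inside X x Y. At interior
   points this is Frechet differentiability with gradient g z. *)
Definition is_gradient X Y f (g : oracle) : Prop :=
  forall x y, X x -> Y y ->
  forall e : R, 0 < e -> exists2 r : R, 0 < r &
  forall x' y', X x' -> Y y' -> enorm2 (x' - x, y' - y) <= r ->
    `|f x' y' - f x y - (dot (g x y).1 (x' - x) + dot (g x y).2 (y' - y))|
      <= e * enorm2 (x' - x, y' - y).

Definition lipschitz_gradient X Y (g : oracle) (L : R) : Prop :=
  forall x y x' y', X x -> Y y -> X x' -> Y y' ->
    enorm2 ((g x' y').1 - (g x y).1, (g x' y').2 - (g x y).2)
      <= L * enorm2 (x' - x, y' - y).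

Definition strongly_convex n (Z : set 'rV[R]_n) (h : 'rV[R]_n -> R)
    (dh : 'rV[R]_n -> 'rV[R]_n) (c : R) : Prop :=
  forall z z', Z z -> Z z' ->
    h z + dot (dh z) (z' - z) + c / 2 * enorm (z' - z) ^+ 2 <= h z'.

Definition strongly_concave n (Z : set 'rV[R]_n) (h : 'rV[R]_n -> R)
    (dh : 'rV[R]_n -> 'rV[R]_n) (c : R) : Prop :=
  strongly_convex Z (fun z => - h z) (fun z => - dh z) c.

Definition diameter_le n (Z : set 'rV[R]_n) (D : R) : Prop :=
  forall z z', Z z -> Z z' -> enorm (z - z') <= D.

(* argmax_{y in Y} f (x, y) *)
Definition best_response Y f (x : 'rV[R]_d) : 'rV[R]_m :=
  xget 0 [set y | Y y /\ forall y', Y y' -> f x y' <= f x y].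

(* F x = max_{y in Y} f (x, y) *)
Definition maxF Y f (x : 'rV[R]_d) : R := f x (best_response Y f x).

Definition gradF Y f (g : oracle) (x : 'rV[R]_d) : 'rV[R]_d :=
  (g x (best_response Y f x)).1.

(* min_{x in X} F x *)
Definition minF X Y f : R := inf [set maxF Y f x | x in X].

Record minimax_problem X Y (DX DY L mu : R) f (g : oracle) : Prop := {
  mp_X_nonempty : X !=set0;
  mp_Y_nonempty : Y !=set0;
  mp_X_closed : closed X;
  mp_Y_closed : closed Y;
  mp_X_convex : convex_set (X : set (convex_lmodType 'rV[R]_d));
  mp_Y_convex : convex_set (Y : set (convex_lmodType 'rV[R]_m));
  mp_X_diameter : diameter_le X DX;
  mp_Y_diameter : diameter_le Y DY;
  mp_gradient : is_gradient X Y f g;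
  mp_smooth : lipschitz_gradient X Y g L;
  mp_convex : forall y, Y y ->
    convex_function (X : set (convex_lmodType 'rV[R]_d)) (fun x => f x y);
  mp_concave : forall x, X x ->
    strongly_concave Y (fun y => f x y) (fun y => (g x y).2) mu
}.

End Problem.

(* A value together with the number of gradient queries spent computing it;
   [query] is the only operation with a nonzero cost, and the algorithms access
   the objective only through it. *)
Definition counted (A : Type) : Type := (A * nat)%type.

Definition ret A (a : A) : counted A := (a, 0%N).

Definition bind A B (c : counted A) (k : A -> counted B) : counted B :=
  ((k c.1).1, (c.2 + (k c.1).2)%N).

Notation "x <-- c ;; k" := (bind c (fun x => k))
  (at level 100, c at next level, right associativity).

(* Runs step 0, step 1, ..., step n.-1 in this order. *)
Fixpoint iterM A (n : nat) (step : nat -> A -> counted A) (a : A) : counted A :=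
  if n is n'.+1 then bind (iterM n' step a) (step n') else ret a.

Section Algorithms.
Variables (R : realType) (d m : nat).
Implicit Types (X : set 'rV[R]_d) (Y : set 'rV[R]_m) (g : oracle R d m).

Definition query g (x : 'rV[R]_d) (y : 'rV[R]_m) :
  counted ('rV[R]_d * 'rV[R]_m) := (g x y, 1%N).

(* Nesterov's accelerated projected gradient method, for max_{y in Y} f (x, y),
   in the form with linearly convergent constant momentum tau = sqrt (mu / L)
   that takes all gradients inside Y. As usual for constrained problems, it is
   preceded by one plain projected gradient step, which makes the initial gap
   at most L |y0 - y*|^2 / 2. *)
Definition agd Y g (L mu : R) (n : nat) (x : 'rV[R]_d) (y0 : 'rV[R]_m) :
    counted 'rV[R]_m :=
  let tau := Num.sqrt (mu / L) in
  p <-- query g x y0 ;;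
  let y1 := proj Y (y0 + L^-1 *: p.2) in
  r <-- iterM n (fun _ (st : 'rV[R]_m * 'rV[R]_m) =>
      let: (y, v) := st in
      let z := (1 + tau)^-1 *: (y + tau *: v) in
      p <-- query g x z ;;
      let w := (1 - tau) *: v + tau *: z in
      let v' := proj Y (w + (tau / mu) *: p.2) in
      ret ((1 - tau) *: y + tau *: v', v')) (y1, y1) ;;
  ret r.1.

(* The oracle of f (x, y) + mu / 2 * |x - s|^2, for g the oracle of f. *)
Definition regularize g (mu : R) (s : 'rV[R]_d) : oracle R d m :=
  fun x y => ((g x y).1 + mu *: (x - s), (g x y).2).

Definition mirror_prox X Y g (M : R) (xi : 'rV[R]_d) (yi : 'rV[R]_m) (N : nat) :
    counted ('rV[R]_d * 'rV[R]_m) :=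
  let eta := M^-1 in
  r <-- iterM N (fun _ (st : 'rV[R]_d * 'rV[R]_m * 'rV[R]_d * 'rV[R]_m) =>
      let: (x, y, su, sv) := st in
      p <-- query g x y ;;
      let u := proj X (x - eta *: p.1) in
      let v := proj Y (y + eta *: p.2) in
      q <-- query g u v ;;
      ret (proj X (x - eta *: q.1), proj Y (y + eta *: q.2), su + u, sv + v))
    (xi, yi, 0, 0) ;;
  ret (N%:R^-1 *: r.1.2, N%:R^-1 *: r.2).

(* In the procedures below, every best-response computation runs [agd] from the
   arbitrary point y_init, and [nagd delta] is the number of momentum steps
   used for the target accuracy delta. *)
Definition approx_prox X Y g (L mu : R) (y_init : 'rV[R]_m) (nagd : R -> nat)
    (delta : R) (s xi xprev : 'rV[R]_d) : counted 'rV[R]_d :=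
  yi <-- agd Y g L mu (nagd delta) xprev y_init ;;
  r <-- mirror_prox X Y (regularize g mu s) (L + mu) xi yi
          `|Num.ceil (64 * (L + mu) / mu)|%N ;;
  ret r.1.

(* The list xs holds x^(0), ..., x^(j); J is the sampled number of levels. *)
Definition unbiased_prox X Y g (L mu : R) (y_init : 'rV[R]_m) (nagd : R -> nat)
    (delta : R) (s xprev : 'rV[R]_d) (J : nat) : counted 'rV[R]_d :=
  let delta_ j := delta / 2 ^+ (3 + 2 * j) in
  x0 <-- approx_prox X Y g L mu y_init nagd (delta_ 0%N) s s xprev ;;
  xs <-- iterM J (fun i (xs : seq 'rV[R]_d) =>
      x <-- approx_prox X Y g L mu y_init nagd (delta_ i.+1) s
              (nth 0 xs i) (nth 0 xs i) ;;
      ret (rcons xs x)) [:: x0] ;;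
  ret (nth 0 xs 1 + 2 ^+ J.-1 *: (nth 0 xs J - nth 0 xs J.-1)).

Definition warm_start X Y g (L mu DX : R) (x_init : 'rV[R]_d)
    (y_init : 'rV[R]_m) (nagd : R -> nat) (W N : nat) : counted 'rV[R]_d :=
  y' <-- agd Y g L mu (nagd (L * DX ^+ 2 / 2)) x_init y_init ;;
  r <-- iterM W (fun _ (z : 'rV[R]_d * 'rV[R]_m) =>
      mirror_prox X Y (regularize g mu x_init) (L + mu) z.1 z.2 N)
    (x_init, y') ;;
  ret r.1.

(* These equations determine alpha uniquely. *)
Definition step_sizes (alpha : nat -> R) : Prop :=
  alpha 0%N = 1 /\
  forall t, 0 <= alpha t.+1 <= 1 /\
    (alpha t.+1 ^+ 2)^-1 - (alpha t.+1)^-1 = (alpha t ^+ 2)^-1.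

(* The T iterations from x_0 = v_0 = x0; J t is the level sampled by the call
   of UnbiasedProx in iteration t. *)
Definition recapp_loop X Y g (L mu : R) (y_init : 'rV[R]_m) (nagd : R -> nat)
    (alpha delta : nat -> R) (T : nat) (x0 : 'rV[R]_d) (J : nat -> nat) :
    counted 'rV[R]_d :=
  r <-- iterM T (fun t (st : 'rV[R]_d * 'rV[R]_d) =>
      let: (x, v) := st in
      let a := alpha t.+1 in
      let s := (1 - a) *: x + a *: v in
      x' <-- approx_prox X Y g L mu y_init nagd (delta t.+1) s s x ;;
      xt <-- unbiased_prox X Y g L mu y_init nagd (delta t.+1) s x (J t) ;;
      ret (x', proj X (v - a^-1 *: (s - xt)))) (x0, x0) ;;
  ret r.1.

(* The proximal parameter lambda is mu, here and in the restarted variant. *)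
Definition recapp X Y g (L mu DX : R) (x_init : 'rV[R]_d) (y_init : 'rV[R]_m)
    (nagd : R -> nat) (W N : nat) (alpha : nat -> R) (T : nat)
    (J : nat -> nat) : counted 'rV[R]_d :=
  x0 <-- warm_start X Y g L mu DX x_init y_init nagd W N ;;
  recapp_loop X Y g L mu y_init nagd alpha
    (fun t => (4 * t%:R ^+ 2)^-1 * alpha t ^+ 2 * mu * DX ^+ 2) T x0 J.

(* Step k of iterM is epoch
   k.+1, which uses the samples J (k * T), ..., J (k * T + T - 1). *)
Definition restarted_recapp X Y g (L mu DX : R) (x_init : 'rV[R]_d)
    (y_init : 'rV[R]_m) (nagd : R -> nat) (W N : nat) (alpha : nat -> R)
    (T K : nat) (J : nat -> nat) : counted 'rV[R]_d :=
  x0 <-- warm_start X Y g L mu DX x_init y_init nagd W N ;;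
  iterM K (fun k x =>
    recapp_loop X Y g L mu y_init nagd alpha
      (fun t => (2 ^+ k.+1)^-1 * (4 * t%:R ^+ 2)^-1 * alpha t ^+ 2 * mu * DX ^+ 2)
      T x (fun t => J (k * T + t)%N)) x0.

(* With nagd momentum steps, AGD meets every requested accuracy, from any
   starting point of Y. *)
Definition agd_accurate X Y (f : 'rV[R]_d -> 'rV[R]_m -> R) g (L mu : R)
    (nagd : R -> nat) : Prop :=
  forall (delta : R) x y, 0 < delta -> X x -> Y y ->
    maxF Y f x - f x (agd Y g L mu (nagd delta) x y).1 <= delta.

End Algorithms.

Section Sampling.
Context {dO : measure_display} {Omega : measurableType dO} {R : realType}
  (P : probability Omega R).

Definition mutually_independent (J : nat -> {RV P >-> nat}) : Prop :=
  forall (s : seq nat) (A : nat -> set nat), uniq s ->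
    P (\big[setI/setT]_(i <- s) (J i @^-1` A i)) =
    (\prod_(i <- s) P (J i @^-1` A i))%E.

Definition level_law (X : {RV P >-> nat}) : Prop :=
  forall j : nat, (2 <= j)%N -> P (X @^-1` [set j]) = ((2 ^+ j.-1)^-1)%:E.

Definition level_samples (J : nat -> {RV P >-> nat}) : Prop :=
  mutually_independent J /\ forall i, level_law (J i).

End Sampling.

(* Main.v *)
Require Import Defs.
From mathcomp Require Import measurable_realfun.
From mathcomp Require Import zify ring lra.

Set Implicit Arguments.
Unset Strict Implicit.
Unset Printing Implicit Defensive.

Local Open Scope classical_set_scope.
Local Open Scope ring_scope.

(** Strong concavity in y makes a proximal step cheap to approximate. If p is
    the proximal point of s, the Bregman divergence of the primal function F
    from p to z is at least mu / 2 times the squared distance between the best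
    responses at p and z ([bregman_ge]): a dual variable that is nearly optimal
    for a point of small divergence is a good start for the saddle problem that
    defines p. Hence a single mirror-prox call of order L / mu iterations has a
    relative error. Its proximal gap is at most 1 / 16 of the sum of three terms:
    the divergence at the point where the dual start was computed, mu / 2 times
    the squared distance of the primal start to p, and the accuracy of the best
    response ([approx_prox_gap]).

    The accelerated proximal point method tolerates such errors. Its potential is
    alpha^-2 (F x - F u) + mu / 2 |v - u|^2, for u a minimizer of F. In an exact
    step this quantity decreases with a surplus that contains |s - p|^2 and the
    divergence at x, the very quantities that bound the relative errors, so
    only the additive accuracies remain ([recapp_drift]). The point v moves
    along an estimate of s - p, and this estimate must have no bias. Repeating
    the approximate step gives levels whose squared errors decrease like 4^-j;
    the difference of two consecutive levels, weighted by 2^(J - 1) and drawn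
    with probability 2^-(J - 1), telescopes to p in the mean ([unbiased_mean])
    and keeps a bounded second moment ([unbiased_second_moment]).

    The drift is a statement on finite sums over the levels, up to a remainder
    B / 2^n. As potentials are nonnegative, this is enough to integrate it along
    the run, where each level is independent of the past ([expectation_chain]);
    the same lemma integrates the number of queries. The accuracies are chosen
    so that the sum of delta_t / alpha_t^2 is of order mu DX^2, and the warm
    start ([warm_start_gap]) makes the initial potential of this order too.
    Since 1 / alpha_T >= 1 + T / 2, order DX sqrt (mu / eps) iterations
    suffice ([recapp_gap]). If F is gamma-strongly convex, the potential at
    the start of an epoch is at most 2 mu / gamma times the gap, so that order
    sqrt (mu / gamma) iterations halve the gap ([restarted_gap_bound]).

    An approximate step costs order L / mu queries for mirror-prox, plus
    sqrt (L / mu) times a logarithm of the accuracy for accelerated gradient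
    descent ([agd_gap]). A sampled level j costs at most order j^2 such steps
    and has probability 2^-(j - 1), so an iteration costs a bounded number of
    them in expectation ([recapp_step_expected_cost]). All accuracies are
    polynomial in the data, which bounds the logarithms ([num_iter_log],
    [epoch_log]). *)

(** * Euclidean geometry *)

Section Dot.
Variables (R : realType) (d : nat).
Implicit Types u v w : 'rV[R]_d.

Lemma dotC u v : dot u v = dot v u.
Proof. by apply: eq_bigr => i _; rewrite mulrC. Qed.

Lemma dotDl u v w : dot (u + v) w = dot u w + dot v w.
Proof.
by rewrite /dot -big_split; apply: eq_bigr => i _; rewrite mxE mulrDl.
Qed.

Lemma dotZl a u v : dot (a *: u) v = a * dot u v.
Proof. by rewrite /dot mulr_sumr; apply: eq_bigr => i _; rewrite mxE mulrA. Qed.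

Lemma dotNl u v : dot (- u) v = - dot u v.
Proof. by rewrite -scaleN1r dotZl mulN1r. Qed.

Lemma dotDr u v w : dot u (v + w) = dot u v + dot u w.
Proof. by rewrite dotC dotDl !(dotC u). Qed.

Lemma dotZr a u v : dot u (a *: v) = a * dot u v.
Proof. by rewrite dotC dotZl dotC. Qed.

Lemma dotNr u v : dot u (- v) = - dot u v.
Proof. by rewrite dotC dotNl dotC. Qed.

Lemma dot0l u : dot 0 u = 0.
Proof. by rewrite -(scale0r u) dotZl mul0r. Qed.

Lemma dot0r u : dot u 0 = 0.
Proof. by rewrite dotC dot0l. Qed.

Definition dotE := (dotDl, dotDr, dotNl, dotNr, dotZl, dotZr, dot0l, dot0r).

Lemma dot_ge0 u : 0 <= dot u u.
Proof. by apply: sumr_ge0 => i _; rewrite -expr2 sqr_ge0. Qed.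

Lemma enorm_ge0 u : 0 <= enorm u.
Proof. exact: sqrtr_ge0. Qed.

Lemma sqr_enorm u : enorm u ^+ 2 = dot u u.
Proof. by rewrite sqr_sqrtr // dot_ge0. Qed.

Lemma dot_subC u v : dot (u - v) (u - v) = dot (v - u) (v - u).
Proof. by rewrite !dotE (dotC u v); ring. Qed.

Lemma dot_young u v : dot u v <= (dot u u + dot v v) / 2.
Proof. by have := dot_ge0 (u - v); rewrite !dotE (dotC v u); lra. Qed.

Lemma dot_triangle u v w :
  dot (u - w) (u - w) <= 2 * dot (u - v) (u - v) + 2 * dot (v - w) (v - w).
Proof.
have -> : u - w = (u - v) + (v - w) by rewrite addrA subrK.
move: (u - v) (v - w) => a b; have := dot_ge0 (a - b).
rewrite !dotE (dotC b a); lra.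
Qed.

(** The square of enorm v *: u - enorm u *: v is nonnegative. When one of the
    norms vanishes this says nothing, and a large multiple of the vanishing
    vector takes its place. *)
Lemma cauchy_schwarz u v : dot u v <= enorm u * enorm v.
Proof.
have [u0|u0] := eqVneq (enorm u) 0.
  have uu : dot u u = 0 by rewrite -sqr_enorm u0 expr0n.
  rewrite u0 mul0r leNgt; apply/negP => uv0.
  pose t := (dot v v + 1) / dot u v.
  have := dot_ge0 (v - t *: u); rewrite !dotE (dotC v u) uu !mulr0.
  have -> : t * dot u v = dot v v + 1 by rewrite /t divfK // gt_eqF.
  by have := dot_ge0 v; lra.
have u_gt0 : 0 < enorm u by rewrite lt_neqAle eq_sym u0 enorm_ge0.
have [v0|v0] := eqVneq (enorm v) 0.
  have vv : dot v v = 0 by rewrite -sqr_enorm v0 expr0n.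
  rewrite v0 mulr0 leNgt; apply/negP => uv0.
  pose t := (dot u u + 1) / dot u v.
  have := dot_ge0 (u - t *: v); rewrite !dotE (dotC v u) vv !mulr0.
  have -> : t * dot u v = dot u u + 1 by rewrite /t divfK // gt_eqF.
  by have := dot_ge0 u; lra.
have v_gt0 : 0 < enorm v by rewrite lt_neqAle eq_sym v0 enorm_ge0.
have := dot_ge0 (enorm v *: u - enorm u *: v).
rewrite !dotE (dotC v u) -!sqr_enorm.
set a := enorm u in u_gt0 *; set b := enorm v in v_gt0 *; set c := dot u v.
have ab : 0 < a * b by rewrite mulr_gt0.
move=> h; rewrite -(ler_pM2l ab); nra.
Qed.

Lemma enormN u : enorm (- u) = enorm u.
Proof. by rewrite /enorm !dotE opprK. Qed.

Lemma enorm_subC u v : enorm (u - v) = enorm (v - u).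
Proof. by rewrite -enormN opprB. Qed.

Lemma enormD u v : enorm (u + v) <= enorm u + enorm v.
Proof.
rewrite -ler_sqr ?nnegrE ?addr_ge0 ?enorm_ge0 // sqrrD !sqr_enorm !dotE (dotC v u).
have := cauchy_schwarz u v; lra.
Qed.

Lemma enorm_dist u v w : enorm (u - w) <= enorm (u - v) + enorm (v - w).
Proof. by have := enormD (u - v) (v - w); rewrite addrA subrK. Qed.

Lemma enormZ a u : 0 <= a -> enorm (a *: u) = a * enorm u.
Proof.
by move=> a0; rewrite /enorm !dotE mulrA -expr2 sqrtrM ?sqr_ge0 // sqrtr_sqr ger0_norm.
Qed.

(** The topology of row vectors is that of the supremum norm: this comparison
    and the next one transfer boundedness and continuity. *)
Lemma norm_le_enorm u : `|u| <= enorm u.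
Proof.
have e0 := enorm_ge0 u.
rewrite [leLHS]mx_normrE; apply/bigmax_leP; split => //= -[i j] _ /=.
rewrite -(@ler_pXn2r _ 2) ?nnegrE // sqr_enorm real_normK ?num_real //.
rewrite [i]ord1 /dot (bigD1 j) //= expr2 lerDl.
by apply: sumr_ge0 => k _; rewrite -expr2 sqr_ge0.
Qed.

Lemma enorm_le_norm u : enorm u <= Num.sqrt d%:R * `|u|.
Proof.
rewrite -(@ler_pXn2r _ 2) ?nnegrE ?mulr_ge0 ?enorm_ge0 ?sqrtr_ge0 //.
rewrite sqr_enorm exprMn sqr_sqrtr ?ler0n //.
apply: (@le_trans _ _ (\sum_(i < d) `|u| ^+ 2)); last first.
  by rewrite sumr_const card_ord mulr_natl.
apply: ler_sum => i _; rewrite -expr2 -[X in X <= _]real_normK ?num_real //.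
rewrite ler_pXn2r ?nnegrE //.
rewrite [leRHS]mx_normrE.
exact: (le_bigmax _ (fun ij : 'I_1 * 'I_d => `|u ij.1 ij.2|%R) (ord0, i)).
Qed.

End Dot.

Section Minimizers.
Variables (R : realType) (d : nat).
Implicit Types (X : set 'rV[R]_d) (u v z : 'rV[R]_d).

Lemma diameter_compact X D :
  X !=set0 -> closed X -> diameter_le X D -> compact X.
Proof.
move=> [x0 Xx0] clX diamX; apply: bounded_closed_compact => //.
exists (`|x0| + D); split; first exact: num_real.
move=> M ltM x Xx /=; apply: le_trans (ltW ltM).
have -> : x = x0 + (x - x0) by rewrite addrC subrK.
apply: le_trans (ler_normD _ _) _; rewrite lerD2l.
exact: le_trans (norm_le_enorm _) (diamX _ _ Xx Xx0).
Qed.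

(** The Euclidean and supremum norms are equivalent, so h is continuous and the
    extreme value theorem applies. *)
Lemma lipschitz_argmin X (h : 'rV[R]_d -> R) B :
  X !=set0 -> compact X ->
  (forall x x', X x -> X x' -> h x - h x' <= B * enorm (x - x')) ->
  exists2 x, X x & forall x', X x' -> h x <= h x'.
Proof.
move=> X0 cX lip.
wlog B0 : B lip / 0 < B.
  move=> H; apply: (H (Num.max B 1)); last by rewrite lt_max ltr01 orbT.
  move=> x x' Xx Xx'; apply: le_trans (lip _ _ Xx Xx') _.
  by rewrite ler_wpM2r ?enorm_ge0 // le_max lexx.
have ctsh : {within X, continuous h}.
  apply/subspace_continuousP => x Xx; apply/cvgrPdist_le => e e0.
  pose K : R := B * (Num.sqrt d%:R + 1).
  have K0 : 0 < K by rewrite mulr_gt0 // ltr_wpDl ?sqrtr_ge0.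
  near=> y.
  have Xy : X y by near: y; exact: withinT.
  have xy : enorm (x - y) * B <= e.
    have : `|x - y| <= e / K.
      near: y; apply: cvg_within.
      have /cvgrPdist_le/(_ (e / K)) := @cvg_id _ (nbhs x); apply.
      by rewrite divr_gt0.
    rewrite ler_pdivlMr // => h1; apply: le_trans h1.
    have := enorm_le_norm (x - y).
    have := normr_ge0 (x - y); rewrite /K; nra.
  change (`|h x - h y| <= e).
  rewrite ler_norml; have := lip _ _ Xx Xy; have := lip _ _ Xy Xx.
  by rewrite (enorm_subC y x); lra.
have [c /set_mem Xc cmin] := EVT_min_rV X0 cX ctsh.
by exists c => // x' Xx'; apply: cmin; rewrite inE.
Unshelve. all: by end_near. Qed.

(** Convexity with plain real weights in place of an interval type. *)
Definition segment_closed X := forall u v (t : R), X u -> X v ->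
  0 <= t -> t <= 1 -> X ((1 - t) *: u + t *: v).

Lemma convex_segment X :
  convex_set (X : set (convex_lmodType 'rV[R]_d)) -> segment_closed X.
Proof.
move=> cX u v t Xu Xv t0 t1.
have := cX v u (Itv01 t0 t1) (mem_set Xv) (mem_set Xu).
by move=> /set_mem; rewrite addrC.
Qed.

(** A descent direction at a minimizer of a function with a quadratic upper
    model would leave the segment to z below the minimum. *)
Lemma first_order_optimality X (h : 'rV[R]_d -> R) p G C :
  segment_closed X -> X p -> (forall q, X q -> h p <= h q) ->
  (forall q, X q -> h q <= h p + dot G (q - p) + C * dot (q - p) (q - p)) ->
  forall z, X z -> 0 <= dot G (z - p).
Proof.
move=> cX Xp pmin quad z Xz; rewrite leNgt; apply/negP => neg.
pose w := dot (z - p) (z - p); pose K := `|C| * w + 1.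
have w0 : 0 <= w := dot_ge0 _.
have K0 : 1 <= K by rewrite /K lerDr mulr_ge0.
(* Below this step the quadratic term is at most half of the linear one. *)
pose t := Num.min 1 (- dot G (z - p) / (2 * K)).
have t0 : 0 < t by rewrite lt_min ltr01 divr_gt0 ?oppr_gt0 //; lra.
have t1 : t <= 1 by rewrite ge_min lexx.
have tK : t * (2 * K) <= - dot G (z - p).
  by rewrite -ler_pdivlMr ?ge_min ?lexx ?orbT //; lra.
have Xq := cX p z t Xp Xz (ltW t0) t1.
have := quad _ Xq; have := pmin _ Xq.
have -> : (1 - t) *: p + t *: z - p = t *: (z - p).
  by rewrite scalerBl scale1r scalerBr addrAC (addrC p) addrK addrC.
rewrite !dotZr !dotZl -/w => h1 h2.
have : C * (t * (t * w)) <= t * (t * K).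
  have tw : 0 <= t * (t * w) by rewrite !mulr_ge0 // ltW.
  have := ler_wpM2r tw (ler_norm C); rewrite /K; have := mulr_gt0 t0 t0; lra.
have := ler_wpM2l (ltW t0) tK; have : 0 < t * (t * K) by rewrite !mulr_gt0 //; lra.
lra.
Qed.

End Minimizers.

Section Projection.
Variables (R : realType) (d : nat) (X : set 'rV[R]_d).
Hypotheses (X0 : X !=set0) (cptX : compact X) (cX : segment_closed X).

Lemma proj_argmin z : X (proj X z) /\
  forall q, X q -> enorm (z - proj X z) <= enorm (z - q).
Proof.
have [|p Xp pmin] := @lipschitz_argmin _ _ X (fun q => enorm (z - q)) 1 X0 cptX.
  by move=> x x' _ _; rewrite mul1r lerBlDl (enorm_subC x); exact: enorm_dist.
exact: (@xgetPex _ 0 [set p | X p /\ forall q, X q -> enorm (z - p) <= enorm (z - q)]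
  (ex_intro _ p (conj Xp pmin))).
Qed.

Lemma proj_in z : X (proj X z). Proof. exact: (proj_argmin z).1. Qed.

Lemma proj_variational z q : X q -> dot (z - proj X z) (q - proj X z) <= 0.
Proof.
move=> Xq; have [Xp pmin] := proj_argmin z; set p := proj X z in Xp pmin *.
have := @first_order_optimality _ _ X (fun q => dot (z - q) (z - q)) p
  (- (2 *: (z - p))) 1 cX Xp _ _ q Xq.
rewrite dotNl dotZl => H; suff: 0 <= - (2 * dot (z - p) (q - p)) by lra.
apply: H => [r Xr | r Xr].
  by rewrite -!sqr_enorm ler_sqr ?nnegrE ?enorm_ge0 ?pmin.
have -> : z - r = (z - p) - (r - p) by rewrite opprB addrA subrK.
by move: (z - p) (r - p) => a b; rewrite !dotE (dotC b a); lra.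
Qed.

(** The variational inequality of the projection, its cross terms written as
    differences of squared distances. *)
Lemma proj_three_point z G u p : X u -> p = proj X (z - G) ->
  2 * dot G (p - u) <=
    dot (z - u) (z - u) - dot (p - u) (p - u) - dot (z - p) (z - p).
Proof.
move=> Xu pE; have := proj_variational (z - G) Xu; rewrite -pE.
have -> : z - G - p = (z - p) - G by rewrite addrAC.
have -> : z - u = (z - p) + (p - u) by rewrite addrA subrK.
rewrite -(opprB p u); move: (z - p) (p - u) => a b.
by rewrite !dotE (dotC b a); lra.
Qed.

Lemma proj_contract z u : X u ->
  dot (proj X z - u) (proj X z - u) <= dot (z - u) (z - u).
Proof.
move=> Xu; have := proj_variational z Xu.
have -> : z - u = (z - proj X z) + (proj X z - u) by rewrite addrA subrK.
rewrite -(opprB (proj X z) u); move: (z - proj X z) (proj X z - u) => a b.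
by have := dot_ge0 a; rewrite !dotE (dotC b a); lra.
Qed.

End Projection.

(** * The saddle objective and its primal function *)

Lemma pow2_small (R : realType) (a e : R) :
  0 < e -> exists n, a / 2 ^+ n <= e.
Proof.
move=> e0; exists (Num.bound (a / e)).
rewrite ler_pdivrMr ?exprn_gt0 // mulrC -ler_pdivrMr //.
apply: le_trans (ler_norm _) _.
apply: le_trans (ltW (archi_boundP (normr_ge0 _))) _.
have -> : Num.bound `|a / e| = Num.bound (a / e) by rewrite /Num.bound normr_id.
by rewrite -natrX ler_nat ltnW // ltn_expl.
Qed.

Section Problem.
Variables (R : realType) (d m : nat).
Variables (X : set 'rV[R]_d) (Y : set 'rV[R]_m) (DX DY L mu : R).
Variables (f : 'rV[R]_d -> 'rV[R]_m -> R) (g : oracle R d m).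
Hypotheses (pb : minimax_problem X Y DX DY L mu f g).
Hypotheses (mu0 : 0 < mu) (muL : mu <= L).

Let L0 : 0 < L. Proof. exact: lt_le_trans muL. Qed.

Local Notation br := (best_response Y f).
Local Notation F := (maxF Y f).
Local Notation dF := (gradF Y f g).

Lemma compact_primal : compact X.
Proof. by apply: diameter_compact (mp_X_diameter pb); case: pb. Qed.

Lemma compact_dual : compact Y.
Proof. by apply: diameter_compact (mp_Y_diameter pb); case: pb. Qed.

Lemma segment_primal : segment_closed X.
Proof. exact: convex_segment (mp_X_convex pb). Qed.

Lemma segment_dual : segment_closed Y.
Proof. exact: convex_segment (mp_Y_convex pb). Qed.

Lemma proj_primal z : X (proj X z).
Proof. by apply: (proj_in _ compact_primal); case: pb. Qed.

Lemma proj_dual z : Y (proj Y z).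
Proof. by apply: (proj_in _ compact_dual); case: pb. Qed.

Lemma primal_dist x x' : X x -> X x' -> dot (x - x') (x - x') <= DX ^+ 2.
Proof.
move=> Xx Xx'; rewrite -sqr_enorm; have := mp_X_diameter pb Xx Xx'.
by have := enorm_ge0 (x - x'); nra.
Qed.

Lemma dual_dist y y' : Y y -> Y y' -> dot (y - y') (y - y') <= DY ^+ 2.
Proof.
move=> Yy Yy'; rewrite -sqr_enorm; have := mp_Y_diameter pb Yy Yy'.
by have := enorm_ge0 (y - y'); nra.
Qed.

Lemma lipschitz_gradient_sq x y x' y' : X x -> Y y -> X x' -> Y y' ->
  dot ((g x' y').1 - (g x y).1) ((g x' y').1 - (g x y).1) +
  dot ((g x' y').2 - (g x y).2) ((g x' y').2 - (g x y).2) <=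
  L ^+ 2 * (dot (x' - x) (x' - x) + dot (y' - y) (y' - y)).
Proof.
move=> Xx Yy Xx' Yy'; have := mp_smooth pb Xx Yy Xx' Yy'; rewrite /enorm2 /=.
rewrite -ler_sqr ?nnegrE ?mulr_ge0 ?sqrtr_ge0 ?(ltW L0) //.
by rewrite exprMn !sqr_sqrtr ?addr_ge0 ?dot_ge0.
Qed.

Lemma enorm_le_of_sq n (u : 'rV[R]_n) c : 0 <= c -> dot u u <= c ^+ 2 -> enorm u <= c.
Proof. by move=> c0 h; rewrite -ler_sqr ?nnegrE ?enorm_ge0 // sqr_enorm. Qed.

(** Dividing the difference quotient of the convex function f (., y) along the
    segment towards x' by the step. *)
Lemma convex_gradient x x' y : X x -> X x' -> Y y ->
  f x y + dot (g x y).1 (x' - x) <= f x' y.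
Proof.
move=> Xx Xx' Yy; apply/ler_addgt0Pr => e e0.
pose h := x' - x; have h0 : 0 <= enorm h := enorm_ge0 _.
have h1 : 0 < enorm h + 1 by lra.
have [r r0 gr] := mp_gradient pb Xx Yy (divr_gt0 e0 h1).
pose t := Num.min 1 (r / (enorm h + 1)).
have t0 : 0 < t by rewrite lt_min ltr01 divr_gt0.
have t1 : t <= 1 by rewrite ge_min lexx.
have tr : t * (enorm h + 1) <= r by rewrite -ler_pdivlMr // ge_min lexx orbT.
pose z : 'rV[R]_d := (1 - t) *: x + t *: x'.
have Xz : X z := segment_primal Xx Xx' (ltW t0) t1.
have zE : z - x = t *: h.
  by rewrite /z /h scalerBl scale1r scalerBr addrAC (addrC x) addrK addrC.
have := gr z y Xz Yy; rewrite zE subrr /enorm2 /= !dot0r !addr0.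
rewrite -[Num.sqrt _]/(enorm (t *: h)) enormZ ?(ltW t0) // dotZr.
have : t * enorm h <= r by nra.
move=> tr' /(_ tr'); rewrite ler_norml => /andP[g1 _].
have := mp_convex pb Yy (Itv01 (ltW t0) t1) (mem_set Xx') (mem_set Xx).
rewrite convRE /= [X in f X y](_ : _ = z); last by rewrite /z addrC.
rewrite /unstable.onem => cv.
have e1 : e / (enorm h + 1) * (t * enorm h) <= t * e.
  rewrite mulrAC ler_pdivrMr //; nra.
rewrite -/h; set a := dot _ h in g1 *; set b := f x' y in cv *; set c := f x y in g1 cv *.
rewrite -(ler_pM2l t0); set k := f z y in g1 cv; lra.
Qed.

Lemma concave_gradient x y y' : X x -> Y y -> Y y' ->
  f x y' <= f x y + dot (g x y).2 (y' - y) - mu / 2 * dot (y' - y) (y' - y).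
Proof.
by move=> Xx Yy Yy'; have := mp_concave pb Xx Yy Yy'; rewrite sqr_enorm dotNl; lra.
Qed.

(** Concavity and the Lipschitz gradient directly give the constant L in place
    of L / 2. If c is admissible for all pairs of points, then splitting a
    segment at its middle shows that c / 2 + L / 4 is, and L / 2 is the fixed
    point of this map. *)
Lemma smooth_lower x y y' : X x -> Y y -> Y y' ->
  f x y + dot (g x y).2 (y' - y) - L / 2 * dot (y' - y) (y' - y) <= f x y'.
Proof.
move=> Xx.
have lip u v h a : Y u -> Y v -> 0 <= a -> dot (v - u) (v - u) = a ^+ 2 * dot h h ->
    - (L * a * dot h h) <= dot ((g x v).2 - (g x u).2) h.
  move=> Yu Yv a0 vuE; have := lipschitz_gradient_sq Xx Yu Xx Yv.
  rewrite subrr dot0r add0r vuE => hl.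
  have : enorm ((g x v).2 - (g x u).2) <= L * a * enorm h.
    apply: enorm_le_of_sq; first by rewrite !mulr_ge0 ?enorm_ge0 // ltW.
    rewrite !exprMn sqr_enorm; apply: le_trans _ (le_trans hl _).
      by rewrite lerDr dot_ge0.
    by rewrite mulrA.
  have := cauchy_schwarz (- ((g x v).2 - (g x u).2)) h; rewrite enormN dotNl -sqr_enorm.
  have := enorm_ge0 h; nra.
pose P c := forall u v, Y u -> Y v ->
  f x u + dot (g x u).2 (v - u) - c * dot (v - u) (v - u) <= f x v.
have P0 : P L.
  move=> u v Yu Yv; have := concave_gradient Xx Yv Yu.
  have := @lip u v (v - u) 1 Yu Yv ler01; rewrite expr1n mul1r => /(_ erefl).
  have := dot_ge0 (v - u); rewrite -(opprB v u); move: (v - u) => h.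
  by rewrite !dotE; have := mu0; nra.
have Pstep c : P c -> P (c / 2 + L / 4).
  move=> Pc u v Yu Yv; pose w : 'rV[R]_m := (1 - 1 / 2) *: u + (1 / 2) *: v.
  have Yw : Y w by apply: segment_dual => //; lra.
  have wu : w - u = (1 / 2) *: (v - u).
    by rewrite /w scalerBl scale1r scalerBr addrAC (addrC u) addrK addrC.
  have vw : v - w = (1 / 2) *: (v - u).
    have -> : v - w = (v - u) - (w - u) by rewrite opprB addrA subrK.
    by rewrite wu -{1}(scale1r (v - u)) -scalerBl; congr (_ *: _); lra.
  have := Pc u w Yu Yw; have := Pc w v Yw Yv.
  have := @lip u w (v - u) (1 / 2) Yu Yw.
  rewrite wu vw; move: (v - u) => h; rewrite !dotE => H.
  by have := H ltac:(lra) ltac:(ring); lra.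
have Pn n : P (L / 2 + L / 2 / 2 ^+ n).
  elim: n => [|n /Pstep]; first by rewrite expr0 divr1 -splitr.
  congr P; rewrite exprS invfM; set q := (2 ^+ n)^-1; lra.
move=> Yy Yy'; set D := dot (y' - y) (y' - y).
apply/ler_addgt0Pr => e e0.
have [n] := pow2_small (L / 2 * D) e0.
by have := Pn n _ _ Yy Yy'; rewrite -/D; set q := (2 ^+ n)^-1; lra.
Qed.

Lemma gradient_bounded : exists2 B, 0 <= B & forall x y, X x -> Y y ->
  enorm (g x y).1 <= B /\ enorm (g x y).2 <= B.
Proof.
have [x0 Xx0] := mp_X_nonempty pb; have [y0 Yy0] := mp_Y_nonempty pb.
pose a := enorm (g x0 y0).1; pose b := enorm (g x0 y0).2.
pose c := L * (`|DX| + `|DY|).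
have [a0 b0] : 0 <= a /\ 0 <= b by split; exact: enorm_ge0.
have c0 : 0 <= c by rewrite mulr_ge0 ?addr_ge0 // ltW.
exists (a + b + c) => [|x y Xx Yy]; first by rewrite !addr_ge0.
have := lipschitz_gradient_sq Xx0 Yy0 Xx Yy.
have := primal_dist Xx Xx0; have := dual_dist Yy Yy0.
have h1 := dot_ge0 ((g x y).1 - (g x0 y0).1).
have h2 := dot_ge0 ((g x y).2 - (g x0 y0).2).
move=> hY hX hg.
have hc : L ^+ 2 * (dot (x - x0) (x - x0) + dot (y - y0) (y - y0)) <= c ^+ 2.
  rewrite exprMn ler_wpM2l ?sqr_ge0 //.
  have := real_normK (num_real DX); have := real_normK (num_real DY).
  have := mulr_ge0 (normr_ge0 DX) (normr_ge0 DY); nra.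
split.
  have : enorm ((g x y).1 - (g x0 y0).1) <= c by apply: enorm_le_of_sq => //; lra.
  by have := enorm_dist (g x y).1 (g x0 y0).1 0; rewrite !subr0 -/a; lra.
have : enorm ((g x y).2 - (g x0 y0).2) <= c by apply: enorm_le_of_sq => //; lra.
by have := enorm_dist (g x y).2 (g x0 y0).2 0; rewrite !subr0 -/b; lra.
Qed.

Lemma best_response_spec x : X x ->
  Y (br x) /\ forall y, Y y -> f x y <= f x (br x).
Proof.
move=> Xx; have [B B0 gB] := gradient_bounded.
have [||p Yp pmin] := @lipschitz_argmin _ _ Y (fun y => - f x y) B _ compact_dual.
- by case: pb.
- move=> y y' Yy Yy'; have := concave_gradient Xx Yy Yy'.
  have := dot_ge0 (y' - y); have := cauchy_schwarz (g x y).2 (y' - y).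
  have [_ gy] := gB _ _ Xx Yy; have := ler_wpM2r (enorm_ge0 (y' - y)) gy.
  by rewrite (enorm_subC y); have := mu0; nra.
apply: (@xgetPex _ 0 [set y | Y y /\ forall y', Y y' -> f x y' <= f x y]).
by exists p; split=> // y' /pmin; rewrite lerN2.
Qed.

Lemma best_response_in x : X x -> Y (br x).
Proof. by move=> /best_response_spec[]. Qed.

Lemma maxF_ge x y : X x -> Y y -> f x y <= F x.
Proof. by move=> /best_response_spec[_]; exact. Qed.

Lemma best_response_optimality x y : X x -> Y y ->
  dot (g x (br x)).2 (y - br x) <= 0.
Proof.
move=> Xx Yy; have [Yb bmax] := best_response_spec Xx.
have := @first_order_optimality _ _ Y (fun y => - f x y) (br x) (- (g x (br x)).2)
  (L / 2) segment_dual Yb.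
move=> /(_ _ _ y Yy); rewrite dotNl oppr_ge0; apply => q Yq.
  by rewrite lerN2 bmax.
by rewrite dotNl; have := smooth_lower Xx Yb Yq; lra.
Qed.

Lemma best_response_gap x y : X x -> Y y ->
  mu / 2 * dot (y - br x) (y - br x) <= F x - f x y.
Proof.
move=> Xx Yy; have := best_response_optimality Xx Yy.
by have := concave_gradient Xx (best_response_in Xx) Yy; rewrite -/(F x); lra.
Qed.

(** Strong monotonicity at the two best responses bounds their distance by the
    change of the dual gradient between x and x'. *)
Lemma best_response_lipschitz x x' : X x -> X x' ->
  mu ^+ 2 * dot (br x' - br x) (br x' - br x) <= L ^+ 2 * dot (x' - x) (x' - x).
Proof.
move=> Xx Xx'; have Yb := best_response_in Xx; have Yb' := best_response_in Xx'.
have := best_response_optimality Xx Yb'; have := best_response_optimality Xx' Yb.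
have := concave_gradient Xx' Yb Yb'; have := concave_gradient Xx' Yb' Yb.
rewrite (dot_subC (br x) (br x')) -(opprB (br x') (br x)) !(dotNr _ (br x' - br x)).
set h := br x' - br x; set D := dot h h => c1 c2 o1 o2.
have := cauchy_schwarz ((g x' (br x)).2 - (g x (br x)).2) h.
have := lipschitz_gradient_sq Xx Yb Xx' Yb; rewrite subrr dot0r addr0 => hl.
have e1 : enorm ((g x' (br x)).2 - (g x (br x)).2) <= L * enorm (x' - x).
  apply: enorm_le_of_sq; first by rewrite mulr_ge0 ?enorm_ge0 // ltW.
  by rewrite exprMn sqr_enorm; apply: le_trans hl; rewrite lerDr dot_ge0.
rewrite dotDl dotNl => cs.
have h0 := enorm_ge0 h; have x0 := enorm_ge0 (x' - x).
have DE : D = enorm h ^+ 2 by rewrite sqr_enorm.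
have m0 : mu * enorm h ^+ 2 <= L * enorm (x' - x) * enorm h.
  by have := ler_wpM2r h0 e1; rewrite -DE; lra.
rewrite DE -(sqr_enorm (x' - x)) -!exprMn ler_sqr ?nnegrE ?mulr_ge0 ?(ltW mu0) ?(ltW L0) //.
have [->|hn0] := eqVneq (enorm h) 0; first by rewrite mulr0 mulr_ge0 // ltW.
have hp : 0 < enorm h by rewrite lt_neqAle eq_sym hn0.
by rewrite -(ler_pM2r hp) -mulrA -expr2.
Qed.

(** The best response at x is only a competitor at x', and strong concavity
    measures how much is lost there. *)
Lemma maxF_subgradient x x' : X x -> X x' ->
  F x + dot (dF x) (x' - x) + mu / 2 * dot (br x' - br x) (br x' - br x) <= F x'.
Proof.
move=> Xx Xx'; have Yb := best_response_in Xx.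
have := convex_gradient Xx Xx' Yb; have := best_response_gap Xx' Yb.
by rewrite (dot_subC (br x)) -/(F x) -/(dF x); lra.
Qed.

Lemma maxF_lipschitz : exists B, forall x x', X x -> X x' ->
  F x - F x' <= B * enorm (x - x').
Proof.
have [B B0 gB] := gradient_bounded; exists B => x x' Xx Xx'.
have [gx _] := gB _ _ Xx (best_response_in Xx).
have := maxF_subgradient Xx Xx'; have := dot_ge0 (br x' - br x).
have := cauchy_schwarz (- dF x) (x' - x); rewrite enormN dotNl (enorm_subC x).
by have := ler_wpM2r (enorm_ge0 (x' - x)) gx; have := mu0; rewrite /gradF; nra.
Qed.

(** The gradient of F at x is the first component of g at (x, br x), and the
    best response is (L / mu)-Lipschitz. *)
Lemma maxF_upper x x' : X x -> X x' ->
  F x' <= F x + dot (dF x) (x' - x) + L * (1 + L / mu) * dot (x' - x) (x' - x).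
Proof.
move=> Xx Xx'; have Yb := best_response_in Xx; have Yb' := best_response_in Xx'.
have := convex_gradient Xx' Xx Yb'; have := maxF_ge Xx Yb'.
have := lipschitz_gradient_sq Xx Yb Xx' Yb'; have := best_response_lipschitz Xx Xx'.
rewrite -/(dF x) -/(dF x') -/(F x'); set D := dot (x' - x) (x' - x).
set G := dF x' - dF x; set B := dot (br x' - br x) (br x' - br x).
set H := dot ((g x' _).2 - _) _ => hb hg h1 h2.
have D0 : 0 <= D := dot_ge0 _.
have k0 : 0 <= L / mu by rewrite divr_ge0 // ltW.
have : enorm G <= L * (1 + L / mu) * enorm (x' - x).
  apply: enorm_le_of_sq.
    by rewrite !mulr_ge0 ?enorm_ge0 ?addr_ge0 // ltW.
  rewrite !exprMn sqr_enorm -/D.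
  have B1 : B <= (L / mu) ^+ 2 * D.
    by rewrite expr_div_n mulrAC ler_pdivlMr ?exprn_gt0 // mulrC.
  have : L ^+ 2 * (D + B) <= L ^+ 2 * (D + (L / mu) ^+ 2 * D).
    by rewrite ler_wpM2l ?sqr_ge0 // lerD2l.
  have : 0 <= L ^+ 2 * ((L / mu) * D).
    by apply: mulr_ge0; [exact: sqr_ge0 | exact: mulr_ge0].
  by have : 0 <= H := dot_ge0 _; rewrite -/G; lra.
have := cauchy_schwarz G (x' - x); have := enorm_ge0 (x' - x).
have : dot (dF x') (x - x') = - dot (dF x) (x' - x) - dot G (x' - x).
  by rewrite -(opprB x' x) /G !dotE; lra.
by rewrite -/D /D -sqr_enorm; move=> h3 h4 h5 h6; nra.
Qed.

(** The proximal point of s with parameter c, encoded by its first-order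
    condition because this is the form that enters all estimates; c = 0 gives
    the minimizers of F. *)
Definition is_prox c s p :=
  X p /\ forall z, X z -> 0 <= dot (dF p + c *: (p - s)) (z - p).

Lemma prox_exists c s : 0 <= c -> X s -> exists p, is_prox c s p.
Proof.
move=> c0 Xs; have [B FB] := maxF_lipschitz.
pose h x := F x + c / 2 * dot (x - s) (x - s).
have [||p Xp pmin] := @lipschitz_argmin _ _ X h (B + c * `|DX|) _ compact_primal.
- by case: pb.
- move=> x x' Xx Xx'; have := FB _ _ Xx Xx'; rewrite /h.
  have [dx dx'] : enorm (x - s) <= `|DX| /\ enorm (x' - s) <= `|DX|.
    by split; apply: le_trans (ler_norm _); exact: (mp_X_diameter pb).
  have := enorm_dist x x' s; rewrite -!sqr_enorm => h1 h2.
  have : enorm (x - s) ^+ 2 - enorm (x' - s) ^+ 2 <= 2 * `|DX| * enorm (x - x').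
    by have := enorm_ge0 (x - s); have := enorm_ge0 (x' - s);
       have := enorm_ge0 (x - x'); nra.
  move=> h3; have := ler_wpM2l c0 h3; lra.
exists p; split=> // z Xz.
apply: (@first_order_optimality _ _ X h p _ (L * (1 + L / mu) + c / 2) segment_primal) => //.
move=> q Xq; have := maxF_upper Xp Xq; rewrite /h.
have -> : q - s = (q - p) + (p - s) by rewrite addrA subrK.
by move: (q - p) (p - s) => a b; rewrite !dotE (dotC a b); lra.
Qed.

Lemma prox_in c s p : is_prox c s p -> X p. Proof. by case. Qed.

Definition bregman p z := F z - F p - dot (dF p) (z - p).

(** This is why the dual variable can be initialized at another point: where the
    divergence is small, the best response is close to that of p. *)
Lemma bregman_ge p z : X p -> X z ->
  mu / 2 * dot (br z - br p) (br z - br p) <= bregman p z.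
Proof. by move=> Xp Xz; have := maxF_subgradient Xp Xz; rewrite /bregman; lra. Qed.

Definition prox_gap s p z :=
  F z + mu / 2 * dot (z - s) (z - s) - F p - mu / 2 * dot (p - s) (p - s).

(** The first-order condition at p removes the linear part of the proximal
    objective. *)
Lemma prox_gap_ge s p z : is_prox mu s p -> X z ->
  bregman p z + mu / 2 * dot (z - p) (z - p) <= prox_gap s p z.
Proof.
move=> [Xp opt] Xz; have := opt _ Xz; rewrite /bregman /prox_gap.
have -> : z - s = (z - p) + (p - s) by rewrite addrA subrK.
by move: (z - p) (p - s) => a b; rewrite !dotE (dotC a b); lra.
Qed.

Lemma minF_attained : exists2 p, X p &
  (forall z, X z -> 0 <= dot (dF p) (z - p)) /\ minF X Y f = F p /\
  forall z, X z -> F p <= F z.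
Proof.
have [s Xs] := mp_X_nonempty pb; have [p [Xp opt]] := prox_exists (lexx 0) Xs.
have {}opt z : X z -> 0 <= dot (dF p) (z - p).
  by move/opt; rewrite scale0r addr0.
have pmin z : X z -> F p <= F z.
  move=> Xz; have := maxF_subgradient Xp Xz; have := opt _ Xz.
  by have := dot_ge0 (br z - br p); have := mu0; nra.
exists p => //; split => //; split => //; apply/eqP; rewrite eq_le; apply/andP; split.
  by apply: ge_inf; [exists (F p) => _ [z Xz <-]; exact: pmin | exists p].
by apply: lb_le_inf; [exists (F p), p | move=> _ [z Xz <-]; exact: pmin].
Qed.

End Problem.

(** * Expectations along a chain driven by independent levels *)

Lemma sum_level_weights (R : realType) n :
  \sum_(2 <= j < n.+2) (2 ^+ j.-1)^-1 = 1 - (2 ^+ n)^-1 :> R.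
Proof.
elim: n => [|n IH]; first by rewrite big_geq // expr0 invr1 subrr.
by rewrite big_nat_recr //= IH exprS invfM; set q := (2 ^+ n)^-1; lra.
Qed.

Section CountableValued.
Context {dO : measure_display} {Omega : measurableType dO} {R : realType}.
Variable P : probability Omega R.

Lemma measurable_fiber (X : Omega -> nat) n :
  measurable_fun setT X -> measurable (X @^-1` [set n]).
Proof. by move=> mX; rewrite -[X in measurable X]setTI; exact: mX. Qed.

Lemma measurable_comp2 d' (T : measurableType d') (X Y : Omega -> nat)
    (Q : nat -> nat -> T) :
  measurable_fun setT X -> measurable_fun setT Y ->
  measurable_fun setT (fun w => Q (X w) (Y w)).
Proof.
move=> mX mY _ B mB; rewrite setTI.
have -> : (fun w => Q (X w) (Y w)) @^-1` B =
    \bigcup_n \bigcup_k [set w | (X w = n /\ Y w = k) /\ B (Q n k)].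
  apply/seteqP; split=> w /=; first by move=> Bw; exists (X w) => //; exists (Y w).
  by move=> [n _ [k _ [[-> ->]]]].
apply: bigcupT_measurable => n; apply: bigcupT_measurable => k.
have [Bnk|Bnk] := pselect (B (Q n k)).
  rewrite (_ : [set w | _] = X @^-1` [set n] `&` Y @^-1` [set k]).
    by apply: measurableI; exact: measurable_fiber.
  by apply/seteqP; split=> w /=; [case | move=> ?].
by rewrite (_ : [set w | _] = set0) //; apply/seteqP; split=> w //= [].
Qed.

Lemma measurable_comp1 d' (T : measurableType d') (X : Omega -> nat) (Q : nat -> T) :
  measurable_fun setT X -> measurable_fun setT (fun w => Q (X w)).
Proof. by move=> mX; exact: (measurable_comp2 (fun n _ => Q n) mX mX). Qed.

Lemma integral_fibers (D : set Omega) (X : Omega -> nat) (h : Omega -> \bar R) :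
  measurable D -> measurable_fun setT X -> measurable_fun setT h ->
  (forall w, (0 <= h w)%E) ->
  (\int[P]_(w in D) h w = \sum_(0 <= n <oo) \int[P]_(w in D `&` X @^-1` [set n]) h w)%E.
Proof.
move=> mD mX mh h0.
rewrite -[in LHS](_ : \bigcup_n (D `&` X @^-1` [set n]) = D); last first.
  by apply/seteqP; split=> w; [case=> n _ [] | move=> Dw; exists (X w)].
apply: ge0_integral_bigcup => //.
- by move=> n; apply: measurableI => //; exact: measurable_fiber.
- exact: measurable_funTS.
- by move=> i j _ _ [w [[_ /= <-] [_ /= <-]]].
Qed.

Lemma integral_countable (D : set Omega) (X : Omega -> nat) (h : nat -> \bar R) :
  measurable D -> measurable_fun setT X -> (forall n, (0 <= h n)%E) ->
  (\int[P]_(w in D) h (X w) = \sum_(0 <= n <oo) h n * P (D `&` X @^-1` [set n]))%E.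
Proof.
move=> mD mX h0; rewrite (@integral_fibers D X) //; last exact: measurable_comp1.
apply: eq_eseriesr => n _.
rewrite -integral_cst; last by apply: measurableI => //; exact: measurable_fiber.
by apply: eq_integral => w /set_mem[_ /= <-].
Qed.

(** Fubini for independent countably valued variables: both sides are double
    series over the values of X and Y. *)
Lemma integral_indep (X Y : Omega -> nat) (Q : nat -> nat -> \bar R) :
  measurable_fun setT X -> measurable_fun setT Y ->
  (forall n k, P (X @^-1` [set n] `&` Y @^-1` [set k]) =
     (P (X @^-1` [set n]) * P (Y @^-1` [set k]))%E) ->
  (forall n k, (0 <= Q n k)%E) ->
  (\int[P]_w Q (X w) (Y w) = \int[P]_w (\int[P]_w' Q (X w) (Y w')))%E.
Proof.
move=> mX mY ind Q0.
rewrite (@integral_fibers setT X) //; last exact: measurable_comp2.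
rewrite (@integral_countable setT X (fun n => \int[P]_w' Q n (Y w'))%E) //; last first.
  by move=> n; apply: integral_ge0.
apply: eq_eseriesr => n _; rewrite !setTI.
rewrite (_ : (\int[P]_(w in X @^-1` [set n]) Q (X w) (Y w) =
              \int[P]_(w in X @^-1` [set n]) Q n (Y w))%E); last first.
  by apply: eq_integral => w /set_mem /= ->.
rewrite !(@integral_countable _ Y) //; last exact: measurable_fiber.
have pE : P (X @^-1` [set n]) = (fine (P (X @^-1` [set n])))%:E.
  by rewrite fineK // fin_num_measure //; exact: measurable_fiber.
rewrite [RHS]muleC [in RHS]pE -nneseriesZl //; last by move=> k _; rewrite mule_ge0.
rewrite -pE; by apply: eq_eseriesr => k _; rewrite setTI ind muleCA.
Qed.

(** The probabilities of the levels j >= 2 add up to 1, so the levels 0 and 1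
    have probability 0. As h is nonnegative, a partial sum is bounded by longer
    ones, whose remainder B / 2 ^+ n is arbitrarily small. The remainder accommodates
    the sums of signed quantities over the levels, such as telescoping ones, that
    bound those of h. *)
Lemma expectation_level (Y : {RV P >-> nat}) (h : nat -> R) A B :
  level_law Y -> (forall n, 0 <= h n) ->
  (forall n, \sum_(2 <= j < n) h j / 2 ^+ j.-1 <= A + B / 2 ^+ n) ->
  (\int[P]_w (h (Y w))%:E <= A%:E)%E.
Proof.
move=> lawY h0 hA.
have mY : measurable_fun setT Y := measurable_funPT Y.
pose p j := fine (P (Y @^-1` [set j])).
have pE j : P (Y @^-1` [set j]) = (p j)%:E.
  by rewrite /p fineK // fin_num_measure //; exact: measurable_fiber.
have p0 j : 0 <= p j by rewrite -lee_fin -pE.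
have intE (k : nat -> R) : (forall n, 0 <= k n) ->
    (\int[P]_w (k (Y w))%:E = \sum_(0 <= n <oo) (k n * p n)%:E)%E.
  move=> k0; rewrite (@integral_countable _ _ (fun n => (k n)%:E)) //.
  by apply: eq_eseriesr => n _; rewrite setTI pE EFinM.
have sum1 n : \sum_(0 <= j < n) p j <= 1.
  rewrite -lee_fin -sumEFin.
  have := intE (fun=> 1) (fun=> ler01).
  rewrite (integral_cst P measurableT 1%:E) [X in (_ * X)%E](@probability_setT _ _ _ P) mule1.
  move=> ->; apply: le_trans (nneseries_lim_ge n _) => [|j _]; last by rewrite lee_fin mul1r.
  by apply: lee_sum => j _; rewrite mul1r.
have law j : (2 <= j)%N -> p j = (2 ^+ j.-1)^-1.
  by move=> j2; apply: EFin_inj; rewrite -pE lawY.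
have p01 : p 0%N + p 1%N <= 0.
  rewrite -[leRHS](addr0 0) -lerBlDr; apply/ler_addgt0Pr => e e0.
  have [n] := pow2_small 1 e0; rewrite div1r => le.
  have := sum1 n.+2; rewrite big_ltn // big_ltn // (eq_big_nat _ _ (F2 := fun j => (2 ^+ j.-1)^-1)).
    by rewrite sum_level_weights; lra.
  by move=> j /andP[j2 _]; exact: law.
have [pz0 pz1] : p 0%N = 0 /\ p 1%N = 0.
  by have := p0 0%N; have := p0 1%N; split; lra.
rewrite intE //; apply: lime_le.
  by apply: is_cvg_nneseries => n _ _; rewrite lee_fin mulr_ge0.
near=> n; rewrite sumEFin lee_fin.
have le2 k : \sum_(0 <= j < k) h j * p j = \sum_(2 <= j < k) h j / 2 ^+ j.-1.
  case: k => [|[|k]]; first by rewrite !big_geq.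
    by rewrite big_nat1 pz0 mulr0 big_geq.
  rewrite big_ltn // big_ltn // pz0 pz1 !mulr0 !add0r.
  by apply: eq_big_nat => j /andP[j2 _]; rewrite law.
apply/ler_addgt0Pr => e e0; have [k Bk] := pow2_small `|B| e0.
have mono : \sum_(0 <= j < n) h j * p j <= \sum_(0 <= j < n + k) h j * p j.
  rewrite (@big_cat_nat _ _ _ n 0 (n + k)) ?leq_addr //=.
  by rewrite lerDl; apply: sumr_ge0 => j _; rewrite mulr_ge0.
apply: le_trans mono _; rewrite le2; apply: le_trans (hA _) _; rewrite lerD2l.
apply: le_trans _ Bk; apply: le_trans (ler_wpM2r _ (ler_norm B)) _.
  by rewrite invr_ge0 exprn_ge0.
by rewrite ler_wpM2l // lef_pV2 ?posrE ?exprn_gt0 // ler_eXn2l ?ltr1n ?leq_addl.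
Unshelve. all: by end_near. Qed.

End CountableValued.

Section Chain.
Context {dO : measure_display} {Omega : measurableType dO} {R : realType}.
Variables (P : probability Omega R) (J : nat -> {RV P >-> nat}).
Hypothesis HJ : level_samples J.

(** With the past coded as one natural number, every function of the past is a
    function of a countably valued variable, hence measurable. *)
Fixpoint history (t : nat) (w : Omega) : nat :=
  if t is t'.+1 then pickle (history t' w, J t' w) else 0%N.

Lemma measurable_history t : measurable_fun setT (history t).
Proof.
elim: t => [|t IH] /=; first exact: measurable_cst.
exact: (measurable_comp2 (fun n k => pickle (n, k)) IH (measurable_funPT (J t))).
Qed.

(** Fixing the past fixes finitely many levels, as mutual independence demands. *)
Lemma history_cylinder t n : history t @^-1` [set n] = set0 \/
  exists A : nat -> set nat,
    history t @^-1` [set n] = \big[setI/setT]_(i <- iota 0 t) (J i @^-1` A i).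
Proof.
elim: t n => [|t IH] n.
  have [->|n0] := eqVneq n 0%N; [right | left].
    by exists (fun=> setT); rewrite big_nil; apply/seteqP; split.
  by apply/seteqP; split=> // w /= n0'; rewrite -n0' eqxx in n0.
have [[[a b] nE]|nE] := pselect (exists ab : nat * nat, pickle ab = n); last first.
  by left; apply/seteqP; split=> // w /= wn; apply: nE; eexists; exact: wn.
have -> : history t.+1 @^-1` [set n] = history t @^-1` [set a] `&` J t @^-1` [set b].
  rewrite -nE; apply/seteqP; split=> w /=; last by move=> [-> ->].
  by move/(pcan_inj pickleK) => [-> ->].
have [->|[A ->]] := IH a; [by left; rewrite set0I | right].
exists (fun i => if i == t then [set b] else A i).
rewrite -addn1 iotaD big_cat big_seq1 /= add0n eqxx; congr (_ `&` _).
apply: eq_big_seq => i; rewrite mem_iota add0n => /andP[_ it].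
by rewrite ltn_eqF.
Qed.

Lemma history_indep t n k :
  P (history t @^-1` [set n] `&` J t @^-1` [set k]) =
  (P (history t @^-1` [set n]) * P (J t @^-1` [set k]))%E.
Proof.
have [->|[A ->]] := history_cylinder t n; first by rewrite set0I measure0 mul0e.
pose A' i := if i == t then [set k] else A i.
have AE : \big[setI/setT]_(i <- iota 0 t) (J i @^-1` A i) =
    \big[setI/setT]_(i <- iota 0 t) (J i @^-1` A' i).
  apply: eq_big_seq => i; rewrite mem_iota add0n => /andP[_ it].
  by rewrite /A' ltn_eqF.
have := (proj1 HJ) (iota 0 t.+1) A' (iota_uniq _ _).
rewrite -addn1 iotaD !big_cat !big_seq1 /= add0n -AE.
rewrite [X in J t @^-1` X](_ : _ = [set k]); last by rewrite /A' eqxx.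
by move=> ->; rewrite -((proj1 HJ) _ A' (iota_uniq _ _)) -AE.
Qed.

Definition adapted T t (phi : Omega -> T) :=
  exists h : nat -> T, forall w, phi w = h (history t w).

Lemma adapted_cst T t (a : T) : adapted t (fun=> a).
Proof. by exists (fun=> a). Qed.

Lemma adapted_comp T U t (phi : Omega -> T) (k : T -> U) :
  adapted t phi -> adapted t (fun w => k (phi w)).
Proof. by move=> [h hE]; exists (fun n => k (h n)) => w; rewrite hE. Qed.

Lemma adapted_step T U t (phi : Omega -> T) (f : T -> nat -> U) :
  adapted t phi -> adapted t.+1 (fun w => f (phi w) (J t w)).
Proof.
move=> [h hE].
exists (fun n => if @unpickle (nat * nat)%type n is Some (a, b) then f (h a) b else f (h 0%N) 0%N).
by move=> w; rewrite hE /= pickleK.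
Qed.

Lemma adapted_measurable t (phi : Omega -> R) :
  adapted t phi -> measurable_fun setT phi.
Proof.
move=> [h hE]; rewrite (_ : phi = fun w => h (history t w)); last exact/funext.
exact: measurable_comp1 (measurable_history t).
Qed.

Lemma expectation_step T t (phi : Omega -> T) (psi' : T -> nat -> R) (psi : T -> R) :
  adapted t phi -> (forall w k, 0 <= psi' (phi w) k) -> (forall w, 0 <= psi (phi w)) ->
  (forall w, exists B, forall n,
     \sum_(2 <= j < n) psi' (phi w) j / 2 ^+ j.-1 <= psi (phi w) + B / 2 ^+ n) ->
  (\int[P]_w (psi' (phi w) (J t w))%:E <= \int[P]_w (psi (phi w))%:E)%E.
Proof.
move=> ad psi'0 psi0 le; have [h hE] := ad.
(* Outside the range of history, h is arbitrary: hence the truncation at 0. *)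
pose Q n k : \bar R := (Num.max 0 (psi' (h n) k))%:E.
have QE w k : Q (history t w) k = (psi' (phi w) k)%:E.
  by rewrite /Q -hE (max_idPr _).
have mJ := measurable_funPT (J t).
rewrite (_ : (\int[P]_w (psi' (phi w) (J t w))%:E =
              \int[P]_w Q (history t w) (J t w))%E); last first.
  by apply: eq_integral => w _; rewrite QE.
have Q0 n k : (0 <= Q n k)%E by rewrite lee_fin le_max lexx.
rewrite (@integral_indep _ _ _ P _ _ Q (measurable_history t) mJ (history_indep t) Q0).
apply: ge0_le_integral => //.
- by move=> w _; apply: integral_ge0.
- exact: (measurable_comp1 (fun n => (\int[P]_w' Q n (J t w'))%E) (measurable_history t)).
- by apply/measurable_EFinP; exact: (adapted_measurable (adapted_comp psi ad)).
move=> w _; have [B leB] := le w.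
have := @expectation_level _ _ _ P (J t) (psi' (phi w)) (psi (phi w)) B
  ((proj2 HJ) t) (psi'0 w) leB.
by congr (_ <= _)%E; apply: eq_integral => w' _; rewrite QE.
Qed.

(** The state is adapted and the next level is independent of the past, so the
    drift may be averaged over this level first. The offset o allows a start
    from a random state that depends on the levels before o, which is the
    situation of an epoch. *)
Lemma expectation_chain T N o (S : nat -> Omega -> T) (f : nat -> T -> nat -> T)
    (psi : nat -> T -> R) (c : nat -> R) (E0 : R) :
  adapted o (S 0%N) ->
  (forall t w, S t.+1 w = f t (S t w) (J (o + t)%N w)) ->
  (forall t w, 0 <= psi t (S t w)) ->
  (forall t w k, 0 <= psi t.+1 (f t (S t w) k)) ->
  (forall t, 0 <= c t) ->
  (forall t w, (t < N)%N -> exists B, forall n,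
     \sum_(2 <= j < n) psi t.+1 (f t (S t w) j) / 2 ^+ j.-1 <=
     psi t (S t w) + c t + B / 2 ^+ n) ->
  (\int[P]_w (psi 0%N (S 0%N w))%:E <= E0%:E)%E ->
  forall n, (n <= N)%N -> adapted (o + n) (S n) /\
    (\int[P]_w (psi n (S n w))%:E <= (E0 + \sum_(0 <= t < n) c t)%:E)%E.
Proof.
move=> ad0 SE psi0 psi'0 c0 drift E0le; elim=> [|n IHn nN].
  by rewrite addn0 big_geq // addr0.
have [ad IH] := IHn (ltnW nN).
have SnE : S n.+1 = fun w => f n (S n w) (J (o + n)%N w) by apply/funext => w; exact: SE.
split; first by rewrite addnS SnE; exact: adapted_step.
rewrite (_ : (\int[P]_w (psi n.+1 (S n.+1 w))%:E =
   \int[P]_w (psi n.+1 (f n (S n w) (J (o + n)%N w)))%:E)%E); last first.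
  by apply: eq_integral => w _; rewrite SE.
have := @expectation_step _ _ (S n) (fun a k => psi n.+1 (f n a k))
  (fun a => psi n a + c n) ad (psi'0 n) (fun w => addr_ge0 (psi0 n w) (c0 n)) (fun w => drift n w nN).
move=> /le_trans; apply.
have mpsi : measurable_fun setT (EFin \o (fun w => psi n (S n w))).
  by apply/measurable_EFinP; exact: (adapted_measurable (adapted_comp (psi n) ad)).
under eq_integral do rewrite EFinD.
rewrite ge0_integralD //; last first.
  by move=> w _; rewrite lee_fin.
  by move=> w _; rewrite lee_fin.
rewrite (integral_cst P measurableT (c n)%:E) [X in (_ * X)%E](@probability_setT _ _ _ P) mule1.
by rewrite big_nat_recr //= addrA EFinD leeD2r.
Qed.

End Chain.

(** * Accelerated gradient descent *)

Lemma iterM_ind A (Q : nat -> A -> Prop) (step : nat -> A -> counted A) a n :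
  Q 0%N a -> (forall i b, Q i b -> Q i.+1 (step i b).1) ->
  Q n (iterM n step a).1.
Proof. by move=> Q0 Qs; elim: n => //= n; exact: Qs. Qed.

Lemma iterM_cost A (step : nat -> A -> counted A) a n c :
  (forall i b, (step i b).2 = c) -> (iterM n step a).2 = (n * c)%N.
Proof. by move=> sc; elim: n => //= n ->; rewrite sc mulSnr. Qed.

Section CeilNat.
Variable R : realType.
Implicit Types x : R.

Definition ceil_nat x := `|Num.ceil x|%N.

Lemma ceil_natE x : 0 <= x -> (ceil_nat x)%:R = (Num.ceil x)%:~R :> R.
Proof.
move=> x0; rewrite /ceil_nat natr_absz ger0_norm //.
by rewrite -(@ler_int R) (le_trans x0) // ceil_ge.
Qed.

Lemma ceil_nat_ge x : 0 <= x -> x <= (ceil_nat x)%:R.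
Proof. by move=> x0; rewrite ceil_natE // ceil_ge. Qed.

Lemma ceil_nat_le x : 0 <= x -> (ceil_nat x)%:R <= x + 1.
Proof.
by move=> x0; rewrite ceil_natE //; have := ceilB1_lt x; rewrite intrB; lra.
Qed.

End CeilNat.

Section AGD.
Variables (R : realType) (d m : nat).
Variables (X : set 'rV[R]_d) (Y : set 'rV[R]_m) (DX DY L mu : R).
Variables (f : 'rV[R]_d -> 'rV[R]_m -> R) (g : oracle R d m).
Hypotheses (pb : minimax_problem X Y DX DY L mu f g).
Hypotheses (mu0 : 0 < mu) (muL : mu <= L).

Local Notation br := (best_response Y f).
Local Notation F := (maxF Y f).

Let L0 : 0 < L. Proof. exact: lt_le_trans muL. Qed.

Local Notation tau := (Num.sqrt (mu / L)).

Lemma momentum_gt0 : 0 < tau.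
Proof. by rewrite sqrtr_gt0 divr_gt0. Qed.

Lemma momentum_sq : L * tau ^+ 2 = mu.
Proof. by rewrite sqr_sqrtr ?divr_ge0 ?ltW // mulrC divfK // gt_eqF. Qed.

Lemma momentum_le1 : tau <= 1.
Proof.
rewrite -sqrtr1 ler_wsqrtr // ler_pdivrMr // mul1r //.
Qed.

(** One plain gradient step bounds the whole Lyapunov function, whatever the gap
    at y0 is. *)
Lemma agd_first_step x y0 y1 : X x -> Y y0 ->
  y1 = proj Y (y0 + L^-1 *: (g x y0).2) ->
  F x - f x y1 + mu / 2 * dot (y1 - br x) (y1 - br x) <= L / 2 * DY ^+ 2.
Proof.
move=> Xx Yy0 y1E; have Yy1 : Y y1 by rewrite y1E; exact: (proj_dual pb).
have Yb := best_response_in pb mu0 muL Xx.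
have := concave_gradient pb Xx Yy0 Yb; have := smooth_lower pb mu0 muL Xx Yy0 Yy1.
have := @proj_three_point _ _ Y (mp_Y_nonempty pb) (compact_dual pb)
  (segment_dual pb) y0 (- (L^-1 *: (g x y0).2)) (br x) y1 Yb.
rewrite opprK => /(_ y1E); have := dual_dist pb Yy0 Yb.
have -> : y1 - y0 = (y1 - br x) - (y0 - br x) by rewrite opprB addrA subrK.
have -> : y0 - y1 = (y0 - br x) - (y1 - br x) by rewrite opprB addrA subrK.
rewrite -(opprB y0 (br x)) -/(F x).
move: (y1 - br x) (y0 - br x) (g x y0).2 => a b G.
rewrite !dotE (dotC b a) => h1 h2 h3 h4.
have h2' := ler_wpM2l (ltW L0) h2.
have Linv : L * (L^-1 * dot G a) = dot G a by rewrite mulrA divff ?gt_eqF // mul1r.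
have a0 := dot_ge0 a; have b0 := dot_ge0 b.
have := ler_wpM2r a0 muL; have := ler_wpM2r b0 (ltW mu0).
have := ler_wpM2l (ltW L0) h1; lra.
Qed.

(** The classical Lyapunov function: the gap plus mu / 2 times the squared
    distance of the momentum iterate v to the maximizer. *)
Lemma agd_step x y v : X x -> Y y -> Y v ->
  let z := (1 + tau)^-1 *: (y + tau *: v) in
  let w := (1 - tau) *: v + tau *: z in
  let v' := proj Y (w + (tau / mu) *: (g x z).2) in
  let y' := (1 - tau) *: y + tau *: v' in
  [/\ Y y', Y v' &
    F x - f x y' + mu / 2 * dot (v' - br x) (v' - br x) <=
    (1 - tau) * (F x - f x y + mu / 2 * dot (v - br x) (v - br x))].
Proof.
move=> Xx Yy Yv z w v' y'.
have t0 := momentum_gt0; have t1 := momentum_le1; have tsq := momentum_sq.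
set t := tau in t0 t1 tsq z w v' y' *.
have t10 : 1 + t != 0 by rewrite gt_eqF //; lra.
have Yz : Y z.
  have -> : z = (1 - t / (1 + t)) *: y + (t / (1 + t)) *: v.
    by apply/rowP => i; rewrite !mxE; field.
  apply: (segment_dual pb) => //; first by rewrite divr_ge0 //; lra.
  by rewrite ler_pdivrMr; lra.
have Yv' : Y v' := proj_dual pb _.
have Yy' : Y y' by apply: (segment_dual pb) => //; lra.
split => //; have Yb := best_response_in pb mu0 muL Xx.
have := concave_gradient pb Xx Yz Yb; have := concave_gradient pb Xx Yz Yy.
have := smooth_lower pb mu0 muL Xx Yz Yy'.
have := @proj_three_point _ _ Y (mp_Y_nonempty pb) (compact_dual pb)
  (segment_dual pb) w (- ((t / mu) *: (g x z).2)) (br x) v' Yb.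
rewrite opprK => /(_ erefl).
have -> : y' - z = t *: (v' - w).
  by apply/rowP => i; rewrite /y' /w /z !mxE; field.
have yz : t *: (v' - w) = (1 - t) *: (y - z) + t *: ((v' - br x) + (br x - z)).
  by apply/rowP => i; rewrite /w /z !mxE; field.
have -> : w - br x = (1 - t) *: (v - br x) - t *: (br x - z).
  by apply/rowP => i; rewrite /w !mxE; ring.
have -> : dot (w - v') (w - v') = dot (v' - w) (v' - w) by exact: dot_subC.
have -> : dot (t *: (v' - w)) (t *: (v' - w)) = t ^+ 2 * dot (v' - w) (v' - w).
  by rewrite dotZl dotZr; ring.
rewrite yz -/(F x); set D := dot (v' - w) (v' - w).
move: (g x z).2 (y - z) (v' - br x) (br x - z) (v - br x) D => G a b c e D.
rewrite !dotE !opprK (dotC c e) => h1 h2 h3 h4.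
have {}h1 : - (t * dot G b) <= mu / 2 *
   ((1 - t) ^+ 2 * dot e e - 2 * t * (1 - t) * dot e c + t ^+ 2 * dot c c - dot b b - D).
  have := ler_wpM2l (ltW mu0) h1.
  have -> : mu * (2 * - (t / mu * dot G b)) = - (2 * t * dot G b).
    by field; rewrite gt_eqF.
  lra.
(* The cross term between v - br x and br x - z is split between the two squares:
   one is part of the old Lyapunov function, the other is paid by strong
   concavity. *)
have young : - (2 * dot e c) <= dot e e + dot c c.
  by have := dot_ge0 (e + c); rewrite !dotE (dotC c e); lra.
have : mu * (t * (1 - t)) * - (2 * dot e c) <= mu * (t * (1 - t)) * (dot e e + dot c c).
  by apply: ler_wpM2l => //; rewrite !mulr_ge0 ?(ltW mu0) ?(ltW t0) ?subr_ge0.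
have h2' : L / 2 * (t ^+ 2 * D) = mu / 2 * D by rewrite -tsq; ring.
rewrite h2' in h2.
have t1' : 0 <= 1 - t by lra.
have := ler_wpM2l t1' h3; have := ler_wpM2l (ltW t0) h4.
have : 0 <= (1 - t) * (mu / 2 * dot a a).
  by rewrite mulr_ge0 // mulr_ge0 ?dot_ge0 // divr_ge0 // ltW.
lra.
Qed.

Lemma agd_gap n x y0 : X x -> Y y0 ->
  let y := (agd Y g L mu n x y0).1 in
  Y y /\ F x - f x y <= (1 - tau) ^+ n * (L / 2 * DY ^+ 2).
Proof.
move=> Xx Yy0; rewrite /agd /=; set y1 := proj Y _.
set step := (fun _ => _).
pose Q i (st : 'rV[R]_m * 'rV[R]_m) := [/\ Y st.1, Y st.2 &
  F x - f x st.1 + mu / 2 * dot (st.2 - br x) (st.2 - br x) <=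
  (1 - tau) ^+ i * (L / 2 * DY ^+ 2)].
have [] : Q n (iterM n step (y1, y1)).1.
  apply: (@iterM_ind _ Q).
    split; [exact: (proj_dual pb) | exact: (proj_dual pb) |].
    by rewrite expr0 mul1r /=; exact: (agd_first_step Xx Yy0).
  move=> i [y v] [/= Yy Yv le]; have [Yy' Yv' le'] := agd_step Xx Yy Yv.
  split => //=; apply: le_trans le' _; rewrite exprS -[leRHS]mulrA ler_wpM2l //.
  by rewrite subr_ge0 momentum_le1.
move=> Yy _ le; split => //; apply: le_trans le; rewrite lerDl.
by rewrite mulr_ge0 ?dot_ge0 // divr_ge0 // ltW.
Qed.

Lemma agd_cost n x y0 : (agd Y g L mu n x y0).2 = n.+1.
Proof. rewrite /agd /= (@iterM_cost _ _ _ _ 1); [by rewrite muln1 addn0 | by move=> _ []]. Qed.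

Definition agd_steps (delta : R) : nat :=
  ceil_nat (Num.sqrt (L / mu) * Num.max 0 (ln (L / 2 * DY ^+ 2 / delta))).

Lemma agd_steps_accurate : 0 < DY -> agd_accurate X Y f g L mu agd_steps.
Proof.
move=> DY0 delta x y0 dl0 Xx Yy0.
have [_ le] := agd_gap (agd_steps delta) Xx Yy0; apply: le_trans le _.
set q := L / 2 * DY ^+ 2.
have q0 : 0 < q by rewrite mulr_gt0 ?exprn_gt0 ?divr_gt0.
have t0 := momentum_gt0; have t1 := momentum_le1.
set n := agd_steps delta; set lg := Num.max 0 (ln (q / delta)).
have lg0 : 0 <= lg by rewrite le_max lexx.
have nge : Num.sqrt (L / mu) * lg <= n%:R.
  by apply: ceil_nat_ge; rewrite mulr_ge0 ?sqrtr_ge0.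
have ts : tau * Num.sqrt (L / mu) = 1.
  rewrite -sqrtrM ?divr_ge0 ?ltW // mulrA divfK ?gt_eqF // divff ?gt_eqF //.
  exact: sqrtr1.
have tn : lg <= tau * n%:R.
  by have := ler_wpM2l (ltW t0) nge; rewrite mulrA ts mul1r.
have e1 : (1 - tau) ^+ n <= expR (- (tau * n%:R)).
  rewrite (mulrC tau) -mulrN expRM_natl.
  by rewrite lerXn2r ?nnegrE ?subr_ge0 ?expR_ge0 // expR_ge1Dx.
have e2 : expR (- (tau * n%:R)) <= delta / q.
  apply: (@le_trans _ _ (expR (- ln (q / delta)))).
    by rewrite ler_expR lerN2; apply: le_trans tn; rewrite le_max lexx orbT.
  by rewrite expRN lnK ?posrE ?divr_gt0 // invf_div.
have := le_trans e1 e2; rewrite ler_pdivlMr //.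
Qed.

Lemma agd_steps_le delta :
  (agd_steps delta)%:R <=
  Num.sqrt (L / mu) * Num.max 0 (ln (L / 2 * DY ^+ 2 / delta)) + 1 :> R.
Proof. by apply: ceil_nat_le; rewrite mulr_ge0 ?sqrtr_ge0 // le_max lexx. Qed.

End AGD.

(** * Mirror-prox and the approximate proximal step *)

Section MirrorProx.
Variables (R : realType) (d m : nat).
Variables (X : set 'rV[R]_d) (Y : set 'rV[R]_m) (DX DY L mu : R).
Variables (f : 'rV[R]_d -> 'rV[R]_m -> R) (g : oracle R d m).
Hypotheses (pb : minimax_problem X Y DX DY L mu f g).
Hypotheses (mu0 : 0 < mu) (muL : mu <= L).

Local Notation br := (best_response Y f).
Local Notation F := (maxF Y f).
Local Notation dF := (gradF Y f g).

Let L0 : 0 < L. Proof. exact: lt_le_trans muL. Qed.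

Section Regularized.
Variable s : 'rV[R]_d.

Local Notation h := (regularize g mu s).

Definition reg_obj x y := f x y + mu / 2 * dot (x - s) (x - s).

Lemma reg_lipschitz_sq x y x' y' : X x -> Y y -> X x' -> Y y' ->
  dot ((h x' y').1 - (h x y).1) ((h x' y').1 - (h x y).1) +
  dot ((h x' y').2 - (h x y).2) ((h x' y').2 - (h x y).2) <=
  (L + mu) ^+ 2 * (dot (x' - x) (x' - x) + dot (y' - y) (y' - y)).
Proof.
move=> Xx Yy Xx' Yy'; have := lipschitz_gradient_sq pb mu0 muL Xx Yy Xx' Yy'.
rewrite /regularize /=.
have -> : (g x' y').1 + mu *: (x' - s) - ((g x y).1 + mu *: (x - s)) =
    ((g x' y').1 - (g x y).1) + mu *: (x' - x).
  by apply/rowP => i; rewrite !mxE; ring.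
move: ((g x' y').1 - (g x y).1) ((g x' y').2 - (g x y).2) (x' - x) (y' - y) => a b u v.
rewrite !dotE (dotC u a) => hl.
have := dot_ge0 (a - L *: u); rewrite !dotE (dotC u a) => /(ler_wpM2l (ltW mu0)).
have := ler_wpM2l (ltW mu0) hl.
have v0 := dot_ge0 v; have b0 := dot_ge0 b; have u0 := dot_ge0 u.
move=> e1 e2; rewrite -(ler_pM2l L0).
have e3 := ler_wpM2l (ltW L0) hl.
have : 0 <= mu * dot b b by rewrite mulr_ge0 // ltW.
have : 0 <= L * mu * (L + mu) * dot v v by rewrite !mulr_ge0 ?addr_ge0 // ltW.
lra.
Qed.

Lemma reg_saddle_gap x y x' y' : X x -> Y y -> X x' -> Y y' ->
  reg_obj x y' - reg_obj x' y <=
  dot (h x y).1 (x - x') - dot (h x y).2 (y - y').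
Proof.
move=> Xx Yy Xx' Yy'.
have := convex_gradient pb Xx Xx' Yy; have := concave_gradient pb Xx Yy Yy'.
rewrite /reg_obj /=; have -> : x' - s = (x' - x) + (x - s) by rewrite addrA subrK.
rewrite -(opprB x x') -(opprB y y').
move: (x - x') (x - s) (y - y') => a b c; rewrite !dotE (dotC b a).
have := mulr_ge0 (ltW mu0) (dot_ge0 a); have := mulr_ge0 (ltW mu0) (dot_ge0 c); lra.
Qed.

Lemma reg_convex x x' y t : X x -> X x' -> Y y -> 0 <= t -> t <= 1 ->
  reg_obj ((1 - t) *: x + t *: x') y <= (1 - t) * reg_obj x y + t * reg_obj x' y.
Proof.
move=> Xx Xx' Yy t0 t1; set z := _ + _.
have Xz : X z := segment_primal pb Xx Xx' t0 t1.
have t1' : 0 <= 1 - t by lra.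
have := ler_wpM2l t1' (convex_gradient pb Xz Xx Yy).
have := ler_wpM2l t0 (convex_gradient pb Xz Xx' Yy).
have -> : x - z = t *: (x - x') by apply/rowP => i; rewrite /z !mxE; ring.
have -> : x' - z = - ((1 - t) *: (x - x')) by apply/rowP => i; rewrite /z !mxE; ring.
rewrite /reg_obj; have -> : z - s = (1 - t) *: (x - x') + (x' - s).
  by apply/rowP => i; rewrite /z !mxE; ring.
have -> : x - s = (x - x') + (x' - s) by rewrite addrA subrK.
move: (x - x') (x' - s) (g z y).1 => a b G; rewrite !dotE (dotC b a).
have : 0 <= mu * (t * (1 - t) * dot a a) by rewrite !mulr_ge0 ?dot_ge0 // ltW.
lra.
Qed.

Lemma reg_concave x y y' t : X x -> Y y -> Y y' -> 0 <= t -> t <= 1 ->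
  (1 - t) * reg_obj x y + t * reg_obj x y' <= reg_obj x ((1 - t) *: y + t *: y').
Proof.
move=> Xx Yy Yy' t0 t1; set z := _ *: y + _.
have Yz : Y z := segment_dual pb Yy Yy' t0 t1.
have t1' : 0 <= 1 - t by lra.
have := ler_wpM2l t1' (concave_gradient pb Xx Yz Yy).
have := ler_wpM2l t0 (concave_gradient pb Xx Yz Yy').
have -> : y - z = t *: (y - y') by apply/rowP => i; rewrite /z !mxE; ring.
have -> : y' - z = - ((1 - t) *: (y - y')) by apply/rowP => i; rewrite /z !mxE; ring.
rewrite /reg_obj; move: (y - y') (g x z).2 => a G; rewrite !dotE.
have : 0 <= mu * (t * (1 - t) * ((1 - t) * dot a a)).
  by rewrite !mulr_ge0 ?dot_ge0 // ltW.
have : 0 <= mu * (t * (1 - t) * (t * dot a a)) by rewrite !mulr_ge0 ?dot_ge0 // ltW.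
lra.
Qed.

Let M := L + mu.
Let M0 : 0 < M. Proof. by rewrite addr_gt0. Qed.

(** One extragradient step: the gradient at the extrapolated point (u, v)
    differs from the one at (x, y) by at most M times the length of the
    extrapolation, which the two three-point inequalities pay for. *)
Lemma extragradient_step x y u v x' y' xu yu :
  X x -> Y y -> X xu -> Y yu ->
  u = proj X (x - M^-1 *: (h x y).1) -> v = proj Y (y + M^-1 *: (h x y).2) ->
  x' = proj X (x - M^-1 *: (h u v).1) -> y' = proj Y (y + M^-1 *: (h u v).2) ->
  reg_obj u yu - reg_obj xu v <=
  M / 2 * (dot (x - xu) (x - xu) + dot (y - yu) (y - yu)
     - dot (x' - xu) (x' - xu) - dot (y' - yu) (y' - yu)).
Proof.
move=> Xx Yy Xxu Yyu uE vE x'E y'E.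
have X3 := @proj_three_point _ _ X (mp_X_nonempty pb) (compact_primal pb) (segment_primal pb).
have Y3 := @proj_three_point _ _ Y (mp_Y_nonempty pb) (compact_dual pb) (segment_dual pb).
have [Xu Xx'] : X u /\ X x' by rewrite uE x'E; split; exact: (proj_primal pb).
have [Yv Yy'] : Y v /\ Y y' by rewrite vE y'E; split; exact: (proj_dual pb).
have k1 := X3 _ _ _ _ Xxu x'E; have k2 := X3 _ _ _ _ Xx' uE.
have := Y3 y (- (M^-1 *: (h u v).2)) yu y' Yyu; rewrite opprK => /(_ y'E) k3.
have := Y3 y (- (M^-1 *: (h x y).2)) y' v Yy'; rewrite opprK => /(_ vE) k4.
have k5 := reg_lipschitz_sq Xx Yy Xu Yv; rewrite -/M in k5.
apply: le_trans (reg_saddle_gap Xu Yv Xxu Yyu) _.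
move: (h x y) (h u v) k1 k2 k3 k4 k5 => [Gx Gy] [Hx Hy] /=.
have -> : u - xu = (u - x') + (x' - xu) by rewrite addrA subrK.
have -> : v - yu = (v - y') + (y' - yu) by rewrite addrA subrK.
rewrite (dot_subC u x) (dot_subC v y).
have -> : Hx = (Hx - Gx) + Gx by rewrite subrK.
have -> : Hy = (Hy - Gy) + Gy by rewrite subrK.
rewrite !addrK; move: (Hx - Gx) (Hy - Gy) => Dx Dy.
set A := dot (x - x') _; set B := dot (y - y') _; set C := dot (x - u) _.
set D := dot (y - v) _; set E := dot (x - xu) _; set H := dot (y - yu) _.
move: (u - x') (x' - xu) (v - y') (y' - yu) => p a q b.
have yx := dot_ge0 (Dx - M *: p); have yy := dot_ge0 (Dy + M *: q).
move: yx yy; rewrite !dotE (dotC p Dx) (dotC q Dy) => yx yy.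
have Mn : M != 0 by rewrite gt_eqF.
move=> /(ler_wpM2l (ltW M0)) k1 /(ler_wpM2l (ltW M0)) k2.
move=> /(ler_wpM2l (ltW M0)) k3 /(ler_wpM2l (ltW M0)) k4 k5.
have cancelM (c : R) : M * (2 * (M^-1 * c)) = 2 * c by field.
have cancelMN (c : R) : M * (2 * - (M^-1 * c)) = - (2 * c) by field.
rewrite !cancelM in k1 k2; rewrite !cancelMN in k3 k4.
rewrite -(ler_pM2l M0).
have := ler_wpM2l (ltW M0) k1; have := ler_wpM2l (ltW M0) k2.
have := ler_wpM2l (ltW M0) k3; have := ler_wpM2l (ltW M0) k4.
lra.
Qed.

(** The running averages (a, b) are tracked instead of the iterates: i times
    the saddle gap of the average is at most the sum of the saddle gaps. *)
Lemma mirror_prox_gap x0 y0 N : X x0 -> Y y0 -> (0 < N)%N ->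
  let r := (mirror_prox X Y h M x0 y0 N).1 in
  [/\ X r.1, Y r.2 & forall xu yu, X xu -> Y yu ->
    N%:R * (reg_obj r.1 yu - reg_obj xu r.2) <=
    M / 2 * (dot (x0 - xu) (x0 - xu) + dot (y0 - yu) (y0 - yu))].
Proof.
move=> Xx0 Yy0 N0; have eg := @extragradient_step.
move: (h) eg => hh eg; rewrite /mirror_prox /=; set step := (fun _ => _).
pose Q (i : nat) (st : 'rV[R]_d * 'rV[R]_m * 'rV[R]_d * 'rV[R]_m) :=
  let: (x, y, su, sv) := st in
  X x /\ Y y /\ exists a b, [/\ X a, Y b, su = i%:R *: a, sv = i%:R *: b &
  forall xu yu, X xu -> Y yu ->
    i%:R * (reg_obj a yu - reg_obj xu b) +
    M / 2 * (dot (x - xu) (x - xu) + dot (y - yu) (y - yu)) <=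
    M / 2 * (dot (x0 - xu) (x0 - xu) + dot (y0 - yu) (y0 - yu))].
have : Q N (iterM N step (x0, y0, 0, 0)).1; last first.
  have Nn : N%:R != 0 :> R by rewrite pnatr_eq0 -lt0n.
  move: (iterM N step _).1 => [[[x y] su] sv] /= [_ [_ [a [b [Xa Yb -> -> gap]]]]].
  rewrite !scalerA mulVf // !scale1r; split => // xu yu Xu Yu.
  have := gap _ _ Xu Yu; apply: le_trans; rewrite lerDl.
  by apply: mulr_ge0; [rewrite divr_ge0 // ltW | rewrite addr_ge0 ?dot_ge0].
apply: (@iterM_ind _ Q) => [|i [[[x y] su] sv] [Xx [Yy [a [b [Xa Yb -> -> gap]]]]]].
  split; [exact: Xx0 | split; [exact: Yy0 |]].
  exists x0, y0; rewrite !scale0r; split; [exact: Xx0 | exact: Yy0 | by [] | by [] |].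
  by move=> xu yu _ _; rewrite mul0r add0r.
rewrite /step /=; set u := proj X (x - M^-1 *: (hh x y).1).
set v := proj Y (y + M^-1 *: (hh x y).2).
set x' := proj X (x - M^-1 *: (hh u v).1).
set y' := proj Y (y + M^-1 *: (hh u v).2).
have [Xu Xx'] : X u /\ X x' by split; exact: (proj_primal pb).
have [Yv Yy'] : Y v /\ Y y' by split; exact: (proj_dual pb).
pose t : R := i.+1%:R^-1.
have i1 : 0 < i.+1%:R :> R by rewrite ltr0n.
have i1n : i.+1%:R != 0 :> R by rewrite gt_eqF.
have t0 : 0 <= t by rewrite invr_ge0 ltW.
have t1 : t <= 1 by rewrite invf_le1 // ler1n.
have tE : i.+1%:R * t = 1 by rewrite mulfV.
have tE' : i.+1%:R * (1 - t) = i%:R by rewrite mulrBr tE mulr1 -natr1 addrK.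
split; [exact: Xx' | split; [exact: Yy' |]].
exists ((1 - t) *: a + t *: u), ((1 - t) *: b + t *: v); split.
- exact: (segment_primal pb).
- exact: (segment_dual pb).
- by rewrite scalerDr !scalerA tE tE' scale1r.
- by rewrite scalerDr !scalerA tE tE' scale1r.
move=> xu yu Xxu Yyu; have := gap _ _ Xxu Yyu.
have := eg x y u v x' y' xu yu Xx Yy Xxu Yyu erefl erefl erefl erefl.
have := ler_wpM2l (ltW i1) (reg_convex Xa Xu Yyu t0 t1).
have := ler_wpM2l (ltW i1) (reg_concave Xxu Yb Yv t0 t1).
have avgE (A B : R) : i.+1%:R * ((1 - t) * A + t * B) = i%:R * A + B.
  by rewrite mulrDr !mulrA tE tE' mul1r.
rewrite !avgE; lra.
Qed.

End Regularized.
End MirrorProx.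

Section ApproxProx.
Variables (R : realType) (d m : nat).
Variables (X : set 'rV[R]_d) (Y : set 'rV[R]_m) (DX DY L mu : R).
Variables (f : 'rV[R]_d -> 'rV[R]_m -> R) (g : oracle R d m).
Hypotheses (pb : minimax_problem X Y DX DY L mu f g).
Hypotheses (mu0 : 0 < mu) (muL : mu <= L).
Variables (y_init : 'rV[R]_m) (nagd : R -> nat).
Hypotheses (Yinit : Y y_init) (acc : agd_accurate X Y f g L mu nagd).

Local Notation br := (best_response Y f).
Local Notation F := (maxF Y f).
Local Notation dF := (gradF Y f g).
Local Notation is_prox := (is_prox X Y f g mu).
Local Notation prox_gap := (prox_gap Y mu f).
Local Notation bregman := (bregman Y f g).

Let L0 : 0 < L. Proof. exact: lt_le_trans muL. Qed.
Let M0 : 0 < L + mu. Proof. by rewrite addr_gt0. Qed.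

Definition prox_steps := ceil_nat (64 * (L + mu) / mu).

Lemma prox_steps_ge : 64 * (L + mu) <= mu * prox_steps%:R.
Proof.
have h : 64 * (L + mu) / mu <= prox_steps%:R.
  by apply: ceil_nat_ge; rewrite divr_ge0 ?mulr_ge0 // ltW.
by move: h; rewrite ler_pdivrMr // (mulrC mu).
Qed.

Lemma prox_steps_gt0 : (0 < prox_steps)%N.
Proof.
rewrite -(@ltr0n R) -(pmulr_rgt0 _ mu0); apply: lt_le_trans prox_steps_ge.
by have := M0; lra.
Qed.

Lemma prox_steps_le : prox_steps%:R <= 129 * (L / mu).
Proof.
have h : prox_steps%:R <= 64 * (L + mu) / mu + 1.
  by apply: ceil_nat_le; rewrite divr_ge0 ?mulr_ge0 // ltW.
apply: le_trans h _; have : 1 <= L / mu by rewrite ler_pdivlMr // mul1r.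
have -> : 64 * (L + mu) / mu = 64 * (L / mu) + 64 by field; rewrite gt_eqF.
lra.
Qed.

(** The number of iterations turns the rate (L + mu) / (2 N) of mirror-prox into
    mu / 128, a coefficient that strong convexity of modulus mu absorbs. *)
Lemma prox_call s x0 y0 : X x0 -> Y y0 ->
  let r := (mirror_prox X Y (regularize g mu s) (L + mu) x0 y0 prox_steps).1 in
  [/\ X r.1, Y r.2 & forall xu yu, X xu -> Y yu ->
    reg_obj mu f s r.1 yu - reg_obj mu f s xu r.2 <=
    mu / 128 * (dot (x0 - xu) (x0 - xu) + dot (y0 - yu) (y0 - yu))].
Proof.
move=> Xx0 Yy0; have [] := mirror_prox_gap pb mu0 muL s Xx0 Yy0 prox_steps_gt0.
move: (mirror_prox _ _ _ _ _ _ _).1 => r Xr Yr gap; split => // xu yu Xu Yu.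
have := gap _ _ Xu Yu; have := prox_steps_ge.
have n0 : 0 < prox_steps%:R :> R by rewrite ltr0n prox_steps_gt0.
set n := prox_steps%:R in n0 *; set A := _ - _; set B := dot _ _ + _.
have B0 : 0 <= B by rewrite addr_ge0 ?dot_ge0.
move=> /(ler_wpM2r B0) h1 h2; rewrite -(ler_pM2l n0); lra.
Qed.

Lemma agd_in n x y : X x -> Y y -> Y (agd Y g L mu n x y).1.
Proof. by move=> Xx Yy; have [] := agd_gap pb mu0 muL n Xx Yy. Qed.

Lemma approx_proxE delta s xi xprev :
  (approx_prox X Y g L mu y_init nagd delta s xi xprev).1 =
  (mirror_prox X Y (regularize g mu s) (L + mu) xi
     (agd Y g L mu (nagd delta) xprev y_init).1 prox_steps).1.1.
Proof. by []. Qed.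

(** The dual start y of the call has to be close to br r. It is delta-optimal at
    xprev, hence close to br xprev; the Bregman divergence at xprev controls the
    distance from there to br p; and the distance from br p to br r is
    controlled by the proximal gap itself, with a coefficient small enough to be
    absorbed. *)
Lemma approx_prox_gap delta s xi xprev : X xi -> X xprev ->
  let r := (approx_prox X Y g L mu y_init nagd delta s xi xprev).1 in
  X r /\ forall p, 0 < delta -> is_prox s p ->
  prox_gap s p r <= (bregman p xprev + mu / 2 * dot (xi - p) (xi - p) + delta) / 16.
Proof.
move=> Xxi Xprev; rewrite approx_proxE.
have Yy := agd_in (nagd delta) Xprev Yinit; set y := (agd _ _ _ _ _ _ _).1 in Yy *.
have [] := prox_call s Xxi Yy.
move: (mirror_prox _ _ _ _ _ _ _).1 => [r yr].
move=> Xr Yr gap; split => // p dl0 pp; rewrite /= in Xr Yr gap *; have Xp := prox_in pp.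
have Ybr := best_response_in pb mu0 muL Xr.
have := gap _ _ Xp Ybr; have := maxF_ge pb mu0 muL Xp Yr.
have := prox_gap_ge pp Xr; have := bregman_ge pb mu0 muL Xp Xr.
have := bregman_ge pb mu0 muL Xp Xprev; have := acc dl0 Xprev Yinit.
have := best_response_gap pb mu0 muL Xprev Yy; rewrite -/y.
have := dot_triangle y (br xprev) (br r).
have := dot_triangle (br xprev) (br p) (br r).
have -> : br xprev - br r = (br xprev - br p) + (br p - br r) by rewrite addrA subrK.
rewrite /prox_gap /reg_obj -/(F r) (dot_subC (br r) (br p)).
have -> : y - br r = (y - br xprev) + ((br xprev - br p) + (br p - br r)).
  by rewrite !addrA !subrK.
have rp := dot_ge0 (r - p); have ep := dot_ge0 (xi - p).
move: (dot (r - p) _) (dot (r - s) _) (dot (p - s) _) (dot (xi - p) _) rp ep.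
move=> D1 D2 D3 D4 rp ep.
move: (y - br xprev) (br xprev - br p) (br p - br r) => a b c.
have ab := dot_ge0 (a - b); have bc := dot_ge0 (b - c); have ac := dot_ge0 (a - c).
move: ab bc ac; rewrite !dotE (dotC b a) (dotC c a) (dotC c b) => ab bc ac _ _.
move=> ha1 ha2 hb hc hE hF hG.
have m1 := ler_wpM2l (ltW mu0) ab; have m2 := ler_wpM2l (ltW mu0) bc.
have m3 := ler_wpM2l (ltW mu0) ac; have m4 := mulr_ge0 (ltW mu0) rp.
have m5 := mulr_ge0 (ltW mu0) ep.
have m6 := mulr_ge0 (ltW mu0) (dot_ge0 b).
lra.
Qed.

End ApproxProx.

(** * Warm start *)

Lemma expR_half_le2 (R : realType) : expR (2^-1) <= 2 :> R.
Proof.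
have := expR_ge1Dx (- (2^-1) : R); rewrite expRN => h.
by rewrite -[leLHS]invrK invf_ple ?posrE ?invr_gt0 ?expR_gt0 //; lra.
Qed.

Lemma expR1_le4 (R : realType) : expR 1 <= 4 :> R.
Proof.
have -> : 1 = 2^-1 + 2^-1 :> R by lra.
by rewrite expRD; have := expR_half_le2 R; have := expR_gt0 (2^-1 : R); nra.
Qed.

Section WarmStart.
Variables (R : realType) (d m : nat).
Variables (X : set 'rV[R]_d) (Y : set 'rV[R]_m) (DX DY L mu : R).
Variables (f : 'rV[R]_d -> 'rV[R]_m -> R) (g : oracle R d m).
Hypotheses (pb : minimax_problem X Y DX DY L mu f g).
Hypotheses (mu0 : 0 < mu) (muL : mu <= L) (DX0 : 0 < DX).
Variables (x_init : 'rV[R]_d) (y_init : 'rV[R]_m) (nagd : R -> nat).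
Hypotheses (Xinit : X x_init) (Yinit : Y y_init).
Hypothesis (acc : agd_accurate X Y f g L mu nagd).

Local Notation br := (best_response Y f).
Local Notation F := (maxF Y f).
Local Notation is_prox := (is_prox X Y f g mu).
Local Notation prox_gap := (prox_gap Y mu f).

Let L0 : 0 < L. Proof. exact: lt_le_trans muL. Qed.

(** (p, br p) is the saddle point of the regularized objective, which is
    mu-strongly convex-concave: a call contracts the squared distance to it. *)
Lemma prox_call_contracts s p x y : is_prox s p -> X x -> Y y ->
  let r := (mirror_prox X Y (regularize g mu s) (L + mu) x y (prox_steps L mu)).1 in
  dot (r.1 - p) (r.1 - p) + dot (r.2 - br p) (r.2 - br p) <=
  64^-1 * (dot (x - p) (x - p) + dot (y - br p) (y - br p)).
Proof.
move=> pp Xx Yy; have := prox_call pb mu0 muL s Xx Yy.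
move: (mirror_prox _ _ _ _ _ _ _).1 => [a b] /= [Xa Yb gap].
have [Xp opt] := pp; have Ybr := best_response_in pb mu0 muL Xp.
have := gap _ _ Xp Ybr; have := best_response_gap pb mu0 muL Xp Yb.
have := convex_gradient pb Xp Xa Ybr; have := opt _ Xa.
rewrite /reg_obj -/(F p) /gradF.
have -> : a - s = (a - p) + (p - s) by rewrite addrA subrK.
set B := dot (b - _) _; set X2 := dot (x - p) _; set Y2 := dot (y - _) _.
move: (a - p) (p - s) (g _ _).1 => u v G; rewrite !dotE (dotC v u) => h1 h2 h3 h4.
rewrite -(ler_pM2l mu0); lra.
Qed.

(** Each call contracts by 64 >= exp 2, so 2 ln (L / mu) calls gain a factor
    (L / mu)^4; the last call turns distances into function values. *)
Definition warm_steps := (ceil_nat (2 * ln (L / mu))).+1.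

Let kappa := L / mu.

Let kappa_ge1 : 1 <= kappa.
Proof. by rewrite /kappa ler_pdivlMr // mul1r. Qed.

Lemma warm_steps_contract :
  (64^-1) ^+ warm_steps.-1 * (5 * kappa ^+ 2) <= 5 / kappa ^+ 2 :> R.
Proof.
set n := warm_steps.-1.
have k0 : 0 < kappa by have := kappa_ge1; lra.
have nge : 2 * ln kappa <= n%:R by apply: ceil_nat_ge; rewrite mulr_ge0 ?ln_ge0.
have e64 : kappa ^+ 4 <= 64 ^+ n :> R.
  apply: (@le_trans _ _ (expR (2 * n%:R))).
    rewrite -[X in X ^+ 4](lnK (_ : kappa \in Num.pos)) ?posrE //.
    by rewrite -expRM_natl ler_expR; lra.
  rewrite mulrC expRM_natl lerXn2r ?nnegrE ?expR_ge0 //.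
  have -> : 2 = 1 + 1 :> R by [].
  by rewrite expRD; have := expR1_le4 R; have := expR_gt0 (1 : R); nra.
have e1 : (64^-1) ^+ n * kappa ^+ 4 <= 1 :> R.
  by rewrite exprVn mulrC ler_pdivrMr ?exprn_gt0 // mul1r.
rewrite ler_pdivlMr ?exprn_gt0 //; move: ((64^-1) ^+ n) e1 => q e1.
have -> : q * (5 * kappa ^+ 2) * kappa ^+ 2 =
  5 * (q * kappa ^+ 4) by ring.
by rewrite -[leRHS]mulr1 ler_pM2l.
Qed.

Lemma warm_steps_le : warm_steps%:R <= 4 * logO (L / mu).
Proof.
have : warm_steps.-1%:R <= 2 * ln (L / mu) + 1.
  by apply: ceil_nat_le; rewrite mulr_ge0 // ln_ge0 // ler_pdivlMr // mul1r.
have : 1 <= logO (L / mu) by rewrite /logO le_max lexx.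
have : ln (L / mu) <= logO (L / mu) by rewrite /logO le_max lexx orbT.
by rewrite /warm_steps /= -natr1; lra.
Qed.

(** All calls but the last bring the squared distance to the saddle point down
    to order (mu / L * DX)^2, which compensates for the Lipschitz constant L / mu
    of the best response in the bound of the last call. *)
Lemma warm_start_gap :
  let r := (warm_start X Y g L mu DX x_init y_init nagd warm_steps (prox_steps L mu)).1 in
  X r /\ forall z, X z -> F r - F z <= 3 / 2 * mu * DX ^+ 2.
Proof.
have -> : (warm_start X Y g L mu DX x_init y_init nagd warm_steps (prox_steps L mu)).1 =
  (iterM warm_steps (fun _ (z : 'rV[R]_d * 'rV[R]_m) =>
      mirror_prox X Y (regularize g mu x_init) (L + mu) z.1 z.2 (prox_steps L mu))
    (x_init, (agd Y g L mu (nagd (L * DX ^+ 2 / 2)) x_init y_init).1)).1.1 by [].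
set y0 := (agd _ _ _ _ _ _ _).1.
have Yy0 : Y y0 := agd_in pb mu0 muL _ Xinit Yinit.
have [p pp] := prox_exists pb mu0 muL (ltW mu0) Xinit; have Xp := prox_in pp.
have Ybp := best_response_in pb mu0 muL Xp.
pose dist x y := dot (x - p) (x - p) + dot (y - br p) (y - br p).
(* 5 = 1 + 2 + 2, from the primal distance and from the two segments of the path
   that joins y0 to br p through br x_init. *)
pose D0 := 5 * kappa ^+ 2 * DX ^+ 2.
have k0 : 0 < kappa by have := kappa_ge1; lra.
have kmu : kappa * mu = L by rewrite /kappa divfK // gt_eqF.
have brlip a b : X a -> X b ->
    dot (br a - br b) (br a - br b) <= kappa ^+ 2 * dot (a - b) (a - b).
  move=> Xa Xb; have := best_response_lipschitz pb mu0 muL Xb Xa.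
  rewrite -kmu.
  have -> (D : R) : (kappa * mu) ^+ 2 * D = mu ^+ 2 * (kappa ^+ 2 * D) by ring.
  by rewrite ler_pM2l // exprn_gt0.
have dist0 : dist x_init y0 <= D0.
  have := primal_dist pb Xinit Xp; rewrite /dist /D0 => hX.
  have := brlip _ _ Xinit Xp.
  have dl0 : 0 < L * DX ^+ 2 / 2 by rewrite divr_gt0 ?mulr_gt0 ?exprn_gt0.
  have := acc dl0 Xinit Yinit; have := best_response_gap pb mu0 muL Xinit Yy0.
  rewrite -/y0; have := dot_triangle y0 (br x_init) (br p).
  move: (dot (y0 - br p) _) (dot (y0 - br x_init) _) (dot (br x_init - br p) _) => A B C.
  move: (dot _ _) hX => D hX h1 h2 h3 h4.
  have hB : B <= kappa * DX ^+ 2.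
    rewrite -(ler_pM2l mu0); have -> : mu * (kappa * DX ^+ 2) = L * DX ^+ 2.
      by rewrite -kmu; ring.
    lra.
  have hC : C <= kappa ^+ 2 * DX ^+ 2.
    by apply: le_trans h4 _; rewrite ler_wpM2l // exprn_ge0 // ltW.
  have k1 := kappa_ge1; have R0 : 0 <= DX ^+ 2 by rewrite exprn_ge0 // ltW.
  have : kappa * DX ^+ 2 <= kappa ^+ 2 * DX ^+ 2 by rewrite ler_wpM2r // expr2 ler_pMr.
  have : DX ^+ 2 <= kappa * DX ^+ 2 by rewrite ler_pMl // exprn_gt0.
  lra.
pose Q (i : nat) (z : 'rV[R]_d * 'rV[R]_m) :=
  [/\ X z.1, Y z.2 & dist z.1 z.2 <= (64^-1) ^+ i * D0].
set step := (fun _ => _).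
have Qn i : Q i (iterM i step (x_init, y0)).1.
  apply: (@iterM_ind _ Q) => [|j [x y] [/= Xx Yy le]].
    by split=> //=; rewrite expr0 mul1r.
  have [Xr Yr _] := prox_call pb mu0 muL x_init Xx Yy; split => //.
  apply: le_trans (prox_call_contracts pp Xx Yy) _.
  by rewrite exprS -mulrA ler_wpM2l.
rewrite /warm_steps -/(warm_steps.-1); set n := warm_steps.-1.
have -> : (iterM n.+1 step (x_init, y0)).1 = (step n (iterM n step (x_init, y0)).1).1 by [].
have := Qn n; move: (iterM n step _).1 => [x y] [Xx Yy le]; rewrite /= in Xx Yy le.
have {}le : dist x y <= 5 / kappa ^+ 2 * DX ^+ 2.
  apply: le_trans le _; rewrite mulrA ler_wpM2r ?exprn_ge0 ?(ltW DX0) //.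
  exact: warm_steps_contract.
have -> : step n (x, y) = mirror_prox X Y (regularize g mu x_init) (L + mu) x y
  (prox_steps L mu) by [].
have := prox_call_contracts pp Xx Yy.
have := prox_call pb mu0 muL x_init Xx Yy.
move: (mirror_prox _ _ _ _ _ _ _).1 => [a b] /= [Xa Yb gap] ctr.
split => // z Xz; have Yba := best_response_in pb mu0 muL Xa.
have := gap _ _ Xp Yba; have := maxF_ge pb mu0 muL Xp Yb.
have := dot_triangle y (br p) (br a); have := brlip _ _ Xp Xa.
have := prox_gap_ge pp Xz; have := bregman_ge pb mu0 muL Xp Xz.
have := primal_dist pb Xz Xinit.
rewrite /prox_gap /reg_obj -/(F a) (dot_subC p a).
have bz := dot_ge0 (br z - br p); have zp := dot_ge0 (z - p).
have ai := dot_ge0 (a - x_init); have b0 := dot_ge0 (b - br p).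
have x0 := dot_ge0 (x - p); have yp0 := dot_ge0 (y - br p).
rewrite /dist in le; move: ctr le bz zp ai b0 x0 yp0.
move: (dot (x - p) _) (dot (y - br p) _) (dot (a - p) _) (dot (b - br p) _) => A1 A2 A3 A4.
move: (dot (br z - br p) _) (dot (z - p) _) (dot (a - x_init) _) => A5 A6 A7.
move: (dot (z - x_init) _) (dot (p - x_init) _) (dot (br p - br a) _) => A8 A9 A10.
move: (dot (y - br a) _) (bregman _ _ _ _ _) => A11 A12.
move=> ctr le bz zp ai b0 x0 yp0 h1 h2 h3 h4 h5 h6 h7.
have k2 : 0 < kappa ^+ 2 by rewrite exprn_gt0.
have R0 : 0 < DX ^+ 2 by rewrite exprn_gt0.
have lek : kappa ^+ 2 * (A1 + A2) <= 5 * DX ^+ 2.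
  by have := ler_wpM2l (ltW k2) le; rewrite mulrCA mulrA divfK ?gt_eqF.
have k1 : 1 <= kappa ^+ 2 by rewrite exprn_ege1.
have le1 : A1 + A2 <= 5 * DX ^+ 2.
  apply: le_trans lek; rewrite ler_peMl //; lra.
have leA3 : kappa ^+ 2 * A3 <= 5 * DX ^+ 2.
  apply: le_trans _ lek; rewrite ler_wpM2l ?(ltW k2) //; lra.
have := ler_wpM2l (ltW mu0) h1; have := mulr_ge0 (ltW mu0) bz.
have := mulr_ge0 (ltW mu0) zp; have := mulr_ge0 (ltW mu0) ai.
have : mu * (A1 + A11) <= mu * (25 * DX ^+ 2) by rewrite ler_pM2l //; lra.
have : 0 <= mu * DX ^+ 2 by rewrite mulr_ge0 // ltW.
lra.
Qed.

End WarmStart.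

(** * The unbiased proximal step and the potential of one iteration *)

Section LevelSums.
Variable R : realType.

(** The cancellation that makes the randomized estimator unbiased. *)
Lemma sum_level_telescope (b : nat -> R) n :
  \sum_(2 <= j < n.+2) (b 1%N + 2 ^+ j.-1 * (b j - b j.-1)) / 2 ^+ j.-1 =
  b n.+1 - b 1%N / 2 ^+ n.
Proof.
elim: n => [|n IH]; first by rewrite big_geq // expr0 divr1 subrr.
rewrite big_nat_recr //= IH exprS; field.
by rewrite expf_neq0.
Qed.

Lemma geometric_levels (e : nat -> R) b delta :
  0 <= e 0%N -> e 0%N <= b -> 0 < delta ->
  (forall i, e i.+1 <= (e i + delta / 8 / 4 ^+ i.+1) / 16) ->
  forall j, e j.+1 <= (b / 4 + delta) / 4 ^+ j.+1.
Proof.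
move=> e0 eb dl0 step; elim=> [|j IH]; first by have := step 0%N; rewrite expr1; lra.
apply: le_trans (step j.+1) _; move: IH; rewrite [4 ^+ j.+2]exprS invfM.
have q0 : 0 < (4 ^+ j.+1)^-1 :> R by rewrite invr_gt0 exprn_gt0.
move: (4 ^+ j.+1)^-1 (e j.+1) q0 => q c q0 IH.
have := mulr_ge0 (le_trans e0 eb) (ltW q0).
have := mulr_ge0 (ltW dl0) (ltW q0); lra.
Qed.

End LevelSums.

Lemma iterM_rcons T (x0 : T) (G : nat -> T -> counted T) (lev : nat -> T) n :
  (forall i, lev i.+1 = (G i (lev i)).1) ->
  let c := iterM n (fun i xs => bind (G i (nth x0 xs i)) (fun x => ret (rcons xs x)))
    [:: lev 0%N] in
  c.1 = mkseq lev n.+1 /\ c.2 = (\sum_(0 <= i < n) (G i (lev i)).2)%N.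
Proof.
move=> levE; elim: n => [|n [IH1 IH2]]; first by rewrite big_geq.
rewrite big_nat_recr //= IH1 IH2 nth_mkseq //= addn0; split => //.
by rewrite -levE; exact/esym/(mkseqS lev n.+1).
Qed.

Section Step.
Variables (R : realType) (d m : nat).
Variables (X : set 'rV[R]_d) (Y : set 'rV[R]_m) (DX DY L mu : R).
Variables (f : 'rV[R]_d -> 'rV[R]_m -> R) (g : oracle R d m).
Hypotheses (pb : minimax_problem X Y DX DY L mu f g).
Hypotheses (mu0 : 0 < mu) (muL : mu <= L).
Variables (y_init : 'rV[R]_m) (nagd : R -> nat).
Hypotheses (Yinit : Y y_init) (acc : agd_accurate X Y f g L mu nagd).

Local Notation F := (maxF Y f).
Local Notation dF := (gradF Y f g).
Local Notation is_prox := (is_prox X Y f g mu).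
Local Notation prox_gap := (prox_gap Y mu f).
Local Notation bregman := (bregman Y f g).
Local Notation approx := (approx_prox X Y g L mu y_init nagd).

Definition level_accuracy (delta : R) j := delta / 2 ^+ (3 + 2 * j).

Fixpoint prox_level delta s x j : 'rV[R]_d :=
  if j is i.+1 then
    (approx (level_accuracy delta j) s (prox_level delta s x i) (prox_level delta s x i)).1
  else (approx (level_accuracy delta 0) s s x).1.

Lemma unbiasedE delta s x J : (2 <= J)%N ->
  (unbiased_prox X Y g L mu y_init nagd delta s x J).1 =
  prox_level delta s x 1 +
    2 ^+ J.-1 *: (prox_level delta s x J - prox_level delta s x J.-1).
Proof.
move=> J2; have [xsE _] := @iterM_rcons _ 0
  (fun i y => approx (level_accuracy delta i.+1) s y y) (prox_level delta s x) J
  (fun=> erefl).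
transitivity (let xs := (iterM J (fun i xs =>
    bind (approx (level_accuracy delta i.+1) s (nth 0 xs i) (nth 0 xs i))
         (fun y => ret (rcons xs y))) [:: prox_level delta s x 0]).1 in
  nth 0 xs 1 + 2 ^+ J.-1 *: (nth 0 xs J - nth 0 xs J.-1)); first by [].
by rewrite xsE; cbv zeta; rewrite !nth_mkseq //; lia.
Qed.

Section Accuracy.
Variables (delta : R) (s x p : 'rV[R]_d).
Hypotheses (dl0 : 0 < delta) (Xs : X s) (Xx : X x) (pp : is_prox s p).

Local Notation lev := (prox_level delta s x).
Local Notation E := (fun j => prox_gap s p (lev j)).

Lemma prox_gap_ge0 z : X z -> 0 <= prox_gap s p z.
Proof.
move=> Xz; have Xp := prox_in pp; have := prox_gap_ge pp Xz.
have := bregman_ge pb mu0 muL Xp Xz.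
have := mulr_ge0 (ltW mu0) (dot_ge0 (z - p)).
have := mulr_ge0 (ltW mu0) (dot_ge0 (best_response Y f z - best_response Y f p)).
lra.
Qed.

Lemma level_in j : X (lev j).
Proof.
by elim: j => [|j IH] /=; apply: (proj1 (approx_prox_gap pb mu0 muL Yinit acc _ _ _ _)).
Qed.

Lemma prox_gap_dist z : X z -> mu / 2 * dot (z - p) (z - p) <= prox_gap s p z.
Proof.
move=> Xz; have Xp := prox_in pp; have := prox_gap_ge pp Xz.
have := bregman_ge pb mu0 muL Xp Xz.
have := mulr_ge0 (ltW mu0) (dot_ge0 (best_response Y f z - best_response Y f p)).
lra.
Qed.

(** The bound of [approx_prox_gap] at level 0, whose accuracy is delta / 8. *)
Definition level0_bound := (bregman p x + mu / 2 * dot (s - p) (s - p) + delta / 8) / 16.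

Lemma level_gap0 : E 0%N <= level0_bound.
Proof.
have := (proj2 (approx_prox_gap pb mu0 muL Yinit acc (level_accuracy delta 0) s Xs Xx)) p.
rewrite /level_accuracy muln0 addn0 => H.
have d8 : delta / 2 ^+ 3 = delta / 8 by congr (_ / _); ring.
rewrite d8 in H; rewrite /= /level_accuracy muln0 addn0 d8.
by apply: H => //; rewrite divr_gt0.
Qed.

(** Each level divides the gap by 16 up to its own accuracy, which decreases by
    a factor of 4. *)
Lemma level_gap j : E j.+1 <= (level0_bound / 4 + delta) / 4 ^+ j.+1.
Proof.
apply: (@geometric_levels _ (fun j => prox_gap s p (lev j))) => //.
- exact: prox_gap_ge0 (level_in 0).
- exact: level_gap0.
move=> i.
have Xl := level_in i.
have accE : level_accuracy delta i.+1 = delta / 8 / 4 ^+ i.+1.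
  rewrite /level_accuracy exprD exprM.
  have -> : 2 ^+ 3 = 8 :> R by ring.
  have -> : 2 ^+ 2 = 4 :> R by ring.
  by rewrite invfM mulrA.
have dl : 0 < level_accuracy delta i.+1 by rewrite accE !divr_gt0 ?exprn_gt0.
have h1 := (proj2 (approx_prox_gap pb mu0 muL Yinit acc (level_accuracy delta i.+1)
  s Xl Xl)) p dl pp.
apply: le_trans h1 _; rewrite -accE ler_pM2r ?invr_gt0 // lerD2r.
exact: prox_gap_ge pp Xl.
Qed.

Lemma level_dist j :
  mu / 2 * dot (lev j.+1 - p) (lev j.+1 - p) <= (level0_bound / 4 + delta) / 4 ^+ j.+1.
Proof. exact: le_trans (prox_gap_dist (level_in _)) (level_gap j). Qed.

Local Notation xt := (fun J => (unbiased_prox X Y g L mu y_init nagd delta s x J).1).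

(** The estimator's factor 2 ^ (J - 1), squared, exactly offsets the decrease of
    the levels' squared errors: the error is bounded uniformly in J. *)
Lemma unbiased_second_moment J : (2 <= J)%N ->
  mu / 2 * dot (xt J - p) (xt J - p) <= 11 / 2 * (level0_bound / 4 + delta).
Proof.
case: J => [|[|j]] // _; rewrite unbiasedE // -pred_Sn.
have := level_dist; move: (prox_level delta s x) => l ld.
have := ld 0%N; have := ld j; have := ld j.+1; clear ld.
have -> : l 1%N + 2 ^+ j.+1 *: (l j.+2 - l j.+1) - p =
    (l 1%N - p) + 2 ^+ j.+1 *: ((l j.+2 - p) - (l j.+1 - p)).
  by apply/rowP => i; rewrite !mxE; ring.
rewrite expr1; move: (l 1%N - p) (l j.+2 - p) (l j.+1 - p) => a b c.
move: (level0_bound / 4 + delta) => B hb hc ha.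
have e1 : 2 ^+ j.+1 ^+ 2 = 4 ^+ j.+1 :> R.
  by rewrite -exprM mulnC exprM; congr (_ ^+ _); ring.
have k0 : 0 < 4 ^+ j.+1 :> R by rewrite exprn_gt0.
have hb' : 4 ^+ j.+1 * (mu / 2 * dot b b) <= B / 4.
  apply: le_trans (ler_wpM2l (ltW k0) hb) _; rewrite [4 ^+ j.+2]exprS; set k := 4 ^+ j.+1.
  by rewrite le_eqVlt; apply/orP; left; apply/eqP; field; rewrite gt_eqF.
have hc' : 4 ^+ j.+1 * (mu / 2 * dot c c) <= B.
  by apply: le_trans (ler_wpM2l (ltW k0) hc) _; rewrite mulrCA mulfV ?mulr1 // gt_eqF.
have t1 := dot_triangle a 0 (- (2 ^+ j.+1 *: (b - c))).
rewrite !sub0r !subr0 !opprK in t1.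
have t2 := dot_triangle b 0 c; rewrite sub0r subr0 in t2.
have bcE : dot (2 ^+ j.+1 *: (b - c)) (2 ^+ j.+1 *: (b - c)) =
  4 ^+ j.+1 * dot (b - c) (b - c) by rewrite dotZl dotZr -e1; ring.
have ccE : dot (- c) (- c) = dot c c by rewrite dotNl dotNr opprK.
rewrite bcE in t1; rewrite ccE in t2.
have := ler_wpM2l (ltW mu0) t1; have := ler_wpM2l (mulr_ge0 (ltW mu0) (ltW k0)) t2.
lra.
Qed.

(** Along any direction b, the weighted errors of the estimator cancel up to a
    term that vanishes with the number of levels summed. *)
Lemma unbiased_mean (b : 'rV[R]_d) : exists B, forall n,
  mu * (\sum_(2 <= j < n.+2) dot b (xt j - p) / 2 ^+ j.-1) <= B / 2 ^+ n.
Proof.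
pose c := level0_bound / 4 + delta.
exists ((mu * dot b b + c / 2) / 2 - mu * dot b (lev 1 - p)) => n.
rewrite (eq_big_nat _ _ (F2 := fun j => (dot b (lev 1 - p) + 2 ^+ j.-1 *
    (dot b (lev j - p) - dot b (lev j.-1 - p))) / 2 ^+ j.-1)); last first.
  move=> j /andP[j2 _]; rewrite unbiasedE //; congr (_ / _).
  by rewrite !dotE; ring.
rewrite (sum_level_telescope (fun j => dot b (lev j - p))).
have := level_dist n; rewrite -/c; move: (prox_level delta s x) => l0.
move: (l0 n.+1 - p) (dot b (l0 1%N - p)) => l b1 hl.
have k0 : 0 < 2 ^+ n :> R by rewrite exprn_gt0.
have q0 : 0 < (2 ^+ n)^-1 :> R by rewrite invr_gt0.
have e1 : 2 ^+ n ^+ 2 = 4 ^+ n :> R.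
  by rewrite -exprM mulnC exprM; congr (_ ^+ _); ring.
have hl' : mu * (2 ^+ n ^+ 2 * dot l l) <= c / 2.
  rewrite e1; have k4 : 0 < 4 ^+ n :> R by rewrite exprn_gt0.
  have := ler_wpM2l (ltW k4) hl.
  have -> : 4 ^+ n * (c / 4 ^+ n.+1) = c / 4.
    by rewrite exprS; field; rewrite gt_eqF.
  lra.
have := dot_young b (2 ^+ n *: l); rewrite !dotZr dotZl => hy.
have -> : dot b l = (2 ^+ n)^-1 * (2 ^+ n * dot b l) by rewrite mulKf // gt_eqF.
move: q0; set q := (2 ^+ n)^-1 => q0.
have := ler_wpM2l (ltW (mulr_gt0 mu0 q0)) hy; have := ler_wpM2l (ltW q0) hl'.
rewrite expr2; lra.
Qed.

End Accuracy.

(** One iteration of the accelerated method. The step for v is a projected step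
    along an unbiased estimate of s - p, so its expected squared distance to u
    drops by the inner product of s - p with v - u; writing alpha (v - u) as
    (s - p) + (1 - alpha) (p - x) + alpha (p - u) turns this into function
    values. The terms mu / 2 |s - p|^2 and (1 - alpha) times the Bregman
    divergence at x are left over and absorb both approximation errors, which
    is why 1 - alpha must stay away from 0. *)
Lemma recapp_drift (alpha delta : R) (x v u : 'rV[R]_d) :
  0 < alpha -> alpha <= 5 / 8 -> 0 < delta -> X x -> X v -> X u ->
  (forall z, X z -> F u <= F z) ->
  let s := (1 - alpha) *: x + alpha *: v in
  exists B, forall n,
    \sum_(2 <= j < n)
      ((alpha ^+ 2)^-1 * (F (approx delta s s x).1 - F u) + mu / 2 *
        let v' := proj X (v - alpha^-1 *: (s -
          (unbiased_prox X Y g L mu y_init nagd delta s x j).1)) in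
        dot (v' - u) (v' - u)) / 2 ^+ j.-1 <=
    (1 - alpha) * (alpha ^+ 2)^-1 * (F x - F u) + mu / 2 * dot (v - u) (v - u)
    + 6 * delta * (alpha ^+ 2)^-1 + B / 2 ^+ n.
Proof.
move=> al0 al1 dl0 Xx Xv Xu umin s.
have Xs : X s by apply: (segment_primal pb) => //; lra.
have [p pp] := prox_exists pb mu0 muL (ltW mu0) Xs; have Xp := prox_in pp.
have [] := approx_prox_gap pb mu0 muL Yinit acc delta s Xs Xx.
set x' := (approx _ _ _ _).1 => Xx' /(_ p dl0 pp) hx'.
set a := alpha^-1; have a0 : 0 < a by rewrite invr_gt0.
have aal : alpha * a = 1 by rewrite mulfV // gt_eqF.
have -> : (alpha ^+ 2)^-1 = a ^+ 2 by rewrite exprVn.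
pose b := v - u - a *: (s - p).
pose V := 11 / 2 * (level0_bound delta s x p / 4 + delta).
have V0 : 0 <= V.
  have := level_gap0 dl0 Xs Xx pp; have := prox_gap_ge0 pp (level_in delta Xs Xx 0).
  by rewrite /V; lra.
pose xt j := (unbiased_prox X Y g L mu y_init nagd delta s x j).1.
have pw j : (2 <= j)%N ->
    mu / 2 * dot (proj X (v - a *: (s - xt j)) - u) (proj X (v - a *: (s - xt j)) - u) <=
    mu / 2 * dot b b + mu * a * dot b (xt j - p) + a ^+ 2 * V.
  move=> j2; have := @proj_contract _ _ X (mp_X_nonempty pb) (compact_primal pb)
    (segment_primal pb) (v - a *: (s - xt j)) u Xu.
  have -> : v - a *: (s - xt j) - u = b + a *: (xt j - p).
    by apply/rowP => i; rewrite !mxE; ring.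
  have := unbiased_second_moment dl0 Xs Xx pp j2; rewrite -/(xt j) -/V.
  move: (proj _ _ - u) (xt j - p) (b) => w e b' hV; rewrite !dotE (dotC e b') => hw.
  have := ler_wpM2l (ltW mu0) hw; have := ler_wpM2l (sqr_ge0 a) hV; lra.
pose C := a ^+ 2 * (F x' - F u) + mu / 2 * dot b b + a ^+ 2 * V.
have C0 : 0 <= C.
  rewrite /C; have := mulr_ge0 (ltW mu0) (dot_ge0 b).
  have := umin _ Xx'; rewrite -subr_ge0 => /(mulr_ge0 (sqr_ge0 a)).
  have := mulr_ge0 (sqr_ge0 a) V0; lra.
have leC : C <= (1 - alpha) * a ^+ 2 * (F x - F u) + mu / 2 * dot (v - u) (v - u)
    + 6 * delta * a ^+ 2.
  have o1 := pp.2 _ Xx; have o2 := pp.2 _ Xu; have g1 := prox_gap_dist pp Xx'.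
  have g2 := bregman_ge pb mu0 muL Xp Xu; have g0 := bregman_ge pb mu0 muL Xp Xx.
  have n2 := mulr_ge0 (ltW mu0) (dot_ge0 (best_response Y f u - best_response Y f p)).
  have n0 := mulr_ge0 (ltW mu0) (dot_ge0 (best_response Y f x - best_response Y f p)).
  have t1 := dot_triangle p x' s; rewrite (dot_subC p x') in t1.
  have brx : bregman p x = F x - F p - dot (dF p) (x - p) by [].
  have bru : bregman p u = F u - F p - dot (dF p) (u - p) by [].
  have vE : v - u = a *: ((s - p) + (1 - alpha) *: (p - x) + alpha *: (p - u)).
    by apply/rowP => i; rewrite /a /s !mxE; field; rewrite gt_eqF.
  have bE : dot b b = dot (v - u) (v - u) + a ^+ 2 * dot (s - p) (s - p)
      - 2 * a ^+ 2 * (dot (s - p) (s - p) - (1 - alpha) * dot (s - p) (x - p)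
      - alpha * dot (s - p) (u - p)).
    have -> : dot b b = dot (v - u) (v - u) - 2 * a * dot (s - p) (v - u)
        + a ^+ 2 * dot (s - p) (s - p).
      by rewrite /b; move: (v - u) (s - p) => c e; rewrite !dotE (dotC e c); ring.
    rewrite [in dot (s - p) (v - u)]vE -(opprB x p) -(opprB u p).
    by move: (s - p) (x - p) (u - p) => c e h; rewrite !dotE; ring.
  rewrite -/(prox_gap s p x') in hx' g1; rewrite /prox_gap in hx' g1.
  rewrite /C bE /V /level0_bound.
  rewrite -(opprB s p) dotDl dotZl dotNl in o1; rewrite -(opprB s p) dotDl dotZl dotNl in o2.
  rewrite (dot_subC p s) in hx' g1 t1.
  have t1' := ler_wpM2l (ltW mu0) t1; clear t1.
  have S0 : 0 <= mu * dot (s - p) (s - p) by rewrite mulr_ge0 ?dot_ge0 ?ltW.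
  move: (dot (s - p) (s - p)) (dot (x' - s) (x' - s)) (dot (x' - p) (x' - p)) brx bru
    o1 o2 hx' g1 t1' S0 => S S' S'' brx bru o1 o2 hx' g1 t1' S0.
  move: (bregman p x) (bregman p u) brx bru hx' g0 g2 => Bx Bu brx bru hx' g0 g2.
  have a20 : 0 < a ^+ 2 by rewrite exprn_gt0.
  rewrite -subr_ge0; set W := (X in 0 <= X).
  pose Wa := (1 - alpha) * (F x - F u) + 6 * delta - (F x' - F u) - mu / 2 * S
    + mu * (S - (1 - alpha) * dot (s - p) (x - p) - alpha * dot (s - p) (u - p))
    - 11 / 2 * ((Bx + mu / 2 * S + delta / 8) / 16 / 4 + delta).
  have -> : W = a ^+ 2 * Wa by rewrite /W /Wa; field.
  apply: mulr_ge0; first exact: ltW.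
  rewrite /Wa; clear W Wa.
  have al1' : 0 <= 1 - alpha by lra.
  have p1 : (1 - alpha) * (mu * dot (s - p) (x - p)) <= (1 - alpha) * (F x - F p - Bx).
    by apply: ler_wpM2l => //; lra.
  have p2 : alpha * (mu * dot (s - p) (u - p)) <= alpha * (F u - F p).
    by apply: ler_wpM2l; lra.
  have p3 : 3 / 8 * Bx <= (1 - alpha) * Bx by apply: ler_wpM2r; lra.
  have p4 : F x' - F p <= (Bx + mu / 2 * S + delta) / 8 + mu / 4 * S by lra.
  move: (dot (s - p) (x - p)) (dot (s - p) (u - p)) p1 p2 => c1 c2 p1 p2; lra.
have [B leB] := unbiased_mean dl0 Xs Xx pp b.
exists (4 * a * `|B|) => n.
apply: (@le_trans _ _ (C + 4 * a * `|B| / 2 ^+ n)); last by rewrite lerD2r.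
case: n => [|[|n]].
- by rewrite big_geq // addr_ge0 // divr_ge0 ?exprn_ge0 // !mulr_ge0 // ltW.
- by rewrite big_geq // addr_ge0 // divr_ge0 ?exprn_ge0 // !mulr_ge0 // ltW.
apply: (@le_trans _ _ (\sum_(2 <= j < n.+2)
    (C * (2 ^+ j.-1)^-1 + a * (mu * (dot b (xt j - p) / 2 ^+ j.-1))))).
  apply: ler_sum_nat => j /andP[j2 _].
  have q0 : 0 < (2 ^+ j.-1)^-1 :> R by rewrite invr_gt0 exprn_gt0.
  have := pw j j2; cbv zeta; rewrite -/(xt j) /C.
  move: (dot (proj _ _ - u) _) (dot b (xt j - p)) => w e hw.
  have -> : a * (mu * (e / 2 ^+ j.-1)) = mu * a * e * (2 ^+ j.-1)^-1 by ring.
  by rewrite -mulrDl ler_pM2r //; lra.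
rewrite big_split /= -mulr_sumr sum_level_weights -mulr_sumr -mulr_sumr.
have := ler_wpM2l (ltW a0) (leB n).
have q0 : 0 < (2 ^+ n)^-1 :> R by rewrite invr_gt0 exprn_gt0.
have -> : 4 * a * `|B| / 2 ^+ n.+2 = a * (`|B| / 2 ^+ n).
  by rewrite !exprS; field; rewrite gt_eqF // exprn_gt0.
have : a * (B / 2 ^+ n) <= a * (`|B| / 2 ^+ n).
  by rewrite ler_pM2l // ler_pM2r // ler_norm.
have := mulr_ge0 C0 (ltW q0); rewrite mulrBr mulr1; lra.
Qed.

End Step.

(** * The accelerated loop in expectation *)

Section StepSizes.
Variables (R : realType) (alpha : nat -> R).
Hypothesis ss : step_sizes alpha.

Lemma step_size_gt0 t : 0 < alpha t.
Proof.
case: ss => a0 aS; elim: t => [|t IH]; first by rewrite a0.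
have [/andP[ge0 _] eq] := aS t; rewrite lt_neqAle ge0 andbT eq_sym.
apply/eqP => z; move: eq; rewrite z expr0n /= !invr0 subrr => /esym/eqP.
by rewrite invr_eq0 expf_eq0 /= gt_eqF.
Qed.

Lemma step_size_rec t : (1 - alpha t.+1) * (alpha t.+1 ^+ 2)^-1 = (alpha t ^+ 2)^-1.
Proof.
case: ss => _ /(_ t)[_ <-]; have := step_size_gt0 t.+1 => a0.
by field; rewrite gt_eqF.
Qed.

Lemma inv_step_size_rec t :
  (alpha t.+1)^-1 ^+ 2 = (alpha t.+1)^-1 + (alpha t)^-1 ^+ 2.
Proof.
by rewrite !exprVn -(step_size_rec t); have a0 := step_size_gt0 t.+1; field; rewrite gt_eqF.
Qed.

Lemma inv_step_size_gt0 t : 0 < (alpha t)^-1.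
Proof. by rewrite invr_gt0 step_size_gt0. Qed.

Lemma inv_step_size_ge t : 1 + t%:R / 2 <= (alpha t)^-1.
Proof.
elim: t => [|t IH]; first by case: ss => -> _; rewrite invr1 mul0r addr0.
have := inv_step_size_rec t; have := inv_step_size_gt0 t.+1.
have t0 : 0 <= t%:R :> R by [].
rewrite -natr1; move: (alpha t)^-1 (alpha t.+1)^-1 IH => b c IH c0 eq; nra.
Qed.

Lemma inv_step_size_le t : (alpha t)^-1 <= 1 + t%:R.
Proof.
elim: t => [|t IH]; first by case: ss => -> _; rewrite invr1 addr0.
have := inv_step_size_rec t; have := inv_step_size_gt0 t.+1.
have := inv_step_size_gt0 t; have t0 : 0 <= t%:R :> R by [].
rewrite -natr1; move: (alpha t)^-1 (alpha t.+1)^-1 IH => b c IH b0 c0 eq; nra.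
Qed.

(** The largest of these step sizes is alpha 1 = 0.618..., the inverse of the
    golden ratio. *)
Lemma step_size_le t : alpha t.+1 <= 5 / 8.
Proof.
have t0 : 0 <= t%:R :> R by [].
have -> : 5 / 8 = (8 / 5)^-1 :> R by rewrite invf_div.
rewrite -[X in X <= _]invrK lef_pV2 ?posrE ?inv_step_size_gt0 //.
have := inv_step_size_rec t; have := inv_step_size_gt0 t.+1; have := inv_step_size_ge t.
move: (alpha t)^-1 (alpha t.+1)^-1 => b c hb c0 eq.
have b1 : 1 <= b by lra.
have b2 : 1 <= b ^+ 2 by exact: exprn_ege1.
rewrite leNgt; apply/negP => lt.
have : 0 < (8 / 5 - c) * (c + 3 / 5) by apply: mulr_gt0; lra.
lra.
Qed.

End StepSizes.

Lemma sum_inv_squares (R : realType) n :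
  \sum_(0 <= t < n) (t.+1%:R ^+ 2)^-1 <= 2 :> R.
Proof.
case: n => [|n]; first by rewrite big_geq.
suff h : \sum_(0 <= t < n.+1) (t.+1%:R ^+ 2)^-1 <= 2 - n.+1%:R^-1 :> R.
  by apply: le_trans h _; rewrite lerBlDr lerDl invr_ge0.
elim: n => [|n IH]; first by rewrite big_nat1 expr1n invr1; lra.
rewrite big_nat_recr //=; apply: le_trans (lerD IH (lexx _)) _.
have n0 : 0 < n.+1%:R :> R by rewrite ltr0n.
rewrite -[n.+2%:R]natr1; set x := n.+1%:R in n0 *.
have x1 : 0 < x + 1 by lra.
rewrite -subr_ge0.
have -> : 2 - (x + 1)^-1 - (2 - x^-1 + ((x + 1) ^+ 2)^-1) = (x * (x + 1) ^+ 2)^-1.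
  by field; rewrite !gt_eqF.
by rewrite invr_ge0 mulr_ge0 ?sqr_ge0 // ltW.
Qed.

Section Loop.
Variables (R : realType) (d m : nat).
Variables (X : set 'rV[R]_d) (Y : set 'rV[R]_m) (DX DY L mu : R).
Variables (f : 'rV[R]_d -> 'rV[R]_m -> R) (g : oracle R d m).
Hypotheses (pb : minimax_problem X Y DX DY L mu f g).
Hypotheses (mu0 : 0 < mu) (muL : mu <= L).
Variables (y_init : 'rV[R]_m) (nagd : R -> nat).
Hypotheses (Yinit : Y y_init) (acc : agd_accurate X Y f g L mu nagd).
Variables (alpha delta : nat -> R).
Hypotheses (ss : step_sizes alpha) (dl0 : forall t, 0 < delta t.+1).

Local Notation F := (maxF Y f).
Local Notation approx := (approx_prox X Y g L mu y_init nagd).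
Local Notation unbiased := (unbiased_prox X Y g L mu y_init nagd).
Local Notation loop := (recapp_loop X Y g L mu y_init nagd alpha delta).

Definition recapp_step t (st : 'rV[R]_d * 'rV[R]_d) (j : nat) :
    counted ('rV[R]_d * 'rV[R]_d) :=
  let: (x, v) := st in
  let a := alpha t.+1 in
  let s := (1 - a) *: x + a *: v in
  bind (approx (delta t.+1) s s x) (fun x' =>
  bind (unbiased (delta t.+1) s x j) (fun xt =>
  ret (x', proj X (v - a^-1 *: (s - xt))))).

Lemma recapp_loopE T x0 J : loop T x0 J =
  bind (iterM T (fun t st => recapp_step t st (J t)) (x0, x0)) (fun r => ret r.1).
Proof. by []. Qed.

Lemma recapp_step_in t st j : X st.1 -> X st.2 ->
  X (recapp_step t st j).1.1 /\ X (recapp_step t st j).1.2.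
Proof.
case: st => x v Xx Xv; have a0 := step_size_gt0 ss t.+1; have a1 := step_size_le ss t.
set s := (1 - alpha t.+1) *: x + alpha t.+1 *: v.
have Xs : X s by apply: (segment_primal pb) => //; rewrite ?ltW //; lra.
split; last exact: (proj_primal pb).
exact: (proj1 (approx_prox_gap pb mu0 muL Yinit acc (delta t.+1) s Xs Xx)).
Qed.

Lemma recapp_loop_in T x0 J : X x0 -> X (loop T x0 J).1.
Proof.
move=> Xx0; rewrite recapp_loopE.
suff [] : X (iterM T (fun t st => recapp_step t st (J t)) (x0, x0)).1.1 /\
          X (iterM T (fun t st => recapp_step t st (J t)) (x0, x0)).1.2 by [].
apply: (@iterM_ind _ (fun _ st => X st.1 /\ X st.2)) => [|t st [Xx Xv]]; first by [].
exact: recapp_step_in.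
Qed.

Context {dO : measure_display} {Omega : measurableType dO}.
Variables (P : probability Omega R) (J : nat -> {RV P >-> nat}).
Hypothesis HJ : level_samples J.

Section Run.
Variables (o : nat) (c0 : Omega -> counted 'rV[R]_d).
Hypotheses (ad0 : adapted J o c0) (Xc0 : forall w, X (c0 w).1).

Definition loop_run T w : counted 'rV[R]_d :=
  bind (c0 w) (fun x => loop T x (fun t => J (o + t)%N w)).

(** The query count travels with the iterates, so that the expected gap and the
    expected cost are both read off a single chain. *)
Definition loop_state t w : counted ('rV[R]_d * 'rV[R]_d) :=
  bind (c0 w) (fun x =>
    iterM t (fun i st => recapp_step i st (J (o + i)%N w)) (x, x)).

Lemma loop_stateS t w : loop_state t.+1 w =
  bind (loop_state t w) (fun st => recapp_step t st (J (o + t)%N w)).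
Proof. by rewrite /loop_state /bind /= addnA. Qed.

Lemma loop_state_in t w : X (loop_state t w).1.1 /\ X (loop_state t w).1.2.
Proof.
elim: t => [|t [Xx Xv]]; first by split; exact: Xc0.
by rewrite loop_stateS; exact: recapp_step_in.
Qed.

Lemma loop_runE T w : loop_run T w = ((loop_state T w).1.1, (loop_state T w).2).
Proof.
rewrite /loop_run {1}/bind recapp_loopE /loop_state [in RHS]/bind.
set r := iterM T _ _; by rewrite /bind /ret /fst /snd addn0.
Qed.

Lemma loop_state0_adapted : adapted J o (loop_state 0).
Proof. exact: (adapted_comp (fun c => bind c (fun x => ret (x, x))) ad0). Qed.

Lemma loop_state_adapted t : adapted J (o + t) (loop_state t).
Proof.
elim: t => [|t IH]; first by rewrite addn0; exact: loop_state0_adapted.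
have -> : loop_state t.+1 = fun w => bind (loop_state t w)
    (fun st => recapp_step t st (J (o + t)%N w)) by apply/funext; exact: loop_stateS.
rewrite addnS.
exact: (adapted_step (fun c j => bind c (fun st => recapp_step t st j)) IH).
Qed.

Lemma loop_run_adapted T : adapted J (o + T) (loop_run T).
Proof.
have [h hE] := adapted_comp (fun c : counted ('rV[R]_d * 'rV[R]_d) => (c.1.1, c.2))
  (loop_state_adapted T).
by exists h => w; rewrite loop_runE.
Qed.

(** The cost already incurred is weighted by probabilities of total at most 1, so
    only the expected cost of the new iteration is added. *)
Lemma loop_run_cost T (Z E0 : R) : 0 <= Z ->
  (forall t st n, (t < T)%N ->
     \sum_(2 <= j < n) (recapp_step t st j).2%:R / 2 ^+ j.-1 <= Z) ->
  (\int[P]_w ((c0 w).2%:R)%:E <= E0%:E)%E ->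
  (\int[P]_w ((loop_run T w).2%:R)%:E <= (E0 + T%:R * Z)%:E)%E.
Proof.
move=> Z0 leZ E0le.
pose psi (t : nat) (c : counted ('rV[R]_d * 'rV[R]_d)) : R := c.2%:R.
pose step t (c : counted ('rV[R]_d * 'rV[R]_d)) j := bind c (fun st => recapp_step t st j).
have [] := @expectation_chain _ _ _ _ _ HJ _ T o loop_state step psi
  (fun=> Z) E0 loop_state0_adapted loop_stateS _ _ _ _ _ T (leqnn T).
- by move=> t w; rewrite /psi ler0n.
- by move=> t w k; rewrite /psi ler0n.
- by [].
- move=> t w tT; move: (loop_state t w) => [st c]; exists 0 => n.
  rewrite mul0r addr0 /psi /step /bind [(_, c).2]/=.
  under eq_bigr do rewrite natrD mulrDl.
  rewrite big_split /=; apply: lerD; last exact: leZ.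
  rewrite -mulr_sumr; case: n => [|[|n]]; try by rewrite big_geq // mulr0.
  rewrite sum_level_weights mulrBr mulr1 gerBl.
  by apply: mulr_ge0 => //; rewrite invr_ge0 exprn_ge0.
- apply: le_trans E0le; rewrite le_eqVlt; apply/orP; left; apply/eqP.
  by apply: eq_integral => w _; rewrite /psi /= addn0.
move=> _; rewrite sumr_const_nat subn0 mulr_natl; apply: le_trans.
by rewrite le_eqVlt; apply/orP; left; apply/eqP; apply: eq_integral => w _; rewrite loop_runE.
Qed.

(** By the recursion of the step sizes, the coefficient (1 - alpha) / alpha^2 that
    [recapp_drift] leaves is the one of the previous potential. *)
Lemma loop_run_gap T (u : 'rV[R]_d) (E0 : R) :
  X u -> (forall z, X z -> F u <= F z) ->
  (\int[P]_w (F (c0 w).1 - F u + mu / 2 * dot ((c0 w).1 - u) ((c0 w).1 - u))%:E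
     <= E0%:E)%E ->
  (\int[P]_w ((alpha T)^-1 ^+ 2 * (F (loop_run T w).1 - F u))%:E <=
    (E0 + \sum_(0 <= t < T) 6 * delta t.+1 * (alpha t.+1)^-1 ^+ 2)%:E)%E.
Proof.
move=> Xu umin E0le.
pose psi t (c : counted ('rV[R]_d * 'rV[R]_d)) :=
  (alpha t ^+ 2)^-1 * (F c.1.1 - F u) + mu / 2 * dot (c.1.2 - u) (c.1.2 - u).
pose step t (c : counted ('rV[R]_d * 'rV[R]_d)) j := bind c (fun st => recapp_step t st j).
have gap0 z : X z -> 0 <= F z - F u by move/umin; rewrite subr_ge0.
have psi0 t c : X c.1.1 -> 0 <= psi t c.
  move=> Xc; rewrite /psi addr_ge0 // mulr_ge0 ?gap0 ?dot_ge0 //.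
    by rewrite invr_ge0 sqr_ge0.
  by rewrite divr_ge0 // ltW.
have [] := @expectation_chain _ _ _ _ _ HJ _ T o loop_state step psi
  (fun t => 6 * delta t.+1 * (alpha t.+1)^-1 ^+ 2) E0 loop_state0_adapted
  loop_stateS _ _ _ _ _ T (leqnn T).
- by move=> t w; apply: psi0; exact: (loop_state_in t w).1.
- move=> t w k; apply: psi0; have [Xx Xv] := loop_state_in t w.
  exact: (recapp_step_in _ _ Xx Xv).1.
- by move=> t; apply: mulr_ge0 (sqr_ge0 _); rewrite mulr_ge0 // ltW.
- move=> t w _; have [Xx Xv] := loop_state_in t w.
  move: (loop_state t w) Xx Xv => [[x v] c] /= Xx Xv.
  have [B leB] := recapp_drift pb mu0 muL Yinit acc (step_size_gt0 ss t.+1)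
    (step_size_le ss t) (dl0 t) Xx Xv Xu umin.
  exists B => n; have := leB n; rewrite (step_size_rec ss) exprVn; exact.
- apply: le_trans E0le; rewrite le_eqVlt; apply/orP; left; apply/eqP.
  by apply: eq_integral => w _; rewrite /psi; case: ss => -> _; rewrite expr1n invr1 mul1r.
move=> adT leT; apply: le_trans leT.
have adpsi := adapted_comp (psi T) adT.
have adgap := adapted_comp (fun c : counted ('rV[R]_d * 'rV[R]_d) =>
  (alpha T)^-1 ^+ 2 * (F c.1.1 - F u)) adT.
rewrite (_ : (\int[P]_w ((alpha T)^-1 ^+ 2 * (F (loop_run T w).1 - F u))%:E =
  \int[P]_w ((alpha T)^-1 ^+ 2 * (F (loop_state T w).1.1 - F u))%:E)%E); last first.
  by apply: eq_integral => w _; rewrite loop_runE.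
apply: ge0_le_integral => //.
- move=> w _; rewrite lee_fin; apply: mulr_ge0 (sqr_ge0 _) _.
  exact: gap0 (loop_state_in T w).1.
- by apply/measurable_EFinP; exact: adapted_measurable adgap.
- by apply/measurable_EFinP; exact: adapted_measurable adpsi.
move=> w _; rewrite lee_fin /psi exprVn lerDl mulr_ge0 ?dot_ge0 //.
by rewrite divr_ge0 // ltW.
Qed.

End Run.
End Loop.

(** * Query counts *)

Section Costs.
Variables (R : realType) (d m : nat).
Variables (X : set 'rV[R]_d) (Y : set 'rV[R]_m) (DX DY L mu : R).
Variables (g : oracle R d m) (y_init : 'rV[R]_m).
Hypotheses (mu0 : 0 < mu) (muL : mu <= L) (DY0 : 0 < DY).

Let L0 : 0 < L. Proof. exact: lt_le_trans muL. Qed.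

Local Notation nagd := (agd_steps DY L mu).
Local Notation N := (prox_steps L mu).
Local Notation q := (L / 2 * DY ^+ 2).
Local Notation rk := (Num.sqrt (L / mu)).

Lemma mirror_prox_cost h M x y n : (mirror_prox X Y h M x y n).2 = (2 * n)%N.
Proof.
rewrite /mirror_prox {1}/bind (@iterM_cost _ _ _ _ 2); last by move=> _ [[[]]].
by rewrite addn0 mulnC.
Qed.

Definition prox_cost delta : nat := ((nagd delta).+1 + 2 * N)%N.

Lemma approx_prox_cost delta s xi xprev :
  (approx_prox X Y g L mu y_init nagd delta s xi xprev).2 = prox_cost delta.
Proof.
have -> : (approx_prox X Y g L mu y_init nagd delta s xi xprev).2 =
  ((agd Y g L mu (nagd delta) xprev y_init).2 +
   ((mirror_prox X Y (regularize g mu s) (L + mu) xi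
      (agd Y g L mu (nagd delta) xprev y_init).1 N).2 + 0))%N by [].
by rewrite agd_cost mirror_prox_cost addn0.
Qed.

Lemma unbiased_prox_cost delta s x j :
  (unbiased_prox X Y g L mu y_init nagd delta s x j).2 =
  (prox_cost (level_accuracy delta 0) +
   \sum_(0 <= i < j) prox_cost (level_accuracy delta i.+1))%N.
Proof.
have [_ c2] := @iterM_rcons _ 0
  (fun i y => approx_prox X Y g L mu y_init nagd (level_accuracy delta i.+1) s y y)
  (prox_level X Y L mu g y_init nagd delta s x) j (fun=> erefl).
transitivity ((approx_prox X Y g L mu y_init nagd (level_accuracy delta 0) s s x).2 +
  ((iterM j (fun i xs =>
    bind (approx_prox X Y g L mu y_init nagd (level_accuracy delta i.+1) s
      (nth 0%R xs i) (nth 0%R xs i)) (fun y => ret (rcons xs y)))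
    [:: prox_level X Y L mu g y_init nagd delta s x 0]).2 + 0))%N; first by [].
rewrite addn0 c2; congr (_ + _)%N; first exact: approx_prox_cost.
by apply: eq_bigr => i _; exact: approx_prox_cost.
Qed.

Lemma sqrt_cond_ge1 : 1 <= rk.
Proof. by rewrite -sqrtr1 ler_wsqrtr // ler_pdivlMr // mul1r. Qed.

Lemma prox_cost_le delta lam : 0 <= lam -> ln (q / delta) <= lam ->
  (prox_cost delta)%:R <= rk * lam + 2 + 2 * N%:R :> R.
Proof.
move=> lam0 le; have := @agd_steps_le _ DY L mu delta.
have : rk * Num.max 0 (ln (q / delta)) <= rk * lam.
  by rewrite ler_wpM2l ?sqrtr_ge0 // ge_max lam0.
by rewrite /prox_cost natrD natrM -natr1; lra.
Qed.

Lemma ln2_le1 : ln 2 <= 1 :> R.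
Proof. by have := @le_ln1Dx R 1; rewrite (_ : 1 + 1 = 2) //; apply. Qed.

Lemma level_cost_le delta lam i : 0 < delta -> 0 <= lam -> ln (q / delta) <= lam ->
  (prox_cost (level_accuracy delta i))%:R <= rk * (lam + 3 + 2 * i%:R) + 2 + 2 * N%:R :> R.
Proof.
move=> dl0 lam0 le; have i0 : 0 <= i%:R :> R by [].
apply: prox_cost_le; first lra.
have q0 : 0 < q by rewrite mulr_gt0 ?exprn_gt0 ?divr_gt0.
rewrite /level_accuracy invf_div mulrCA.
rewrite lnM ?posrE ?divr_gt0 ?exprn_gt0 // lnXn //.
rewrite -[ln 2 *+ _]mulr_natr natrD natrM.
have h : 0 <= 3 + 2 * i%:R :> R by lra.
by have := ler_wpM2r h ln2_le1; rewrite mul1r; lra.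
Qed.

Variables (alpha delta : nat -> R).

Local Notation step := (recapp_step X Y L mu g y_init nagd alpha delta).

Lemma recapp_step_cost t st j : (step t st j).2 =
  (prox_cost (delta t.+1) + (prox_cost (level_accuracy (delta t.+1) 0) +
   \sum_(0 <= i < j) prox_cost (level_accuracy (delta t.+1) i.+1)))%N.
Proof.
case: st => x v; pose s : 'rV[R]_d := (1 - alpha t.+1) *: x + alpha t.+1 *: v.
transitivity ((approx_prox X Y g L mu y_init nagd (delta t.+1) s s x).2 +
  ((unbiased_prox X Y g L mu y_init nagd (delta t.+1) s x j).2 + 0))%N; first by [].
rewrite addn0; congr (_ + _)%N; first exact: approx_prox_cost.
exact: unbiased_prox_cost.
Qed.

(** Bounds the cost of an approximate step if lam bounds the logarithm of its
    accuracy ratio; the additional 2 makes room for the finer levels. *)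
Definition step_charge lam : R := rk * (lam + 2) + 2 + 2 * N%:R.

Lemma step_charge_ge0 lam : 0 <= lam -> 0 <= step_charge lam.
Proof.
by move=> l0; rewrite /step_charge !addr_ge0 ?mulr_ge0 ?sqrtr_ge0 ?addr_ge0.
Qed.

(** The iteration makes j + 2 calls, and an accuracy of level i adds to the
    logarithm a term proportional to i <= j. *)
Lemma recapp_step_cost_le t st j lam : 0 < delta t.+1 -> 0 <= lam ->
  ln (q / delta t.+1) <= lam ->
  (step t st j).2%:R <= (j%:R + 2) ^+ 2 * step_charge lam.
Proof.
move=> dl0 lam0 le; rewrite recapp_step_cost natrD [X in _ + X]natrD natr_sum.
have r1 := sqrt_cond_ge1; have j0 : 0 <= j%:R :> R by [].
pose B := rk * (lam + 3 + 2 * j%:R) + 2 + 2 * N%:R.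
have r0 : 0 <= rk by lra.
have N0 : 0 <= N%:R :> R by [].
have BZ : B <= (j%:R + 2) * step_charge lam.
  have : rk * (lam + 3 + 2 * j%:R) <= rk * ((j%:R + 2) * (lam + 2)).
    by apply: ler_wpM2l => //; have := mulr_ge0 j0 lam0; lra.
  by rewrite /B /step_charge; have := mulr_ge0 j0 N0; lra.
have c1 : (prox_cost (delta t.+1))%:R <= B.
  apply: le_trans (prox_cost_le lam0 le) _; rewrite /B.
  have : rk * lam <= rk * (lam + 3 + 2 * j%:R) by apply: ler_wpM2l => //; lra.
  lra.
have c2 i : (i <= j)%N -> (prox_cost (level_accuracy (delta t.+1) i))%:R <= B.
  move=> ij; apply: le_trans (level_cost_le i dl0 lam0 le) _; rewrite /B.
  have ijR : i%:R <= j%:R :> R by rewrite ler_nat.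
  have : rk * (lam + 3 + 2 * i%:R) <= rk * (lam + 3 + 2 * j%:R).
    by apply: ler_wpM2l => //; lra.
  lra.
have c3 : \sum_(0 <= i < j) (prox_cost (level_accuracy (delta t.+1) i.+1))%:R <= j%:R * B.
  apply: (@le_trans _ _ (\sum_(0 <= i < j) B)).
    by apply: ler_sum_nat => i /andP[_ ij]; exact: c2.
  by rewrite sumr_const_nat subn0 mulr_natl.
have := c2 0%N (leq0n j); have j2 : 0 <= j%:R + 2 :> R by lra.
have h := ler_wpM2l j2 BZ; rewrite expr2 -mulrA => c0; apply: le_trans h.
by move: (\sum_(0 <= i < j) _) (B) c0 c1 c3 => S B' c0 c1 c3; lra.
Qed.

(** The quadratic cost of a level against its geometric probability. *)
Lemma sum_level_squares n :
  \sum_(2 <= j < n.+2) (j%:R + 2) ^+ 2 / 2 ^+ j.-1 =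
  27 - ((n%:R + 4) ^+ 2 + 2 * (n%:R + 4) + 3) / 2 ^+ n :> R.
Proof.
elim: n => [|n IH]; first by rewrite big_geq // expr0; field.
rewrite big_nat_recr //= IH -[n.+2%:R]natr1 -[n.+1%:R]natr1 ![2 ^+ n.+1]exprS; field.
by rewrite expf_neq0.
Qed.

Lemma recapp_step_expected_cost t st n lam : 0 < delta t.+1 -> 0 <= lam ->
  ln (q / delta t.+1) <= lam ->
  \sum_(2 <= j < n) (step t st j).2%:R / 2 ^+ j.-1 <= 27 * step_charge lam.
Proof.
move=> dl0 lam0 le; have Z0 := step_charge_ge0 lam0.
case: n => [|[|n]]; try by rewrite big_geq // mulr_ge0.
apply: (@le_trans _ _ (\sum_(2 <= j < n.+2)
    (j%:R + 2) ^+ 2 / 2 ^+ j.-1 * step_charge lam)).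
  apply: ler_sum => j _; rewrite mulrAC ler_pM2r ?invr_gt0 ?exprn_gt0 //.
  exact: recapp_step_cost_le.
rewrite -mulr_suml sum_level_squares ler_wpM2r // gerBl divr_ge0 ?exprn_ge0 //.
Qed.

Lemma warm_start_cost x0 W : 0 < DX ->
  ((warm_start X Y g L mu DX x0 y_init nagd W N).2%:R <=
   2 * (rk * logO (DY / DX)) + 2 + 2 * (W%:R * N%:R) :> R).
Proof.
move=> DX0.
have -> : (warm_start X Y g L mu DX x0 y_init nagd W N).2 =
  ((agd Y g L mu (nagd (L * DX ^+ 2 / 2)) x0 y_init).2 +
  ((iterM W (fun _ (z : 'rV[R]_d * 'rV[R]_m) =>
      mirror_prox X Y (regularize g mu x0) (L + mu) z.1 z.2 N)
    (x0, (agd Y g L mu (nagd (L * DX ^+ 2 / 2)) x0 y_init).1)).2 + 0))%N by [].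
rewrite agd_cost (@iterM_cost _ _ _ _ (2 * N)) ?addn0; last first.
  by move=> i z; rewrite mirror_prox_cost.
have := @agd_steps_le _ DY L mu (L * DX ^+ 2 / 2).
have -> : q / (L * DX ^+ 2 / 2) = (DY / DX) ^+ 2.
  by field; rewrite !gt_eqF.
rewrite lnXn ?divr_gt0 //.
have : 0 <= logO (DY / DX) by rewrite /logO le_max ler01.
have : ln (DY / DX) <= logO (DY / DX) by rewrite /logO le_max lexx orbT.
move: (ln _) (logO _) => l1 l2 h1 h2.
have : rk * Num.max 0 (l1 *+ 2) <= rk * (2 * l2).
  rewrite ler_wpM2l ?sqrtr_ge0 // ge_max mulr_ge0 //= -mulr_natl; lra.
by rewrite !natrD !natrM -natr1; lra.
Qed.

End Costs.

(** * Logarithms and accuracies *)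

Section Numerics.
Variable R : realType.

Lemma logO_ge1 (z : R) : 1 <= logO z.
Proof. by rewrite /logO le_max lexx. Qed.

Lemma ln_le_logO (z : R) : ln z <= logO z.
Proof. by rewrite /logO le_max lexx orbT. Qed.

Lemma ln_le_nat (c : R) k : 0 < c -> c <= 2 ^+ k -> ln c <= k%:R.
Proof.
move=> c0 ck; rewrite -ler_expR lnK ?posrE //; apply: le_trans ck _.
rewrite -[k%:R]mulr1 expRM_natl lerXn2r ?nnegrE ?expR_ge0 //.
by have := expR_ge1Dx (1 : R); lra.
Qed.

Lemma log_accuracy_le (q delta c y : R) k : 0 < q -> 0 < delta -> 0 < c -> 0 < y ->
  c <= 2 ^+ k -> q <= delta * (c * y ^+ 2) -> ln (q / delta) <= k%:R + 2 * logO y.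
Proof.
move=> q0 d0 c0 y0 ck le.
have : ln (q / delta) <= ln (c * y ^+ 2).
  by rewrite ler_ln ?posrE ?divr_gt0 ?mulr_gt0 ?exprn_gt0 // ler_pdivrMr // mulrC.
rewrite [ln (c * _)]lnM ?posrE ?exprn_gt0 // lnXn // -[ln y *+ 2]mulr_natl.
by have := ln_le_nat c0 ck; have := ln_le_logO y; lra.
Qed.

(** An integer above the binary logarithm of z: the factor 2 is enough because
    expR (1 / 2) <= 2. *)
Definition halvings (z : R) := ceil_nat (2 * Num.max 0 (ln z)).

Lemma halvings_ge z : 0 < z -> z <= 2 ^+ halvings z.
Proof.
move=> z0; have m0 : 0 <= Num.max 0 (ln z) by rewrite le_max lexx.
have le : 2 * Num.max 0 (ln z) <= (halvings z)%:R by apply: ceil_nat_ge; rewrite mulr_ge0.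
apply: (@le_trans _ _ (expR ((halvings z)%:R * 2^-1))).
  rewrite -[leLHS](lnK z0) ler_expR.
  have h : ln z <= Num.max 0 (ln z) by rewrite le_max lexx orbT.
  lra.
by rewrite expRM_natl lerXn2r ?nnegrE ?expR_ge0 // expR_half_le2.
Qed.

Lemma halvings_le z : (halvings z)%:R <= 2 * Num.max 0 (ln z) + 1.
Proof. by apply: ceil_nat_le; rewrite mulr_ge0 // le_max lexx. Qed.

(** The bound is not wasteful, so that the accuracy of the last epoch is
    polynomial in z. *)
Lemma pow_halvings_le z : 0 < z -> (0 < halvings z)%N -> 2 ^+ halvings z <= 4 * z ^+ 2.
Proof.
move=> z0 h0; have lz : 0 < ln z.
  rewrite ltNge; apply/negP => le; move: h0.
  by rewrite /halvings (max_idPl le) mulr0 /ceil_nat ceil0.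
have := halvings_le z; rewrite (max_idPr (ltW lz)) => le.
have e2 : 2 ^+ halvings z <= expR (halvings z)%:R :> R.
  rewrite -[(halvings z)%:R]mulr1 expRM_natl lerXn2r ?nnegrE ?expR_ge0 //.
  by have := expR_ge1Dx (1 : R); lra.
apply: le_trans e2 _; apply: (@le_trans _ _ (expR (2 * ln z + 1))).
  by rewrite ler_expR.
rewrite expRD expRM_natl lnK // mulrC ler_pM2r ?exprn_gt0 //.
exact: expR1_le4.
Qed.

End Numerics.

Section Errors.
Variables (R : realType) (alpha delta : nat -> R) (w K0 : R).
Hypotheses (ss : step_sizes alpha) (w0 : 0 < w) (K00 : 0 < K0).
Hypothesis deltaE : forall t, delta t = w * ((4 * t%:R ^+ 2)^-1 * alpha t ^+ 2 * K0).

Lemma scheduled_accuracy_gt0 t : 0 < delta t.+1.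
Proof.
have a0 := step_size_gt0 ss t.+1; have t0 : 0 < t.+1%:R :> R by rewrite ltr0n.
by rewrite deltaE !mulr_gt0 // ?exprn_gt0 // invr_gt0 mulr_gt0 // exprn_gt0.
Qed.

(** The step sizes cancel and the sum of the inverse squares remains. *)
Lemma sum_scheduled_accuracy T :
  \sum_(0 <= t < T) 6 * delta t.+1 * (alpha t.+1)^-1 ^+ 2 <= 3 * w * K0.
Proof.
rewrite (eq_bigr (fun t => 3 / 2 * w * K0 * (t.+1%:R ^+ 2)^-1)); last first.
  move=> t _; have a0 := step_size_gt0 ss t.+1.
  have t0 : 0 < t.+1%:R :> R by rewrite ltr0n.
  rewrite deltaE; move: (t.+1%:R) t0 (alpha t.+1) a0 => x x0 a a0.
  by field; rewrite !gt_eqF.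
have c0 : 0 <= 3 / 2 * w * K0 by rewrite !mulr_ge0 // ltW.
rewrite -mulr_sumr; have := ler_wpM2l c0 (sum_inv_squares R T).
by move: (\sum_(0 <= t < T) _) => S; lra.
Qed.

(** The accuracies decrease polynomially only, as alpha t.+1 >= 1 / (2 t.+1); the
    logarithms that they cost are therefore harmless. *)
Lemma scheduled_accuracy_ge t T : (t < T)%N ->
  w * K0 <= 16 * T%:R ^+ 4 * delta t.+1.
Proof.
move=> tT; rewrite deltaE; have a0 := step_size_gt0 ss t.+1.
have := inv_step_size_le ss t.+1.
have t0 : 0 < t.+1%:R :> R by rewrite ltr0n.
have t1 : 1 <= t.+1%:R :> R by rewrite ler1n.
have tTR : t.+1%:R <= T%:R :> R by rewrite ler_nat.
move: (t.+1%:R) (T%:R) (alpha t.+1) t0 t1 tTR a0 => x y a x0 x1 xy a0 ia.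
have ax : 1 <= a * (2 * x).
  have := ler_wpM2l (ltW a0) ia; rewrite mulfV ?gt_eqF // => h.
  by apply: le_trans h _; rewrite ler_pM2l //; lra.
have y0 : 0 < y by lra.
have ax2 : 1 <= (a * (2 * x)) ^+ 2 by exact: exprn_ege1.
have xy4 : x ^+ 4 <= y ^+ 4 by rewrite lerXn2r ?nnegrE // ltW.
have -> : 16 * y ^+ 4 * (w * ((4 * x ^+ 2)^-1 * a ^+ 2 * K0)) =
    w * K0 * ((y ^+ 4 / x ^+ 4) * (a * (2 * x)) ^+ 2).
  by field; rewrite gt_eqF.
rewrite -[leLHS]mulr1 ler_pM2l ?mulr_gt0 //.
have r1 : 1 <= y ^+ 4 / x ^+ 4 by rewrite ler_pdivlMr ?exprn_gt0 // mul1r.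
by apply: le_trans ax2 _; rewrite -[leLHS]mul1r ler_wpM2r ?sqr_ge0.
Qed.

End Errors.

(** * The two methods *)

Section AdaptedIntegrals.
Context {dO : measure_display} {Omega : measurableType dO} {R : realType}.
Variables (P : probability Omega R) (J : nat -> {RV P >-> nat}).

Lemma adapted_integral_scale t (G : Omega -> R) c B :
  adapted J t G -> (forall w, 0 <= G w) -> 0 <= c ->
  (\int[P]_w (G w)%:E <= B%:E)%E -> (\int[P]_w (c * G w)%:E <= (c * B)%:E)%E.
Proof.
move=> adG G0 c0 le.
have mG : measurable_fun setT (EFin \o G).
  by apply/measurable_EFinP; exact: adapted_measurable adG.
under eq_integral do rewrite EFinM.
rewrite ge0_integralZl_EFin //; last by move=> w _; rewrite lee_fin.
by rewrite EFinM lee_wpmul2l // lee_fin.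
Qed.

Lemma adapted_integral_unscale t (G : Omega -> R) c B :
  adapted J t G -> (forall w, 0 <= G w) -> 0 < c ->
  (\int[P]_w (c * G w)%:E <= (c * B)%:E)%E -> (\int[P]_w (G w)%:E <= B%:E)%E.
Proof.
move=> adG G0 c0 le.
have := @adapted_integral_scale t (fun w => c * G w) c^-1 (c * B)
  (adapted_comp (fun x => c * x) adG) (fun w => mulr_ge0 (ltW c0) (G0 w)) _ le.
rewrite invr_ge0 mulKf ?gt_eqF // => /(_ (ltW c0)).
by under eq_integral do rewrite mulKf ?gt_eqF //.
Qed.

(** A nonnegative gap with a finite integral makes G integrable, so that the
    constant a can be split off. *)
Lemma expectation_gap t (G : Omega -> R) a B :
  adapted J t G -> (forall w, a <= G w) ->
  (\int[P]_w (G w - a)%:E <= B%:E)%E -> ('E_P[G] - a%:E <= B%:E)%E.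
Proof.
move=> adG aG le.
have adGa := adapted_comp (fun x => x - a) adG.
have mGa : measurable_fun setT (fun w => G w - a) by exact: adapted_measurable adGa.
have Ga0 w : 0 <= G w - a by rewrite subr_ge0.
have intGa : P.-integrable setT (fun w => (G w - a)%:E).
  apply/integrableP; split; first exact/measurable_EFinP.
  apply: le_lt_trans _ (ltry B).
  apply: le_trans le; rewrite le_eqVlt; apply/orP; left; apply/eqP.
  by apply: eq_integral => w _; rewrite gee0_abs // lee_fin.
have inta : P.-integrable setT (cst a%:E) by exact: finite_measure_integrable_cst.
rewrite unlock.
have -> : (\int[P]_w (G w)%:E = \int[P]_w ((G w - a)%:E + a%:E))%E.
  by apply: eq_integral => w _; rewrite -EFinD subrK.
rewrite integralD // (integral_cst P measurableT a%:E).
rewrite [X in (_ * X)%E](@probability_setT _ _ _ P) mule1 addeK //.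
Qed.

End AdaptedIntegrals.

Section Methods.
Variables (R : realType) (d m : nat).
Variables (X : set 'rV[R]_d) (Y : set 'rV[R]_m) (DX DY L mu eps : R).
Variables (f : 'rV[R]_d -> 'rV[R]_m -> R) (g : oracle R d m).
Hypotheses (pb : minimax_problem X Y DX DY L mu f g).
Hypotheses (DX0 : 0 < DX) (DY0 : 0 < DY) (mu0 : 0 < mu) (muL : mu <= L).
Variables (x_init : 'rV[R]_d) (y_init : 'rV[R]_m) (alpha : nat -> R).
Hypotheses (Xinit : X x_init) (Yinit : Y y_init) (ss : step_sizes alpha).
Context {dO : measure_display} {Omega : measurableType dO}.
Variables (P : probability Omega R) (J : nat -> {RV P >-> nat}).
Hypothesis HJ : level_samples J.

Local Notation F := (maxF Y f).
Local Notation nagd := (agd_steps DY L mu).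
Local Notation N := (prox_steps L mu).
Local Notation W := (warm_steps L mu).
Local Notation rk := (Num.sqrt (L / mu)).

Let acc : agd_accurate X Y f g L mu nagd.
Proof. exact: agd_steps_accurate pb mu0 muL DY0. Qed.

Let L0 : 0 < L. Proof. exact: lt_le_trans muL. Qed.

Local Notation warm := (warm_start X Y g L mu DX x_init y_init nagd W N).

Definition warm_charge : R := 2 * (rk * logO (DY / DX)) + 2 + 2 * (W%:R * N%:R).

Lemma integral_const (c : R) : (\int[P]_w c%:E = c%:E)%E.
Proof.
by rewrite (integral_cst P measurableT c%:E) [X in (_ * X)%E](@probability_setT _ _ _ P) mule1.
Qed.

(** ** Without restarts *)

Definition schedule t := (4 * t%:R ^+ 2)^-1 * alpha t ^+ 2 * mu * DX ^+ 2.

Lemma scheduleE t :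
  schedule t = 1 * ((4 * t%:R ^+ 2)^-1 * alpha t ^+ 2 * (mu * DX ^+ 2)).
Proof. by rewrite /schedule mul1r !mulrA. Qed.

Let K0_gt0 : 0 < mu * DX ^+ 2.
Proof. by rewrite mulr_gt0 // exprn_gt0. Qed.

Let run T w := recapp X Y g L mu DX x_init y_init nagd W N alpha T (fun i => J i w).

Let warm_in : X warm.1.
Proof. exact: (warm_start_gap pb mu0 muL DX0 Xinit Yinit acc).1. Qed.

Let warm_gap z : X z -> F warm.1 - F z <= 3 / 2 * mu * DX ^+ 2.
Proof. exact: (warm_start_gap pb mu0 muL DX0 Xinit Yinit acc).2. Qed.

Lemma recapp_in T w : X (run T w).1.
Proof.
have -> : (run T w).1 = (recapp_loop X Y g L mu y_init nagd alpha schedule T warm.1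
  (fun i => J i w)).1 by [].
exact: (recapp_loop_in pb mu0 muL Yinit acc schedule ss).
Qed.

(** The constant 5 consists of 2 for the initial potential and 3 for the
    accumulated accuracies, in units of mu DX^2. *)
Lemma recapp_gap T : 5 * (mu * DX ^+ 2) <= (alpha T)^-1 ^+ 2 * eps ->
  ('E_P[fun w => F (run T w).1] - (minF X Y f)%:E <= eps%:E)%E.
Proof.
move=> hT; have [u Xu [_ [-> umin]]] := minF_attained pb mu0 muL.
have dl0 t : 0 < schedule t.+1.
  exact: (scheduled_accuracy_gt0 ss ltr01 K0_gt0 scheduleE).
have E0 : (\int[P]_w (F warm.1 - F u + mu / 2 *
    dot (warm.1 - u) (warm.1 - u))%:E <= (2 * (mu * DX ^+ 2))%:E)%E.
  rewrite integral_const lee_fin; have := warm_gap Xu.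
  have := ler_wpM2l (ltW mu0) (primal_dist pb warm_in Xu); lra.
have le := loop_run_gap pb mu0 muL Yinit acc ss dl0 HJ (adapted_cst J 0 warm)
  (fun=> warm_in) T Xu umin E0.
have ad := loop_run_adapted X Y L mu g y_init nagd alpha schedule (adapted_cst J 0 warm) T.
have adF := adapted_comp (fun c : counted 'rV[R]_d => F c.1) ad.
have adG := adapted_comp (fun c : counted 'rV[R]_d => F c.1 - F u) ad.
have gap0 w : F u <= F (run T w).1 by apply: umin; exact: recapp_in.
apply: (expectation_gap adF) => //.
apply: (adapted_integral_unscale adG) (_ : 0 < (alpha T)^-1 ^+ 2) _.
- by move=> w; rewrite subr_ge0; exact: gap0.
- by rewrite exprn_gt0 // inv_step_size_gt0.
apply: le_trans le _; rewrite lee_fin; apply: le_trans hT.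
have := sum_scheduled_accuracy ss ltr01 K0_gt0 scheduleE T.
by move: (\sum_(0 <= t < T) _) => S; lra.
Qed.

Lemma recapp_cost T lam : 0 <= lam ->
  (forall t, (t < T)%N -> ln (L / 2 * DY ^+ 2 / schedule t.+1) <= lam) ->
  ('E_P[fun w => (run T w).2%:R] <=
    (warm_charge + T%:R * (27 * step_charge L mu lam))%:E)%E.
Proof.
move=> lam0 le; rewrite unlock.
have dl0 t : 0 < schedule t.+1.
  exact: (scheduled_accuracy_gt0 ss ltr01 K0_gt0 scheduleE).
apply: (loop_run_cost HJ (adapted_cst J 0 warm)).
- by rewrite mulr_ge0 // step_charge_ge0.
- move=> t st n tT; exact: recapp_step_expected_cost (dl0 t) lam0 (le t tT).
by rewrite integral_const lee_fin; exact: warm_start_cost.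
Qed.

(** ** With restarts *)

Definition epoch_schedule k t :=
  (2 ^+ k.+1)^-1 * (4 * t%:R ^+ 2)^-1 * alpha t ^+ 2 * mu * DX ^+ 2.

Lemma epoch_scheduleE k t : epoch_schedule k t =
  (2 ^+ k.+1)^-1 * ((4 * t%:R ^+ 2)^-1 * alpha t ^+ 2 * (mu * DX ^+ 2)).
Proof. by rewrite /epoch_schedule !mulrA. Qed.

Let w_gt0 k : 0 < (2 ^+ k.+1)^-1 :> R.
Proof. by rewrite invr_gt0 exprn_gt0. Qed.

Lemma epoch_schedule_gt0 k t : 0 < epoch_schedule k t.+1.
Proof. exact: (scheduled_accuracy_gt0 ss (w_gt0 k) K0_gt0 (epoch_scheduleE k)). Qed.

Let restarted T k w := restarted_recapp X Y g L mu DX x_init y_init nagd W N alpha T k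
  (fun i => J i w).

Lemma restartedS T k w : restarted T k.+1 w =
  loop_run X Y L mu g y_init nagd alpha (epoch_schedule k) J (k * T) (restarted T k) T w.
Proof.
pose step := fun k x => recapp_loop X Y g L mu y_init nagd alpha (epoch_schedule k) T x
  (fun t => J (k * T + t)%N w).
have assoc : bind warm (iterM k.+1 step) = bind (bind warm (iterM k step)) (step k).
  by rewrite /bind /= addnA.
exact: assoc.
Qed.

Lemma restarted_in T k w : X (restarted T k w).1.
Proof.
elim: k => [|k IH]; first exact: warm_in.
rewrite restartedS.
exact: (recapp_loop_in pb mu0 muL Yinit acc (epoch_schedule k) ss).
Qed.

Lemma restarted_adapted T k : adapted J (k * T) (restarted T k).
Proof.
elim: k => [|k IH]; first exact: (adapted_cst J 0 (bind warm (fun x => ret x))).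
have -> : restarted T k.+1 = loop_run X Y L mu g y_init nagd alpha (epoch_schedule k) J
  (k * T) (restarted T k) T by apply/funext => w; exact: restartedS.
rewrite mulSnr.
exact: (loop_run_adapted X Y L mu g y_init nagd alpha (epoch_schedule k) IH T).
Qed.

Section StronglyConvex.
Variable gamma : R.
Hypotheses (gamma0 : 0 < gamma) (gammamu : gamma <= mu).
Hypothesis Fsc : strongly_convex X F (gradF Y f g) gamma.

(** An epoch halves the bound. By strong convexity the initial potential is at
    most 2 mu / gamma times the gap, and the epoch divides it by 8 mu / gamma;
    what is left to reach 1 / 2 covers the accuracies of the epoch. *)
Lemma restarted_gap_bound T (u : 'rV[R]_d) : 8 * mu / gamma <= (alpha T)^-1 ^+ 2 ->
  X u -> (forall z, X z -> 0 <= dot (gradF Y f g u) (z - u)) ->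
  (forall z, X z -> F u <= F z) ->
  forall k,
  (\int[P]_w (F (restarted T k w).1 - F u)%:E <= (3 / 2 * (mu * DX ^+ 2) / 2 ^+ k)%:E)%E.
Proof.
move=> hT Xu opt umin; elim=> [|k IH].
  have -> : (\int[P]_w (F (restarted T 0 w).1 - F u)%:E =
    \int[P]_w (F warm.1 - F u)%:E)%E by [].
  by rewrite integral_const lee_fin expr0 divr1; have := warm_gap Xu; lra.
have gap0 i w : 0 <= F (restarted T i w).1 - F u.
  by rewrite subr_ge0; apply: umin; exact: restarted_in.
have mg0 : 0 <= 2 * mu / gamma by rewrite divr_ge0 ?mulr_ge0 // ltW.
have adG := adapted_comp (fun c : counted 'rV[R]_d => F c.1 - F u) (restarted_adapted T k).
have adPhi := adapted_comp (fun c : counted 'rV[R]_d =>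
  F c.1 - F u + mu / 2 * dot (c.1 - u) (c.1 - u)) (restarted_adapted T k).
set e := 3 / 2 * (mu * DX ^+ 2) / 2 ^+ k in IH.
have start : (\int[P]_w (F (restarted T k w).1 - F u + mu / 2 *
    dot ((restarted T k w).1 - u) ((restarted T k w).1 - u))%:E <=
    (2 * mu / gamma * e)%:E)%E.
  apply: le_trans (adapted_integral_scale adG (gap0 k) mg0 IH).
  apply: ge0_le_integral => //.
  - move=> w _; rewrite lee_fin addr_ge0 // mulr_ge0 ?dot_ge0 //.
    by rewrite divr_ge0 // ltW.
  - by apply/measurable_EFinP; exact: adapted_measurable adPhi.
  - apply/measurable_EFinP.
    exact: adapted_measurable (adapted_comp (fun x => 2 * mu / gamma * x) adG).
  move=> w _; rewrite lee_fin; have Xr := restarted_in T k w; have := gap0 k w.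
  have := Fsc Xu Xr; have := opt _ Xr; rewrite sqr_enorm.
  move: (restarted T k w) Xr => [x c] /= Xx.
  move: (dot (gradF _ _ _ _) _) (dot (x - u) (x - u)) (F x) (F u) => o D Fx Fu o0 sc h3.
  have h : gamma / 2 * D <= Fx - Fu by lra.
  have h1 : mu / 2 * D <= mu / gamma * (Fx - Fu).
    have -> : mu / 2 * D = mu / gamma * (gamma / 2 * D) by field; rewrite gt_eqF.
    by rewrite ler_wpM2l // divr_ge0 // ltW.
  have h2 : 1 <= mu / gamma by rewrite ler_pdivlMr // mul1r.
  have := ler_wpM2r h3 h2; lra.
have le := loop_run_gap pb mu0 muL Yinit acc ss (epoch_schedule_gt0 k) HJ
  (restarted_adapted T k) (restarted_in T k) T Xu umin start.
have adGS := adapted_comp (fun c : counted 'rV[R]_d => F c.1 - F u)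
  (restarted_adapted T k.+1).
apply: (adapted_integral_unscale adGS (gap0 k.+1)) (_ : 0 < (alpha T)^-1 ^+ 2) _.
  by rewrite exprn_gt0 // inv_step_size_gt0.
under eq_integral do rewrite restartedS.
apply: le_trans le _; rewrite lee_fin.
have := sum_scheduled_accuracy ss (w_gt0 k) K0_gt0 (epoch_scheduleE k) T.
have r1 : 1 <= mu / gamma by rewrite ler_pdivlMr // mul1r.
have q0 : 0 < (2 ^+ k)^-1 * (mu * DX ^+ 2) by rewrite mulr_gt0 // invr_gt0 exprn_gt0.
have := ler_wpM2r (ltW q0) hT; have := ler_wpM2r (ltW q0) r1.
rewrite /e ![2 ^+ k.+1]exprS invfM.
move: (\sum_(0 <= t < T) _) ((2 ^+ k)^-1) (mu * DX ^+ 2) ((alpha T)^-1 ^+ 2) q0.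
move=> S q K0 a q0.
have -> : 8 * mu / gamma = 8 * (mu / gamma) by rewrite mulrA.
have -> : 2 * mu / gamma = 2 * (mu / gamma) by rewrite mulrA.
move: (mu / gamma) => r; lra.
Qed.

Lemma restarted_gap T k : 8 * mu / gamma <= (alpha T)^-1 ^+ 2 ->
  3 / 2 * (mu * DX ^+ 2) / 2 ^+ k <= eps ->
  ('E_P[fun w => F (restarted T k w).1] - (minF X Y f)%:E <= eps%:E)%E.
Proof.
move=> hT hk; have [u Xu [opt [-> umin]]] := minF_attained pb mu0 muL.
have le := restarted_gap_bound hT Xu opt umin k.
have adF := adapted_comp (fun c : counted 'rV[R]_d => F c.1) (restarted_adapted T k).
apply: (expectation_gap adF) => [w|]; first by apply: umin; exact: restarted_in.
by apply: le_trans le _; rewrite lee_fin.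
Qed.

End StronglyConvex.

Lemma restarted_cost T K lam : 0 <= lam ->
  (forall k t, (k < K)%N -> (t < T)%N ->
    ln (L / 2 * DY ^+ 2 / epoch_schedule k t.+1) <= lam) ->
  ('E_P[fun w => (restarted T K w).2%:R] <=
    (warm_charge + K%:R * (T%:R * (27 * step_charge L mu lam)))%:E)%E.
Proof.
move=> lam0 le; rewrite unlock; set Z := T%:R * _.
have : (K <= K)%N by [].
elim: {-2}K => [_|k IH kK].
  rewrite mul0r addr0.
  have -> : (\int[P]_w ((restarted T 0 w).2%:R)%:E =
    \int[P]_w ((warm.2 + 0)%N%:R)%:E)%E by [].
  by rewrite addn0 integral_const lee_fin; exact: warm_start_cost.
rewrite -natr1 mulrDl mul1r addrA.
under eq_integral do rewrite restartedS.
apply: (loop_run_cost HJ (restarted_adapted T k)).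
- by rewrite mulr_ge0 // step_charge_ge0.
- move=> t st n tT.
  exact: recapp_step_expected_cost (epoch_schedule_gt0 k t) lam0 (le k t kK tT).
exact: IH (ltnW kK).
Qed.
End Methods.

(** * Choice of the parameters *)

Section ParameterChoice.
Variables (R : realType) (DX DY L mu eps : R).
Hypotheses (DX0 : 0 < DX) (DY0 : 0 < DY) (mu0 : 0 < mu) (muL : mu <= L) (eps0 : 0 < eps).

Let L0 : 0 < L. Proof. exact: lt_le_trans muL. Qed.

Local Notation N := (prox_steps L mu).
Local Notation W := (warm_steps L mu).
Local Notation rk := (Num.sqrt (L / mu)).

Let S4_ge : DX ^+ 2 * DY ^+ 2 <= ((DX + DY) ^+ 2) ^+ 2.
Proof.
have h1 : DX ^+ 2 <= (DX + DY) ^+ 2.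
  by rewrite lerXn2r ?nnegrE ?addr_ge0 ?lerDl // ltW.
have h2 : DY ^+ 2 <= (DX + DY) ^+ 2.
  by rewrite lerXn2r ?nnegrE ?addr_ge0 ?lerDr // ltW.
by rewrite [leRHS]expr2 ler_pM ?exprn_ge0 // ltW.
Qed.

Let rho_ge1 : 1 <= L / mu.
Proof. by rewrite ler_pdivlMr // mul1r. Qed.

(** 22 suits both bounds of the logarithm, 13 + 2 lo and 18 + 2 lo, as lo >= 1. *)
Lemma step_charge_le lam lo : 1 <= lo -> lam + 2 <= 22 * lo ->
  step_charge L mu lam <= 22 * (rk * lo) + 260 * (L / mu).
Proof.
move=> lo1 hl; rewrite /step_charge; have := prox_steps_le mu0 muL.
have := ler_wpM2l (sqrtr_ge0 (L / mu)) hl; have := rho_ge1.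
by move: (L / mu) rk => r k; lra.
Qed.

Lemma warm_charge_le : warm_charge DX DY L mu <=
  1034 * (L / mu * logO (L / mu)) + 2 * (rk * logO (DY / DX)).
Proof.
rewrite /warm_charge; have := prox_steps_le mu0 muL; have := warm_steps_le mu0 muL.
have := logO_ge1 (L / mu); have := rho_ge1.
move: (L / mu) (logO (L / mu)) (rk * _) => r l c r1 l1 hW hN.
have N0 : 0 <= N%:R :> R by [].
have W0 : 0 <= W%:R :> R by [].
have : W%:R * N%:R <= 4 * l * (129 * r) by apply: ler_pM.
have : 1 <= r * l by rewrite mulr_ege1.
lra.
Qed.

(** ** Without restarts *)

Let tau : R := 5 * DX * Num.sqrt (mu / eps).

(** Rounded down, so as to be of order tau even if tau < 1; there are then no
    iterations, and the warm start alone is accurate enough. *)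
Definition num_iter := Num.truncn tau.

Let tau_ge0 : 0 <= tau.
Proof. by rewrite !mulr_ge0 ?sqrtr_ge0 // ltW. Qed.

Let tau_sq : tau ^+ 2 * eps = 25 * (mu * DX ^+ 2).
Proof.
rewrite /tau !exprMn sqr_sqrtr ?divr_ge0 ?(ltW mu0) ?(ltW eps0) //.
by field; rewrite gt_eqF.
Qed.

Lemma num_iter_le : num_iter%:R <= tau.
Proof. by have /andP[] := truncn_itv tau_ge0. Qed.

Lemma num_iter_enough alpha : step_sizes alpha ->
  5 * (mu * DX ^+ 2) <= (alpha num_iter)^-1 ^+ 2 * eps.
Proof.
move=> ss; have := inv_step_size_ge ss num_iter.
have /andP[_] := truncn_itv tau_ge0; rewrite -/num_iter -natr1.
have T0 : 0 <= num_iter%:R :> R by [].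
move: ((alpha _)^-1) (num_iter%:R) T0 => a t t0 h1 h2.
have h3 : tau / 2 <= a by lra.
have h4 : (tau / 2) ^+ 2 <= a ^+ 2.
  by rewrite lerXn2r ?nnegrE ?divr_ge0 //; have := tau_ge0; lra.
have := ler_wpM2r (ltW eps0) h4; rewrite expr_div_n mulrAC tau_sq.
have := mulr_gt0 mu0 (exprn_gt0 2 DX0); lra.
Qed.

Lemma num_iter_log alpha t : step_sizes alpha -> (t < num_iter)%N ->
  ln (L / 2 * DY ^+ 2 / schedule DX mu alpha t.+1) <=
  13 + 2 * logO (L * (DX + DY) ^+ 2 / eps).
Proof.
move=> ss tT; have K0 : 0 < mu * DX ^+ 2 by rewrite mulr_gt0 // exprn_gt0.
have dl0 : 0 < schedule DX mu alpha t.+1.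
  exact: (scheduled_accuracy_gt0 ss ltr01 K0 (scheduleE DX mu alpha)).
have := scheduled_accuracy_ge ss ltr01 K0 (scheduleE DX mu alpha) tT.
rewrite mul1r; move: (schedule _ _ _ _) dl0 => dl dl0 hge.
have S0 : 0 < DX + DY by rewrite addr_gt0.
(* 50 * 100 = 16 * 25 ^ 2 / 2: the fourth power of num_iter contributes 25 ^ 2,
   and [scheduled_accuracy_ge] the factor 16. *)
apply: (@log_accuracy_le _ _ _ (50 * 100) _ 13).
- by rewrite mulr_gt0 ?exprn_gt0 ?divr_gt0.
- exact: dl0.
- lra.
- by rewrite divr_gt0 ?mulr_gt0 ?exprn_gt0.
- have -> : 2 ^+ 13 = 64 * 128 :> R by ring.
  lra.
have T2 : num_iter%:R ^+ 2 * eps <= 25 * (mu * DX ^+ 2).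
  by rewrite -tau_sq ler_pM2r // lerXn2r ?nnegrE ?num_iter_le.
have T20 : 0 <= num_iter%:R ^+ 2 * eps by rewrite mulr_ge0 ?exprn_ge0 // ltW.
have T4 : (num_iter%:R ^+ 2 * eps) ^+ 2 <= (25 * (mu * DX ^+ 2)) ^+ 2.
  by rewrite lerXn2r ?nnegrE // ltW // mulr_gt0.
have e2 : eps ^+ 2 <= 100 * 100 * (mu * DX ^+ 2) * dl.
  rewrite -(ler_pM2l K0); have := ler_wpM2r (sqr_ge0 eps) hge.
  by have := ler_wpM2r (ltW dl0) T4; rewrite !exprMn; lra.
have -> : dl * ((50 * 100) * (L * (DX + DY) ^+ 2 / eps) ^+ 2) =
    (50 * 100) * dl * (L ^+ 2 * ((DX + DY) ^+ 2) ^+ 2) / eps ^+ 2.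
  by field; rewrite gt_eqF.
rewrite ler_pdivlMr ?exprn_gt0 //.
have q0 : 0 <= L / 2 * DY ^+ 2 by rewrite mulr_ge0 ?exprn_ge0 ?divr_ge0 // ltW.
apply: le_trans (ler_wpM2l q0 e2) _.
have -> : L / 2 * DY ^+ 2 * (100 * 100 * (mu * DX ^+ 2) * dl) =
  (50 * 100) * dl * (L * mu * (DX ^+ 2 * DY ^+ 2)) by field.
have c0 : 0 < (50 * 100) * dl by lra.
rewrite (ler_pM2l c0); apply: ler_pM S4_ge.
- by rewrite mulr_ge0 // ltW.
- by rewrite mulr_ge0 ?exprn_ge0 // ltW.
by rewrite expr2 ler_pM2l.
Qed.

Lemma recapp_charge_le lam (lo := logO (L * (DX + DY) ^+ 2 / eps)) :
  lam = 13 + 2 * lo ->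
  warm_charge DX DY L mu + num_iter%:R * (27 * step_charge L mu lam) <=
  10 ^+ 6 * (L * DX / Num.sqrt (mu * eps) + L / mu * logO (L / mu)
    + rk * logO (DY / DX) + DX * Num.sqrt (L / eps) * lo).
Proof.
move=> lamE; have lo1 : 1 <= lo := logO_ge1 _.
have hl : lam + 2 <= 22 * lo by lra.
have := step_charge_le lo1 hl; have := warm_charge_le.
have me0 : 0 <= mu * eps by rewrite mulr_ge0 // ltW.
have s0 : 0 < Num.sqrt (mu * eps) by rewrite sqrtr_gt0 mulr_gt0.
have t1 : tau * rk = 5 * (DX * Num.sqrt (L / eps)).
  rewrite /tau -mulrA -sqrtrM ?divr_ge0 ?(ltW mu0) ?(ltW eps0) //.
  have -> : mu / eps * (L / mu) = L / eps by field; rewrite !gt_eqF.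
  by rewrite mulrA.
have t2 : tau * (L / mu) = 5 * (L * DX / Num.sqrt (mu * eps)).
  have e1 : Num.sqrt (mu / eps) * Num.sqrt (mu * eps) = mu.
    rewrite -sqrtrM ?divr_ge0 ?(ltW mu0) ?(ltW eps0) //.
    have -> : mu / eps * (mu * eps) = mu ^+ 2 by field; rewrite gt_eqF.
    by rewrite sqrtr_sqr ger0_norm // ltW.
  have s1 : 0 < Num.sqrt (mu / eps) by rewrite sqrtr_gt0 divr_gt0.
  rewrite /tau; move: (Num.sqrt (mu / eps)) (Num.sqrt (mu * eps)) s1 s0 e1 => a b a0 b0 <-.
  by field; rewrite !gt_eqF.
have Trk := ler_wpM2r (sqrtr_ge0 (L / mu)) num_iter_le.
have rho0 : 0 <= L / mu by rewrite divr_ge0 // ltW.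
have Trho := ler_wpM2r rho0 num_iter_le; rewrite t1 in Trk; rewrite t2 in Trho.
have lo0 : 0 <= lo by lra.
have Tlo := ler_wpM2r lo0 Trk.
have A0 : 0 <= L * DX / Num.sqrt (mu * eps) by rewrite divr_ge0 ?mulr_ge0 // ltW.
have B0 : 0 <= L / mu * logO (L / mu).
  by rewrite mulr_ge0 //; apply: le_trans (logO_ge1 _).
have C0 : 0 <= rk * logO (DY / DX).
  by rewrite mulr_ge0 ?sqrtr_ge0 //; apply: le_trans (logO_ge1 _).
have T0 : 0 <= num_iter%:R :> R by [].
have D0 : 0 <= DX * Num.sqrt (L / eps) * lo.
  by rewrite mulr_ge0 // mulr_ge0 ?sqrtr_ge0 // ltW.
move: A0 B0 C0 D0 Tlo Trho T0.
move: (L * DX / _) (L / mu * logO _) (rk * logO (DY / DX)) (DX * _) => A B C D.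
move: (L / mu) (num_iter%:R) rk (step_charge _ _ _) (warm_charge _ _ _ _) => r T k Z E.
move=> A0 B0 C0 D0 Tlo Trho T0 hE hZ; have := ler_wpM2l T0 hZ.
have ec : 300 * 1000 <= 10 ^+ 6 :> R.
  have -> : 10 ^+ 6 = 10 ^+ 3 * 10 ^+ 3 :> R by rewrite -exprD.
  have -> : 10 ^+ 3 = 1000 :> R by ring.
  lra.
have := ler_wpM2r A0 ec; have := ler_wpM2r B0 ec.
have := ler_wpM2r C0 ec; have := ler_wpM2r D0 ec.
move: (10 ^+ 6) ec => c _; lra.
Qed.

(** ** With restarts *)

Let z : R := 3 / 2 * (mu * DX ^+ 2) / eps.

Let z_gt0 : 0 < z.
Proof. by rewrite /z divr_gt0 // mulr_gt0 ?divr_gt0 // mulr_gt0 ?exprn_gt0. Qed.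

Definition num_epochs := halvings z.

Lemma num_epochs_le : num_epochs%:R <= 5 * logO (L * DX ^+ 2 / eps).
Proof.
have a0 : 0 < L * DX ^+ 2 / eps by rewrite divr_gt0 ?mulr_gt0 ?exprn_gt0.
have lz : ln z <= 1 + ln (L * DX ^+ 2 / eps).
  have zle : z <= 3 / 2 * (L * DX ^+ 2 / eps).
    rewrite /z [leRHS]mulrA ler_pM2r ?invr_gt0 // ler_pM2l ?divr_gt0 //.
    by rewrite ler_pM2r ?exprn_gt0.
  have h32 : 0 < 3 / 2 :> R by lra.
  apply: (@le_trans _ _ (ln (3 / 2 * (L * DX ^+ 2 / eps)))).
    by rewrite ler_ln ?posrE //; apply: mulr_gt0.
  rewrite [ln (3 / 2 * _)]lnM ?posrE // lerD2r.
  have := @le_ln1Dx R (1 / 2); rewrite (_ : 1 + 1 / 2 = 3 / 2); last by field.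
  by move=> h; have := h ltac:(lra); lra.
have := halvings_le z; rewrite -/num_epochs.
have := ln_le_logO (L * DX ^+ 2 / eps); have := logO_ge1 (L * DX ^+ 2 / eps).
move: (logO _) (ln (L * _ / _)) lz => lo l lz h1 h2.
have : Num.max 0 (ln z) <= 1 + lo by rewrite ge_max; apply/andP; split; lra.
lra.
Qed.

Lemma num_epochs_enough : 3 / 2 * (mu * DX ^+ 2) / 2 ^+ num_epochs <= eps.
Proof.
rewrite ler_pdivrMr ?exprn_gt0 // (mulrC eps) -ler_pdivrMr //.
exact: halvings_ge z_gt0.
Qed.

Section Gamma.
Variable gamma : R.
Hypotheses (gamma0 : 0 < gamma) (gammamu : gamma <= mu).

(** An epoch has to gain a factor 8 mu / gamma <= (6 / 2)^2 mu / gamma, and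
    1 / alpha t >= t / 2. *)
Definition epoch_iter := ceil_nat (6 * Num.sqrt (mu / gamma)).

Let s1 : 1 <= Num.sqrt (mu / gamma).
Proof. by rewrite -sqrtr1 ler_wsqrtr // ler_pdivlMr // mul1r. Qed.

Let ssq : Num.sqrt (mu / gamma) ^+ 2 = mu / gamma.
Proof. by rewrite sqr_sqrtr // divr_ge0 // ltW. Qed.

Lemma epoch_iter_le : epoch_iter%:R <= 7 * Num.sqrt (mu / gamma).
Proof.
have : epoch_iter%:R <= 6 * Num.sqrt (mu / gamma) + 1.
  by apply: ceil_nat_le; rewrite mulr_ge0 ?sqrtr_ge0.
by have := s1; lra.
Qed.

Lemma epoch_iter_enough alpha : step_sizes alpha ->
  8 * mu / gamma <= (alpha epoch_iter)^-1 ^+ 2.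
Proof.
move=> ss; rewrite -mulrA -ssq; have := inv_step_size_ge ss epoch_iter.
have : 6 * Num.sqrt (mu / gamma) <= epoch_iter%:R.
  by apply: ceil_nat_ge; rewrite mulr_ge0 ?sqrtr_ge0.
have := s1.
move: ((alpha _)^-1) (epoch_iter%:R) (Num.sqrt _) => a t s s1' h1 h2.
have h3 : 3 * s <= a by lra.
have : (3 * s) ^+ 2 <= a ^+ 2 by rewrite lerXn2r ?nnegrE //; lra.
by have := sqr_ge0 s; rewrite exprMn; lra.
Qed.

Lemma epoch_log alpha k t : step_sizes alpha -> (k < num_epochs)%N -> (t < epoch_iter)%N ->
  ln (L / 2 * DY ^+ 2 / epoch_schedule DX mu alpha k t.+1) <=
  18 + 2 * logO (mu * L * (DX + DY) ^+ 2 / (gamma * eps)).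
Proof.
move=> ss kK tT; have K0 : 0 < mu * DX ^+ 2 by rewrite mulr_gt0 // exprn_gt0.
have w0 : 0 < (2 ^+ k.+1)^-1 :> R by rewrite invr_gt0 exprn_gt0.
have dl0 : 0 < epoch_schedule DX mu alpha k t.+1.
  exact: (scheduled_accuracy_gt0 ss w0 K0 (epoch_scheduleE DX mu alpha k)).
have := scheduled_accuracy_ge ss w0 K0 (epoch_scheduleE DX mu alpha k) tT.
move: (epoch_schedule _ _ _ _ _) dl0 => dl dl0 hge.
have S0 : 0 < DX + DY by rewrite addr_gt0.
(* 72 * 49 ^ 2 = 16 * 49 ^ 2 * 9 / 2: the fourth power of epoch_iter contributes
   49 ^ 2, and the power of 2 of the epoch 9 = 4 (3 / 2) ^ 2. *)
apply: (@log_accuracy_le _ _ _ (72 * (49 * 49)) _ 18).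
- by rewrite mulr_gt0 ?exprn_gt0 ?divr_gt0.
- exact: dl0.
- lra.
- apply: divr_gt0; last exact: mulr_gt0.
  by rewrite mulr_gt0 ?exprn_gt0 // mulr_gt0.
- have -> : 2 ^+ 18 = 512 * 512 :> R by ring.
  lra.
have T2 : epoch_iter%:R ^+ 2 * gamma <= 49 * mu.
  have h : epoch_iter%:R ^+ 2 <= (7 * Num.sqrt (mu / gamma)) ^+ 2.
    by rewrite lerXn2r ?nnegrE ?mulr_ge0 ?sqrtr_ge0 // epoch_iter_le.
  have e : (7 * Num.sqrt (mu / gamma)) ^+ 2 * gamma = 49 * mu.
    by rewrite exprMn ssq; field; rewrite gt_eqF.
  by rewrite -e ler_wpM2r // ltW.
have T20 : 0 <= epoch_iter%:R ^+ 2 * gamma by rewrite mulr_ge0 ?exprn_ge0 // ltW.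
have T4 : (epoch_iter%:R ^+ 2 * gamma) ^+ 2 <= (49 * mu) ^+ 2.
  by rewrite lerXn2r ?nnegrE // mulr_ge0 // ltW.
have pK : 2 ^+ k.+1 * eps ^+ 2 <= 9 * (mu * DX ^+ 2) ^+ 2.
  have h1 : 2 ^+ k.+1 <= 2 ^+ num_epochs :> R by rewrite ler_eXn2l // ltr1n.
  have h2 := pow_halvings_le z_gt0 (leq_ltn_trans (leq0n k) kK).
  have := ler_wpM2r (sqr_ge0 eps) (le_trans h1 h2).
  have -> : 4 * z ^+ 2 * eps ^+ 2 = 9 * (mu * DX ^+ 2) ^+ 2.
    by rewrite /z; field; rewrite gt_eqF.
  by [].
have {}hge : mu * DX ^+ 2 <= 16 * epoch_iter%:R ^+ 4 * dl * 2 ^+ k.+1.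
  by move: hge; rewrite mulrC ler_pdivrMr ?exprn_gt0.
have e2 : (gamma * eps) ^+ 2 <= 144 * (49 * 49) * mu ^+ 2 * (mu * DX ^+ 2) * dl.
  rewrite -(ler_pM2l K0).
  have g0 : 0 <= (gamma * eps) ^+ 2 := sqr_ge0 _.
  have := ler_wpM2r g0 hge; rewrite exprMn.
  have -> : 16 * epoch_iter%:R ^+ 4 * dl * 2 ^+ k.+1 * (gamma ^+ 2 * eps ^+ 2) =
    16 * dl * ((epoch_iter%:R ^+ 2 * gamma) ^+ 2 * (2 ^+ k.+1 * eps ^+ 2)) by ring.
  have k0 : 0 <= 2 ^+ k.+1 * eps ^+ 2 by rewrite mulr_ge0 ?sqr_ge0 // exprn_ge0.
  have h3 := ler_pM (sqr_ge0 _) k0 T4 pK.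
  have dl16 : 0 <= 16 * dl by lra.
  have := ler_wpM2l dl16 h3; rewrite exprMn; lra.
have -> : dl * ((72 * (49 * 49)) * (mu * L * (DX + DY) ^+ 2 / (gamma * eps)) ^+ 2) =
    (72 * (49 * 49)) * dl * mu ^+ 2 * (L ^+ 2 * ((DX + DY) ^+ 2) ^+ 2) / (gamma * eps) ^+ 2.
  by field; rewrite !gt_eqF.
rewrite ler_pdivlMr ?exprn_gt0 ?mulr_gt0 //.
have q0 : 0 <= L / 2 * DY ^+ 2 by rewrite mulr_ge0 ?exprn_ge0 ?divr_ge0 // ltW.
apply: le_trans (ler_wpM2l q0 e2) _.
have -> : L / 2 * DY ^+ 2 * (144 * (49 * 49) * mu ^+ 2 * (mu * DX ^+ 2) * dl) =
  (72 * (49 * 49)) * dl * mu ^+ 2 * (L * mu * (DX ^+ 2 * DY ^+ 2)) by field.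
have c0 : 0 < (72 * (49 * 49)) * dl by lra.
have c1 : 0 < (72 * (49 * 49)) * dl * mu ^+ 2 := mulr_gt0 c0 (exprn_gt0 2 mu0).
rewrite (ler_pM2l c1); apply: ler_pM S4_ge.
- by rewrite mulr_ge0 // ltW.
- by rewrite mulr_ge0 ?exprn_ge0 // ltW.
by rewrite expr2 ler_pM2l.
Qed.

Lemma restarted_charge_le lam
    (lo := logO (mu * L * (DX + DY) ^+ 2 / (gamma * eps))) (lK := logO (L * DX ^+ 2 / eps)) :
  lam = 18 + 2 * lo ->
  warm_charge DX DY L mu +
    num_epochs%:R * (epoch_iter%:R * (27 * step_charge L mu lam)) <=
  10 ^+ 6 * (L / Num.sqrt (mu * gamma) * lK + L / mu * logO (L / mu)
    + rk * logO (DY / DX) + Num.sqrt (L / gamma) * lo * lK).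
Proof.
move=> lamE; have lo1 : 1 <= lo := logO_ge1 _; have lK1 : 1 <= lK := logO_ge1 _.
have hl : lam + 2 <= 22 * lo by lra.
have := step_charge_le lo1 hl; have := warm_charge_le.
have s0 : 0 < Num.sqrt (mu * gamma) by rewrite sqrtr_gt0 mulr_gt0.
have t1 : Num.sqrt (mu / gamma) * rk = Num.sqrt (L / gamma).
  rewrite -sqrtrM ?divr_ge0 ?(ltW mu0) ?(ltW gamma0) //.
  by congr Num.sqrt; field; rewrite !gt_eqF.
have t2 : Num.sqrt (mu / gamma) * (L / mu) = L / Num.sqrt (mu * gamma).
  have e1 : Num.sqrt (mu / gamma) * Num.sqrt (mu * gamma) = mu.
    rewrite -sqrtrM ?divr_ge0 ?(ltW mu0) ?(ltW gamma0) //.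
    have -> : mu / gamma * (mu * gamma) = mu ^+ 2 by field; rewrite gt_eqF.
    by rewrite sqrtr_sqr ger0_norm // ltW.
  have sg0 : 0 < Num.sqrt (mu / gamma) by apply: lt_le_trans s1.
  move: (Num.sqrt (mu / gamma)) (Num.sqrt (mu * gamma)) sg0 s0 e1 => a b a0 b0 <-.
  by field; rewrite !gt_eqF.
have rho0 : 0 <= L / mu by rewrite divr_ge0 // ltW.
have Trk := ler_wpM2r (sqrtr_ge0 (L / mu)) epoch_iter_le.
have Trho := ler_wpM2r rho0 epoch_iter_le.
rewrite -mulrA t1 in Trk; rewrite -mulrA t2 in Trho.
have lo0 : 0 <= lo by lra.
have Tlo := ler_wpM2r lo0 Trk.
have A0 : 0 <= L / Num.sqrt (mu * gamma) by rewrite divr_ge0 // ltW.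
have B0 : 0 <= L / mu * logO (L / mu).
  by rewrite mulr_ge0 //; apply: le_trans (logO_ge1 _).
have C0 : 0 <= rk * logO (DY / DX).
  by rewrite mulr_ge0 ?sqrtr_ge0 //; apply: le_trans (logO_ge1 _).
have D0 : 0 <= Num.sqrt (L / gamma) * lo by rewrite mulr_ge0 ?sqrtr_ge0.
have T0 : 0 <= epoch_iter%:R :> R by [].
have KT0 : 0 <= num_epochs%:R :> R by [].
have hK : num_epochs%:R <= 5 * lK := num_epochs_le.
move: A0 B0 C0 D0 Tlo Trho T0 KT0 hK.
move: (L / Num.sqrt _) (L / mu * logO _) (rk * logO (DY / DX)) (Num.sqrt (L / gamma)) => A B C D.
move: (L / mu) (epoch_iter%:R) (num_epochs%:R) rk (step_charge _ _ _) (warm_charge _ _ _ _).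
move=> r T K k Z E A0 B0 C0 D0 Tlo Trho T0 KT0 hK hE hZ.
have hTZ : T * (27 * Z) <= 27 * (154 * (D * lo) + 1820 * A).
  by have := ler_wpM2l T0 hZ; lra.
have Z0 : 0 <= 27 * (154 * (D * lo) + 1820 * A) by lra.
have h1 := le_trans (ler_wpM2l KT0 hTZ) (ler_wpM2r Z0 hK).
have lK0 : 0 <= lK by lra.
have ec : 300 * 1000 <= 10 ^+ 6 :> R.
  have -> : 10 ^+ 6 = 10 ^+ 3 * 10 ^+ 3 :> R by rewrite -exprD.
  have -> : 10 ^+ 3 = 1000 :> R by ring.
  lra.
have := ler_wpM2r (mulr_ge0 A0 lK0) ec; have := ler_wpM2r (mulr_ge0 D0 lK0) ec.
have := ler_wpM2r B0 ec; have := ler_wpM2r C0 ec.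
move: (10 ^+ 6) ec => c _; have := mulr_ge0 A0 lK0; have := mulr_ge0 D0 lK0; lra.
Qed.

End Gamma.
End ParameterChoice.

Theorem theorem4 (R : realType) :
  exists C : R, 0 < C /\
  forall DX DY L mu eps : R,
  0 < DX -> 0 < DY -> 0 < mu -> mu <= L -> 0 < eps ->
  (exists (T W N : nat) (nagd : R -> nat),
    [/\ T%:R <= C * (DX * Num.sqrt (mu / eps)),
        W%:R <= C * logO (L / mu),
        N%:R <= C * (L / mu) &
    forall (d m : nat) (X : set 'rV[R]_d) (Y : set 'rV[R]_m)
      (f : 'rV[R]_d -> 'rV[R]_m -> R) (g : oracle R d m)
      (x_init : 'rV[R]_d) (y_init : 'rV[R]_m) (alpha : nat -> R)
      (dO : measure_display) (Omega : measurableType dO)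
      (P : probability Omega R) (J : nat -> {RV P >-> nat}),
    minimax_problem X Y DX DY L mu f g ->
    X x_init -> Y y_init -> step_sizes alpha -> level_samples J ->
    let run w := recapp X Y g L mu DX x_init y_init nagd W N alpha T
                   (fun i => J i w) in
    [/\ agd_accurate X Y f g L mu nagd,
        forall w, X (run w).1,
        ('E_P[fun w => maxF Y f (run w).1] - (minF X Y f)%:E <= eps%:E)%E &
        ('E_P[fun w => (run w).2%:R] <=
          (C * (L * DX / Num.sqrt (mu * eps)
                + L / mu * logO (L / mu)
                + Num.sqrt (L / mu) * logO (DY / DX)
                + DX * Num.sqrt (L / eps)
                  * logO (L * (DX + DY) ^+ 2 / eps)))%:E)%E]]) /\
  (forall gamma : R, 0 < gamma -> gamma <= mu ->
   exists (T K W N : nat) (nagd : R -> nat),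
    [/\ T%:R <= C * Num.sqrt (mu / gamma),
        K%:R <= C * logO (L * DX ^+ 2 / eps),
        W%:R <= C * logO (L / mu),
        N%:R <= C * (L / mu) &
    forall (d m : nat) (X : set 'rV[R]_d) (Y : set 'rV[R]_m)
      (f : 'rV[R]_d -> 'rV[R]_m -> R) (g : oracle R d m)
      (x_init : 'rV[R]_d) (y_init : 'rV[R]_m) (alpha : nat -> R)
      (dO : measure_display) (Omega : measurableType dO)
      (P : probability Omega R) (J : nat -> {RV P >-> nat}),
    minimax_problem X Y DX DY L mu f g ->
    strongly_convex X (maxF Y f) (gradF Y f g) gamma ->
    X x_init -> Y y_init -> step_sizes alpha -> level_samples J ->
    let run w := restarted_recapp X Y g L mu DX x_init y_init nagd W N alpha
                   T K (fun i => J i w) in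
    [/\ agd_accurate X Y f g L mu nagd,
        forall w, X (run w).1,
        ('E_P[fun w => maxF Y f (run w).1] - (minF X Y f)%:E <= eps%:E)%E &
        ('E_P[fun w => (run w).2%:R] <=
          (C * (L / Num.sqrt (mu * gamma) * logO (L * DX ^+ 2 / eps)
                + L / mu * logO (L / mu)
                + Num.sqrt (L / mu) * logO (DY / DX)
                + Num.sqrt (L / gamma)
                  * logO (mu * L * (DX + DY) ^+ 2 / (gamma * eps))
                  * logO (L * DX ^+ 2 / eps)))%:E)%E]]).
Proof.
(* A round number above all constants that the parts of the bound need. *)
have c1 : 300 * 1000 <= 10 ^+ 6 :> R.
  have -> : 10 ^+ 6 = 10 ^+ 3 * 10 ^+ 3 :> R by rewrite -exprD.
  have -> : 10 ^+ 3 = 1000 :> R by ring.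
  lra.
have cle (a x y : R) : a <= 1000 -> 0 <= y -> x <= a * y -> x <= 10 ^+ 6 * y.
  move=> a1 y0 /le_trans; apply; apply: ler_wpM2r => //; lra.
exists (10 ^+ 6); split; first by rewrite exprn_gt0.
move=> DX DY L mu eps DX0 DY0 mu0 muL eps0.
have L0 : 0 < L := lt_le_trans mu0 muL.
have lrho0 := le_trans ler01 (logO_ge1 (L / mu)).
have rho0 : 0 <= L / mu by rewrite divr_ge0 // ltW.
have hW : (warm_steps L mu)%:R <= 10 ^+ 6 * logO (L / mu).
  by apply: (cle 4) => //; [lra | exact: warm_steps_le].
have hN : (prox_steps L mu)%:R <= 10 ^+ 6 * (L / mu).
  by apply: (cle 129) => //; [lra | exact: prox_steps_le].
split.
  exists (num_iter DX mu eps), (warm_steps L mu), (prox_steps L mu), (agd_steps DY L mu).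
  split => //.
    apply: (cle 5); [lra | by rewrite mulr_ge0 ?sqrtr_ge0 // ltW |].
    by rewrite mulrA; exact: num_iter_le.
  move=> d m X Y f g x_init y_init alpha dO Omega P J pb Xinit Yinit ss HJ run.
  split.
  - exact: agd_steps_accurate pb mu0 muL DY0.
  - by move=> w; exact: (recapp_in pb DX0 DY0 mu0 muL Xinit Yinit ss).
  - apply: (recapp_gap pb DX0 DY0 mu0 muL Xinit Yinit ss HJ).
    exact: num_iter_enough.
  have lam0 : 0 <= 13 + 2 * logO (L * (DX + DY) ^+ 2 / eps).
    by have := logO_ge1 (L * (DX + DY) ^+ 2 / eps); lra.
  apply: le_trans (recapp_cost X Y g DX0 DY0 mu0 muL x_init y_init ss HJ lam0 _) _.
    by move=> t; exact: num_iter_log.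
  by rewrite lee_fin; exact: recapp_charge_le.
move=> gamma gamma0 gammamu.
exists (epoch_iter mu gamma), (num_epochs DX mu eps), (warm_steps L mu),
  (prox_steps L mu), (agd_steps DY L mu).
split => //.
- by apply: (cle 7); [lra | exact: sqrtr_ge0 | exact: epoch_iter_le].
- apply: (cle 5); [lra | exact: le_trans ler01 (logO_ge1 _) |].
  exact: num_epochs_le.
move=> d m X Y f g x_init y_init alpha dO Omega P J pb Fsc Xinit Yinit ss HJ run.
split.
- exact: agd_steps_accurate pb mu0 muL DY0.
- by move=> w; exact: (restarted_in pb DX0 DY0 mu0 muL Xinit Yinit ss).
- apply: (restarted_gap pb DX0 DY0 mu0 muL Xinit Yinit ss HJ gamma0 gammamu Fsc).
    exact: epoch_iter_enough.
  exact: num_epochs_enough.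
have lam0 : 0 <= 18 + 2 * logO (mu * L * (DX + DY) ^+ 2 / (gamma * eps)).
  by have := logO_ge1 (mu * L * (DX + DY) ^+ 2 / (gamma * eps)); lra.
apply: le_trans (restarted_cost X Y g DX0 DY0 mu0 muL x_init y_init ss HJ lam0 _) _.
  by move=> k t; exact: epoch_log.
by rewrite lee_fin; exact: restarted_charge_le.
Qed.
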